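(* Let $X$ be an infinite dimensional Banach space with an unconditional basis. Then $S(X)$ and $S(\ell_1)$ are uniformly homeomorphic if and only if $X$ does not contain $\ell_\infty^n$ uniformly in $n$.
   Context: Banach spaces are real. $S(X)$ is the unit sphere of $X$ with the metric induced by the norm. A uniform homeomorphism between two metric spaces is an invertible map such that both the map and its inverse are uniformly continuous; two metric spaces are uniformly homeomorphic if such a map exists. $X$ contains $\ell_\infty^n$ uniformly in $n$ if there is a constant $C<\infty$ such that for every $n\in\mathbb{N}$ there is an $n$-dimensional subspace of $X$ whose Banach–Mazur distance to $\ell_\infty^n$ is at most $C$. *)

(* Defs.v *)
From HB Require Import structures.
From mathcomp Require Import all_boot all_order all_algebra.
From mathcomp Require Import all_classical all_reals all_analysis.

Set Implicit Arguments.
Unset Strict Implicit.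
Unset Printing Implicit Defensive.

Import Order.TTheory GRing.Theory Num.Theory.
Import numFieldNormedType.Exports.

Local Open Scope classical_set_scope.
Local Open Scope ring_scope.

(* The carrier S(V) is the type [set_type (unit_sphere V)], on which the
   library puts the uniform structure induced from V. *)
Definition unit_sphere (R : realType) (V : normedModType R) : set V :=
  [set x | `|x| = 1].
Arguments unit_sphere {R} V _.

Definition uniformly_homeomorphic (U V : uniformType) : Prop :=
  exists (f : U -> V) (g : V -> U),
    [/\ cancel f g, cancel g f, unif_continuous f & unif_continuous g].

(* The uniform structure on S(V) is the one of the metric `|x - y|. *)
Lemma unif_continuous_sphereP (R : realType) (V W : normedModType R)
    (f : unit_sphere V -> unit_sphere W) :
  unif_continuous f <->
  forall e : R, 0 < e -> exists2 d : R, 0 < d &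
    forall x y : unit_sphere V,
      `|set_val x - set_val y| < d -> `|set_val (f x) - set_val (f y)| < e.
Proof.
have ballS (A : normedModType R) (x y : unit_sphere A) (r : R) :
    ball x r y = (`|set_val x - set_val y| < r) :> Prop.
  change (ball (set_val x) r (set_val y) =
          (`|set_val x - set_val y| < r) :> Prop).
  by rewrite -ball_normE.
rewrite unif_continuousP; split=> h e e0; have [d d0 hd] := h e e0.
  by exists d => // x y; have := hd (x, y); rewrite !ballS.
by exists d => // -[x y]; rewrite !ballS; exact: hd.
Qed.

Section ell1.
Context {R : realType}.

Definition ell1_pred : {pred nat -> R} :=
  mem [set a : nat -> R | cvgn (series (fun k => `|a k|))].

Lemma ell1_submod_closed : submod_closed ell1_pred.
Proof.
split.
  rewrite inE/= (_ : series _ = cst 0); first exact: is_cvg_cst.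
  by apply/funext => n; rewrite /series/= big1// => i _; rewrite normr0.
move=> c a b; rewrite !inE/= => ca cb.
pose v k := `|c| * `|a k| + `|b k|.
apply: (@series_le_cvg R _ v) => [k|k|k|].
- exact: normr_ge0.
- by rewrite addr_ge0// mulr_ge0.
- by rewrite /v -normrM; exact: ler_normD.
have -> : series v =
    (fun n => `|c| * series (fun k => `|a k|) n + series (fun k => `|b k|) n).
  by apply/funext => n; rewrite /series/= /v big_split/= mulr_sumr.
by apply: is_cvgD => //; apply: is_cvgMl_tmp.
Qed.

HB.instance Definition _ :=
  GRing.isSubmodClosed.Build R (nat -> R) ell1_pred ell1_submod_closed.

Record ell1 := Ell1 { ell1_val :> nat -> R ; _ : ell1_val \in ell1_pred }.

HB.instance Definition _ := [isSub for ell1_val].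
HB.instance Definition _ := [Choice of ell1 by <:].
HB.instance Definition _ := [SubChoice_isSubLmodule of ell1 by <:].

Definition ell1_norm (a : ell1) : R := limn (series (fun k => `|a k|)).

Lemma ell1_cvg (a : ell1) : cvgn (series (fun k => `|a k|)).
Proof. by have := valP a; rewrite inE. Qed.

Lemma ell1_normD (a b : ell1) : ell1_norm (a + b) <= ell1_norm a + ell1_norm b.
Proof.
rewrite /ell1_norm -limD; [|exact: ell1_cvg|exact: ell1_cvg].
apply: ler_lim; first exact: ell1_cvg.
  by apply: is_cvgD; exact: ell1_cvg.
apply: nearW => n.
rewrite [leRHS](_ : _ = series (fun k => `|a k| + `|b k|) n); last first.
  by rewrite /series/= big_split.
by apply: ler_sum => k _; exact: ler_normD.
Qed.

Lemma ell1_normZ (c : R) (a : ell1) : ell1_norm (c *: a) = `|c| * ell1_norm a.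
Proof.
apply: cvg_lim => //.
have -> : series (fun k => `|(c *: a) k|) =
    (fun n => `|c| * series (fun k => `|a k|) n).
  apply/funext => n; rewrite /series/= mulr_sumr.
  by apply: eq_bigr => k _; exact: normrM.
by apply: cvgMl_tmp; exact: ell1_cvg.
Qed.

Lemma ell1_norm0_eq0 (a : ell1) : ell1_norm a = 0 -> a = 0.
Proof.
move=> a0; apply/val_inj/funext => k; apply/eqP.
have nd : nondecreasing_seq (series (fun k => `|a k|)).
  by apply: nondecreasing_series => n _; rewrite normr_ge0.
have := nondecreasing_cvgn_le nd (@ell1_cvg a) k.+1.
rewrite -/(ell1_norm a) a0 -normr_le0; apply: le_trans.
rewrite /series/= big_nat_recr//= lerDr.
by apply: sumr_ge0 => i _; exact: normr_ge0.
Qed.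

HB.instance Definition _ :=
  Lmodule_isNormed.Build R ell1 ell1_normD ell1_normZ ell1_norm0_eq0.

Lemma ell1_normE (a : ell1) : `|a| = limn (series (fun k => `|a k|)).
Proof. by []. Qed.

End ell1.
Arguments ell1 : clear implicits.

Section bases.
Context {R : realType} (X : normedModType R).

Definition schauder_basis (e : nat -> X) : Prop :=
  forall x : X, exists! a : nat -> R,
    series (fun k => a k *: e k) @ \oo --> x.

Definition unconditionally_cvg (u : nat -> X) : Prop :=
  forall s : nat -> nat, bijective s -> cvgn (series (u \o s)).

Definition unconditional_basis (e : nat -> X) : Prop :=
  schauder_basis e /\
  forall a : nat -> R, cvgn (series (fun k => a k *: e k)) ->
    unconditionally_cvg (fun k => a k *: e k).

End bases.

(* The set E is an n-dimensional linear subspace of V: it is the linear span of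
   n linearly independent vectors. *)
Definition has_dimension (R : realType) (V : lmodType R) (n : nat)
    (E : set V) : Prop :=
  exists b : 'I_n -> V,
    (forall a : 'I_n -> R, \sum_i a i *: b i = 0 -> forall i, a i = 0) /\
    E = [set \sum_i a i *: b i | a in [set: 'I_n -> R]].

Definition infinite_dimensional (R : realType) (V : lmodType R) : Prop :=
  forall n, ~ has_dimension n [set: V].

Section banach_mazur.
Context {R : realType} {V W : normedModType R}.

Definition opnorm_on (E : set V) (T : V -> W) : \bar R :=
  ereal_sup [set `|T x|%:E | x in [set x | E x /\ `|x| <= 1]].

Definition linear_on (E : set V) (T : V -> W) : Prop :=
  forall (c : R) (x y : V), E x -> E y -> T (c *: x + y) = c *: T x + T y.

End banach_mazur.

(* T restricts to a linear bijection from E onto F, with inverse T'. *)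
Definition linear_iso_on (R : realType) (V W : normedModType R)
    (E : set V) (F : set W) (T : V -> W) (T' : W -> V) : Prop :=
  [/\ linear_on E T, set_fun E F T, set_fun F E T',
      {in E, cancel T T'} & {in F, cancel T' T}].

(* Infimum of the norms ||T|| ||T^-1||; it is +oo when E and F are not
   isomorphic. *)
Definition banach_mazur_dist (R : realType) (V W : normedModType R)
    (E : set V) (F : set W) : \bar R :=
  ereal_inf [set z | exists (T : V -> W) (T' : W -> V),
    linear_iso_on E F T T' /\ z = (opnorm_on E T * opnorm_on F T')%E].

(* The norm of 'rV[R]_n is the maximum of the absolute values of the
   coordinates, so that this space is ell_infty^n. *)
Definition contains_linfty_uniformly (R : realType) (X : normedModType R) :
    Prop :=
  exists C : R, forall n : nat, exists E : set X,
    has_dimension n E /\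
    (banach_mazur_dist E [set: 'rV[R]_n] <= C%:E)%E.

(* Main.v *)
(** If [X] does not contain [ell_infty^n] uniformly, disjoint vectors of the
    basis satisfy a lower [q]-estimate, and [X] has an equivalent norm [N] which
    is monotone in the coordinates and concave of power [Q]:
    [N a ^ Q + N b ^ Q <= N ((a ^ Q + b ^ Q) ^ (1 / Q)) ^ Q]. Send [x] in the
    sphere of [N] to [h = sgn x |x| f] in [S(ell_1)], with [f >= 0] norming [|x|]
    (Lozanovskii factorisation). Concavity applied to [(1 + t th) x] and
    [(1 - t th) x], with [th] a sequence of signs, makes [N] uniformly smooth
    under multiplicative perturbations, so [h] depends uniformly continuously on
    [x]. Conversely, for [x, x' >= 0] the geometric mean [m] of [x] and [x']
    satisfies [sum min (h, h') <= N m], while the half-sum [s] and the half-difference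
    [d] satisfy [s ^ 2 = m ^ 2 + d ^ 2], whence [N m ^ Q + N d ^ Q <= N s ^ Q <= 1]:
    if [h] and [h'] are close, then [N d] is small. These estimates do not depend
    on the dimension, so it suffices to treat finitely supported vectors, where
    [h] comes from Hahn-Banach and [x] maximises [sum |h| ln x].

    If [X] contains [ell_infty^n] uniformly, the torus [(Z / 4r)^n] maps to [S(X)]
    with diagonal steps [(+-1, ..., +-1)] of size [O(1 / r)] and antipodes in one
    coordinate at a distance bounded below. A uniform homeomorphism of [S(X)]
    with [S(ell_1)], followed by the Mazur map into [ell_2], then contradicts, for
    large [n], the inequality bounding the mean displacement along half a period
    of one coordinate by that along the diagonals, up to [O(r ^ 2 / n)]. *)

Require Import Defs.
From HB Require Import structures.
From mathcomp Require Import all_boot all_order all_algebra.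
From mathcomp Require Import all_classical all_reals all_analysis.
From mathcomp Require Import ring lra.
Import Order.TTheory GRing.Theory Num.Theory.
Import numFieldNormedType.Exports.
Local Open Scope classical_set_scope.
Local Open Scope ring_scope.

Set Implicit Arguments.
Unset Strict Implicit.
Unset Printing Implicit Defensive.

(** * Lozanovskii pairs *)

(** Excluding [ell_infty^n] only says something about disjoint vectors, while the estimates on pairs
    need concavity for arbitrary splittings and with constant exactly 1: they live on the smallness
    of [1 - (1 - D) ^ Q], which a larger constant would drown. Three devices bridge this gap. If [d]
    disjoint pieces always double the norm, only polynomially many pieces of a given size fit into
    the unit ball. Random choices among level sets reduce arbitrary splittings to disjoint ones, at
    the price of doubling the exponent. A supremum over all splittings absorbs the constant.

    Neither the norming functional nor the maximiser is known beforehand to be unique, so [x] and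
    [h] are linked by a relation, and the two uniform estimates turn its closure into the graph of a
    homeomorphism.

    Unconditionality is given by rearrangements, one series at a time; a bound on multipliers common
    to all series needs a category argument.

    In the converse, orthogonality in [ell_2] is decisive: by Bessel, a bounded function has a fixed
    amount of variation to share among all [n] directions, whereas in the sup norm a diagonal step
    costs no more than a step in one coordinate. *)

Section lattice_norms.
Context {R : realType}.
Implicit Types (N : (nat -> R) -> R) (a b c x y h : nat -> R).

(** Norms on [R^n] are coded on infinite sequences so that different [n] can be compared without
    casts. [latnorm_le] looks only at indices below [n], hence also forces [N] to ignore signs and
    all later entries. *)
Record lattice_norm (n : nat) N : Prop := LatticeNorm {
  latnormD : forall a b, N (fun i => a i + b i) <= N a + N b ;
  latnormZ : forall (k : R) a, N (fun i => k * a i) = `|k| * N a ;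
  latnorm_le : forall a b, (forall i, (i < n)%N -> `|a i| <= `|b i|) ->
    N a <= N b ;
  latnorm0_eq0 : forall a, N a = 0 -> forall i, (i < n)%N -> a i = 0 }.

(** This is lattice [Q]-concavity with constant 1. Quantifying over every dominating [c] avoids
    forming a [Q]-th root coordinate by coordinate. *)
Definition power_concave (n Q : nat) N : Prop :=
  forall a b c,
    (forall i, (i < n)%N -> `|a i| ^+ Q + `|b i| ^+ Q <= `|c i| ^+ Q) ->
  N a ^+ Q + N b ^+ Q <= N c ^+ Q.

(* [|h| = |x| f] where [f] is a functional norming [|x|]; multiplying the test
   vectors by [x] avoids dividing by the coordinates of [x]. *)
Definition lozanovskii_pair (n : nat) N x h : Prop :=
  [/\ N x = 1, \sum_(i < n) `|h i| = 1,
      forall i, (i < n)%N -> h i = Num.sg (x i) * `|h i| &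
      forall y, \sum_(i < n) `|h i| * y i <= N (fun i => y i * x i)].

Section theory.
Variables (n : nat) (N : (nat -> R) -> R).
Hypothesis latN : lattice_norm n N.

Lemma latnorm_eq a b : (forall i, (i < n)%N -> `|a i| = `|b i|) -> N a = N b.
Proof.
by move=> ab; apply/eqP; rewrite eq_le !(latnorm_le latN)// => i /ab ->.
Qed.

Lemma latnorm0 : N (fun=> 0) = 0.
Proof.
rewrite -[LHS](_ : N (fun i => 0 * 0) = _); last by congr N; apply/funext => i; rewrite mul0r.
by rewrite (latnormZ latN) normr0 mul0r.
Qed.

Lemma latnorm_ge0 a : 0 <= N a.
Proof.
by rewrite -latnorm0; apply: (latnorm_le latN) => i _; rewrite normr0.
Qed.

Lemma latnorm_sum (I : Type) (r : seq I) (P : pred I) (a : I -> nat -> R) :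
  N (fun i => \sum_(j <- r | P j) a j i) <= \sum_(j <- r | P j) N (a j).
Proof.
elim: r => [|k r IH].
  rewrite big_nil (_ : (fun i => _) = fun=> 0) ?latnorm0//.
  by apply/funext => i; rewrite big_nil.
rewrite big_cons; case: ifPn => Pk.
  apply: le_trans (lerD (lexx _) IH); apply: le_trans (latnormD latN _ _).
  by rewrite le_eqVlt; apply/orP; left; apply/eqP; congr N; apply/funext => i; rewrite big_cons Pk.
apply: le_trans IH; rewrite le_eqVlt; apply/orP; left; apply/eqP.
by congr N; apply/funext => i; rewrite big_cons (negbTE Pk).
Qed.

Lemma latnormN a : N (fun i => - a i) = N a.
Proof. by apply: latnorm_eq => i _; rewrite normrN. Qed.

End theory.

Lemma bernoulli_ge1 (Q : nat) (u : R) : -1 <= u -> 1 + Q%:R * u <= (1 + u) ^+ Q.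
Proof.
move=> u1; elim: Q => [|Q IH]; first by rewrite mul0r addr0.
rewrite exprS (@le_trans _ _ ((1 + u) * (1 + Q%:R * u)))//; last first.
  by rewrite ler_wpM2l//; lra.
rewrite -natr1; have : 0 <= Q%:R * u ^+ 2 by rewrite mulr_ge0 ?sqr_ge0.
by rewrite expr2; nra.
Qed.

(** Added at [t] and [- t], the linear terms cancel: this produces the quadratic error in the
    smoothness estimate. *)
Lemma expr1D_le (Q : nat) : exists2 C : R, 0 <= C & forall t : R, `|t| <= 1 ->
  (1 + t) ^+ Q <= 1 + Q%:R * t + C * t ^+ 2.
Proof.
elim: Q => [|Q [C C0 IH]].
  by exists 0 => // t _; rewrite expr0 !mul0r !addr0.
exists (Q%:R + 2 * C); first by have := ler0n R Q; lra.
move=> t t1; have := t1; rewrite ler_norml => /andP[t1l t1r].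
rewrite exprS (@le_trans _ _ ((1 + t) * (1 + Q%:R * t + C * t ^+ 2)))//.
  by rewrite ler_wpM2l ?IH//; lra.
rewrite -natr1.
have : C * t * t ^+ 2 <= C * t ^+ 2 by rewrite ler_wpM2r ?sqr_ge0// ler_piMr.
rewrite !expr2; lra.
Qed.

Lemma exprn_root (Q : nat) (a : R) : (0 < Q)%N -> 0 <= a ->
  exists2 k : R, 0 <= k & k ^+ Q = a.
Proof.
move=> Q0 a0; exists (a `^ (Q%:R^-1)); first exact: powR_ge0.
by rewrite -powR_mulrn ?powR_ge0// -powRrM mulVf ?powRr1// pnatr_eq0 -lt0n.
Qed.

(** Comparing signed sequences reduces to comparing moduli, plus the mass sitting where the signs
    are opposite: there [a + a'] is at most [|a - a'| + 2 * a]. The two implications handle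
    [Num.sg 0 = 0]. *)
Lemma sgr_dist (x x' a a' : R) : 0 <= a -> 0 <= a' ->
  (x = 0 -> a = 0) -> (x' = 0 -> a' = 0) ->
  `|Num.sg x * a - Num.sg x' * a'| <= `|a - a'| + 2 * (a * (x * x' < 0)%R%:R).
Proof.
move=> a0 a0' xa xa'; case: ltP => xx.
  rewrite mulr1; have : a + a' <= `|a - a'| + 2 * a by case: (ger0P (a - a')); lra.
  apply: le_trans; rewrite (le_trans (ler_normB _ _))// !normrM.
  by rewrite lerD// (ger0_norm a0, ger0_norm a0') ler_piMl// normr_sg; case: eqP.
rewrite !mulr0 addr0.
have [x0|x0|x0] := ltrgtP x 0; have [x0'|x0'|x0'] := ltrgtP x' 0.
all: rewrite ?(gtr0_sg x0) ?(gtr0_sg x0') ?(ltr0_sg x0) ?(ltr0_sg x0').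
all: rewrite ?(xa x0) ?(xa' x0') ?mulr0 ?mul1r ?mulN1r ?subr0 ?sub0r ?opprK ?normrN ?normr0//.
- by rewrite addrC distrC.
- nra.
- nra.
Qed.

(** The functional norming [x'] is tested at [1 + t * th] and the one norming [x] at [1 - t * th],
    where [th] is the sign of [|h'| - |h|]; smoothness bounds the sum. The parameter [t] stays free:
    it is fixed small first, and only then is [x'] taken close to [x]. *)
Lemma lozanovskii_unif_left (Q : nat) : (0 < Q)%N ->
  exists2 C : R, 0 <= C & forall n N x h x' h', lattice_norm n N ->
    power_concave n Q N -> lozanovskii_pair n N x h ->
    lozanovskii_pair n N x' h' -> forall t, 0 < t <= 1 ->
    \sum_(i < n) `|h i - h' i| <= C * t + 4 * N (fun i => x i - x' i) / t.
Proof.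
move=> Q0; have [C C0 HC] := expr1D_le Q; exists (2 * C) => [|n N x h x' h' latN cN]; first lra.
move=> [Nx h1 hs hN] [Nx' h1' hs' hN'] t /andP[t0 t1].
set e := N _; have e0 : 0 <= e by exact: latnorm_ge0 latN _.
have smooth (th : nat -> R) : (forall i, `|th i| = 1) ->
  N (fun i => (1 + t * th i) * x i) + N (fun i => (1 - t * th i) * x i) <= 2 + 2 * C * t ^+ 2.
  move=> th1.
  (* Since [th i] is a sign, the two [Q]-th powers at a coordinate add up to [k ^+ Q * |x i| ^+ Q]
     in either case, so concavity applies with [k * x] as the dominating vector. *)
  have [k k0 kQ] : exists2 k : R, 0 <= k & k ^+ Q = (1 + t) ^+ Q + (1 - t) ^+ Q.
    by apply: exprn_root => //; rewrite addr_ge0// exprn_ge0; lra.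
  have := cN (fun i => (1 + t * th i) * x i) (fun i => (1 - t * th i) * x i)
     (fun i => k * x i).
  rewrite (latnormZ latN) Nx mulr1 (ger0_norm k0) kQ.
  have hyp : forall i, (i < n)%N -> `|(1 + t * th i) * x i| ^+ Q +
      `|(1 - t * th i) * x i| ^+ Q <= `|k * x i| ^+ Q.
    move=> i _; rewrite !normrM (ger0_norm k0) !exprMn kQ -mulrDl ler_wpM2r ?exprn_ge0//.
    have : th i = 1 \/ th i = -1.
      have := th1 i; case: (ger0P (th i)) => _ ?; [by left | by right; lra].
    have p1 : 0 <= 1 + t by lra.
    have p2 : 0 <= 1 - t by lra.
    by case=> ->; rewrite ?mulrN1 ?mulr1 ?opprK (ger0_norm p1) (ger0_norm p2)// addrC.
  move=> /(_ hyp).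
  set A := N _; set B := N _ => AB.
  have A0 : 0 <= A by exact: latnorm_ge0 latN _.
  have B0 : 0 <= B by exact: latnorm_ge0 latN _.
  have hA : 1 + Q%:R * (A - 1) <= A ^+ Q.
    have -> : A ^+ Q = (1 + (A - 1)) ^+ Q by congr (_ ^+ _); ring.
    by apply: bernoulli_ge1; lra.
  have hB : 1 + Q%:R * (B - 1) <= B ^+ Q.
    have -> : B ^+ Q = (1 + (B - 1)) ^+ Q by congr (_ ^+ _); ring.
    by apply: bernoulli_ge1; lra.
  have tt : `|t| <= 1 by rewrite ger0_norm//; lra.
  have ht1 := HC t tt; have := HC (- t); rewrite normrN sqrrN => /(_ tt) ht2.
  have Q1 : (1 : R) <= Q%:R by rewrite ler1n.
  have : Q%:R * (A + B - 2) <= 2 * C * t ^+ 2 by lra.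
  have t2 : 0 <= t ^+ 2 by exact: sqr_ge0.
  have Ct : 0 <= 2 * C * t ^+ 2 by rewrite mulr_ge0// mulr_ge0.
  have [ab|ab] := lerP (A + B - 2) 0; first by move=> _; lra.
  have : A + B - 2 <= Q%:R * (A + B - 2) by rewrite ler_peMl// ltW.
  lra.
pose th i : R := if `|h i| <= `|h' i| then 1 else -1.
have th1 i : `|th i| = 1 by rewrite /th; case: ifP; rewrite ?normrN normr1.
have S1 : \sum_(i < n) `| `|h i| - `|h' i| | <= 2 * C * t + 2 * e / t.
  have -> : \sum_(i < n) `| `|h i| - `|h' i| | =
      \sum_(i < n) `|h' i| * th i - \sum_(i < n) `|h i| * th i.
    rewrite -sumrB; apply: eq_bigr => i _; rewrite /th -mulrBl; by case: lerP => hh; ring.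
  have a1 := hN' (fun i => 1 + t * th i).
  have a2 := hN (fun i => 1 - t * th i).
  have a3 := smooth _ th1.
  (* Replacing [x'] by [x] inside the norm costs [(1 + t) * e], so that [smooth], which concerns [x]
     alone, can be used. *)
  have a4 : N (fun i => (1 + t * th i) * x' i) <=
            N (fun i => (1 + t * th i) * x i) + (1 + t) * e.
    have -> : (fun i => (1 + t * th i) * x' i) = 
      (fun i => (1 + t * th i) * x i + (1 + t * th i) * (x' i - x i)).
      by apply/funext => i; ring.
    apply: le_trans (latnormD latN _ _) (lerD (lexx _) _).
    rewrite -[X in X * e](@ger0_norm _ (1 + t)); last lra.
    rewrite -(latnormZ latN); apply: (latnorm_le latN) => i _.
    rewrite !normrM distrC ler_wpM2r// (@ger0_norm _ (1 + t)); last lra.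
    by rewrite (le_trans (ler_normD _ _))// normr1 normrM th1 mulr1 gtr0_norm.
  have e1 (g : nat -> R) (k : R) : \sum_(i < n) `|g i| = 1 ->
      \sum_(i < n) `|g i| * (1 + k * th i) = 1 + k * \sum_(i < n) `|g i| * th i.
    move=> g1; rewrite -[in RHS]g1 mulr_sumr -big_split/=.
    by apply: eq_bigr => i _; ring.
  rewrite e1// in a1; have := e1 h (- t) h1.
  under eq_bigr do rewrite mulNr.
  move=> e2; rewrite e2 in a2.
  set X := \sum_(i < n) `|h' i| * th i in a1 *.
  set Y := \sum_(i < n) `|h i| * th i in a2 *.
  have : t * (X - Y) <= 2 * C * t ^+ 2 + 2 * e by nra.
  rewrite mulrC -ler_pdivlMr// => /le_trans; apply.
  have -> : 2 * C * t ^+ 2 = 2 * C * t * t by ring.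
  by rewrite mulrDl mulfK ?gt_eqF.
pose B i := x i * x' i < 0.
(* The functional of [x] is tested on the indicator of [B]: where the signs are opposite, [|x i|] is
   at most [|x i - x' i|]. *)
have S2 : \sum_(i < n) `|h i| * (B i)%:R <= e.
  apply: le_trans (hN (fun i => (B i)%:R)) _; apply: (latnorm_le latN) => i _.
  rewrite /B; case: ltP => xx /=; last by rewrite mul0r normr0.
  rewrite mul1r; case: (ltrP 0 (x i)) => x0.
    rewrite !gtr0_norm//; nra.
  rewrite !ler0_norm//; nra.
have S3 : \sum_(i < n) `|h i - h' i| <=
    \sum_(i < n) (`| `|h i| - `|h' i| | + 2 * (`|h i| * (B i)%:R)).
  apply: ler_sum => i _.
  have ni := ltn_ord i.
  rewrite {1}hs// {1}hs'//; apply: sgr_dist => //.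
    by move=> x0; rewrite hs// x0 sgr0 mul0r normr0.
  by move=> x0; rewrite hs'// x0 sgr0 mul0r normr0.
apply: (le_trans S3); rewrite big_split/= -mulr_sumr.
have : 0 < t by [].
have : 2 * e <= 2 * e / t by rewrite ler_pdivlMr// ler_piMr//; lra.
lra.
Qed.

End lattice_norms.

(** * From close [h] back to close [x] *)

Section lozanovskii_unif_right.
Context {R : realType}.
Implicit Types (N : (nat -> R) -> R) (x h : nat -> R).

Lemma exprDsq_ge (q : nat) (m d : R) : (0 < q)%N -> 0 <= m -> 0 <= d ->
  m ^+ q + d ^+ q <= (m + d) ^+ q.
Proof.
case: q => // q _ m0 d0; elim: q => [|q IH]; first by rewrite !expr1.
rewrite exprS [d ^+ _]exprS [leRHS]exprS mulrDl lerD// ler_wpM2l//.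
  by rewrite lerXn2r ?nnegrE ?addr_ge0// lerDl.
by rewrite lerXn2r ?nnegrE ?addr_ge0// lerDr.
Qed.

(** Test [h] on [y = sqrt (|x'| / |x|)] and [h'] on the inverse ratio: both products with the
    vectors are the geometric mean. As [y * y' = 1], the sum [y + y'] is at least 2, which leaves
    twice the smaller of [|h|] and [|h'|]. *)
Lemma lozanovskii_geometric n N x h x' h' : lattice_norm n N ->
  lozanovskii_pair n N x h -> lozanovskii_pair n N x' h' ->
  1 - (\sum_(i < n) `|h i - h' i|) / 2 <=
  N (fun i => Num.sqrt (`|x i| * `|x' i|)).
Proof.
move=> latN [Nx h1 hs hN] [Nx' h1' hs' hN'].
pose y i := Num.sqrt (`|x' i| / `|x i|).
pose y' i := Num.sqrt (`|x i| / `|x' i|).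
set M := N _.
have key (a b : R) : `|Num.sqrt (`|b| / `|a|) * a| <= `|Num.sqrt (`|a| * `|b|)|.
  rewrite normrM !(ger0_norm (sqrtr_ge0 _)).
  have [->|a0] := eqVneq a 0; first by rewrite normr0 mulr0 sqrtr_ge0.
  rewrite -[X in _ * X]normr_id -[X in _ * X]sqrtr_sqr -sqrtrM ?divr_ge0//.
  by apply: ler_wsqrtr; rewrite expr2 mulrA divfK ?normr_eq0// mulrC.
have h2 : \sum_(i < n) `|h i| * y i <= M.
  by apply: le_trans (hN y) _; apply: (latnorm_le latN) => i _; exact: key.
have h2' : \sum_(i < n) `|h' i| * y' i <= M.
  apply: le_trans (hN' y') _; apply: (latnorm_le latN) => i _.
  by rewrite [X in _ <= `|Num.sqrt X|]mulrC; exact: key.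
suff : 2 - \sum_(i < n) `|h i - h' i| <= 2 * M by lra.
have -> : 2 - \sum_(i < n) `|h i - h' i| =
    \sum_(i < n) (`|h i| + `|h' i| - `|h i - h' i|).
  by rewrite sumrB big_split/= h1 h1'.
apply: le_trans (_ : \sum_(i < n) (`|h i| * y i + `|h' i| * y' i) <= _); last first.
  by rewrite big_split/=; lra.
apply: ler_sum => i _.
have b0 : 0 <= `|h i| * y i by rewrite mulr_ge0// sqrtr_ge0.
have b0' : 0 <= `|h' i| * y' i by rewrite mulr_ge0// sqrtr_ge0.
(* Division by zero breaks [y i * y' i = 1] at the zeros of [x] or [x'], but there the sign
   condition makes [h i] or [h' i] vanish. *)
have [x0|x0] := eqVneq (x i) 0.
  by rewrite hs// x0 sgr0 mul0r normr0 sub0r normrN add0r subrr mul0r add0r.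
have [x0'|x0'] := eqVneq (x' i) 0.
  by rewrite [h' i]hs'// x0' sgr0 mul0r normr0 subr0 addr0 subrr mul0r addr0.
have yy : y i * y' i = 1.
  rewrite /y /y' -sqrtrM ?divr_ge0// mulf_div [X in X / _]mulrC divff ?sqrtr1//.
  by rewrite mulf_neq0 ?normr_eq0.
have y0 : 0 <= y i by exact: sqrtr_ge0.
have y0' : 0 <= y' i by exact: sqrtr_ge0.
have y2 : 2 <= y i + y' i.
  have := sqr_ge0 (y i - y' i); have := sqr_ge0 (y i + y' i - 2); nra.
have t1 : `|h i| - `|h' i| <= `|h i - h' i| by exact: lerB_dist.
have t2 : `|h' i| - `|h i| <= `|h i - h' i| by rewrite distrC lerB_dist.
have [hh|/ltW hh] := lerP `|h i| `|h' i|.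
  have : `|h i| * (y i + y' i) <= `|h i| * y i + `|h' i| * y' i.
    by rewrite mulrDr lerD2l ler_wpM2r.
  have : `|h i| * 2 <= `|h i| * (y i + y' i) by rewrite ler_wpM2l.
  lra.
have : `|h' i| * (y i + y' i) <= `|h i| * y i + `|h' i| * y' i.
  by rewrite mulrDr lerD2r ler_wpM2r.
have : `|h' i| * 2 <= `|h' i| * (y i + y' i) by rewrite ler_wpM2l.
lra.
Qed.

(** Closeness of [h] and [h'] leaves mass at least [1 - D] of [|h|] on the coordinates where the
    signs are not opposite, so [x] restricted to them has norm at least [1 - D]. Concavity then
    leaves at most [1 - (1 - D) ^+ Q <= Q * D] for the [Q]-th power of the rest. *)
Lemma lozanovskii_opposite Q n N x h x' h' : (0 < Q)%N ->
  lattice_norm n N -> power_concave n Q N ->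
  lozanovskii_pair n N x h -> lozanovskii_pair n N x' h' ->
  forall D r : R, \sum_(i < n) `|h i - h' i| <= D -> D <= 1 -> 0 <= r ->
  Q%:R * D <= r ^+ Q -> N (fun i => (x i * x' i < 0)%R%:R * x i) <= r.
Proof.
move=> Q0 latN cN [Nx h1 hs hN] [Nx' h1' hs' hN'] D r hD D1 r0 Dr.
set A := N _; have A0 : 0 <= A by exact: latnorm_ge0 latN _.
pose B := N (fun i => (~~ (x i * x' i < 0)%R)%:R * x i).
have B1 : 1 - D <= B.
  apply: le_trans (hN (fun i => (~~ (x i * x' i < 0)%R)%:R)).
  rewrite lerBlDr -lerBlDl -[X in X - _]h1 -sumrB (le_trans _ hD)//.
  apply: ler_sum => i _; have ni := ltn_ord i.
  case: ltP => xx /=; last by rewrite mulr1 subrr.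
  rewrite mulr0 subr0 [in leRHS]hs// [in leRHS]hs'//.
  have p1 := normr_ge0 (h i); have p2 := normr_ge0 (h' i).
  have pp : 0 <= `|h i| + `|h' i| by exact: addr_ge0.
  move: xx; rewrite mulr_lt0 => /and3P[x0 x0'].
  case: (ltrP (x i) 0) => xi /=.
    rewrite -leNgt le_eqVlt eq_sym (negbTE x0')/= => xi'.
    by rewrite ltr0_sg// gtr0_sg// mulN1r mul1r -opprD normrN (ger0_norm pp) lerDl.
  move=> xi'; rewrite gtr0_sg ?lt0r ?x0// ltr0_sg// mulN1r mul1r opprK (ger0_norm pp).
  by rewrite lerDl.
have AB : A ^+ Q + B ^+ Q <= 1.
  rewrite -(expr1n _ Q) -Nx; apply: cN => i _.
  by case: ltP => _ /=; rewrite mul1r mul0r normr0 expr0n gtn_eqF// ?addr0 ?add0r.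
have BQ : 1 - Q%:R * D <= B ^+ Q.
  apply: le_trans (_ : (1 - D) ^+ Q <= _).
    by rewrite -mulrN bernoulli_ge1//; lra.
  by rewrite lerXn2r ?nnegrE//; lra.
have : A ^+ Q <= r ^+ Q by lra.
by rewrite ler_pXn2r.
Qed.

(** The factor 4 is [2 + 1 + 1]: twice the half-difference [d] of the moduli, and the parts of [x]
    and of [x'] on coordinates of opposite signs. Evenness of [Q] allows raising
    [s ^ 2 = m ^ 2 + d ^ 2] to the power [Q / 2]. *)
Lemma lozanovskii_unif_right Q n N x h x' h' : (0 < Q)%N -> ~~ odd Q ->
  lattice_norm n N -> power_concave n Q N ->
  lozanovskii_pair n N x h -> lozanovskii_pair n N x' h' ->
  forall D r : R, \sum_(i < n) `|h i - h' i| <= D -> D <= 1 -> 0 <= r ->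
  Q%:R * D <= r ^+ Q -> N (fun i => x i - x' i) <= 4 * r.
Proof.
move=> Q0 oQ latN cN l1 l2 D r hD D1 r0 Dr.
have o1 := lozanovskii_opposite Q0 latN cN l1 l2 hD D1 r0 Dr.
have hD' : \sum_(i < n) `|h' i - h i| <= D.
  by under eq_bigr do rewrite distrC.
have o2 := lozanovskii_opposite Q0 latN cN l2 l1 hD' D1 r0 Dr.
have g := lozanovskii_geometric latN l1 l2.
move: l1 l2 => [Nx _ _ _] [Nx' _ _ _].
set m := fun i => Num.sqrt (`|x i| * `|x' i|) in g.
pose d i := 2^-1 * (`|x i| - `|x' i|).
pose s i := 2^-1 * (`|x i| + `|x' i|).
have D0 : 0 <= D by apply: le_trans hD; apply: sumr_ge0.
have Ns : N s <= 1.
  rewrite (latnormZ latN) ger0_norm//.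
  have := latnormD latN (fun i => `|x i|) (fun i => `|x' i|).
  rewrite (_ : N (fun i => `|x i|) = 1); last first.
    by rewrite -Nx; apply: (latnorm_eq latN) => i _; rewrite normr_id.
  rewrite (_ : N (fun i => `|x' i|) = 1); first lra.
  by rewrite -Nx'; apply: (latnorm_eq latN) => i _; rewrite normr_id.
(* [s ^ 2 = m ^ 2 + d ^ 2] *)
have md : N m ^+ Q + N d ^+ Q <= N s ^+ Q.
  apply: cN => i _; have q2 : Q = (2 * Q./2)%N by rewrite mul2n even_halfK.
  rewrite q2 !exprM; apply: le_trans (exprDsq_ge _ (sqr_ge0 _) (sqr_ge0 _)) _.
    by rewrite half_gt0; case: (Q) Q0 oQ => [|[|]].
  rewrite !real_normK ?num_real// /m sqr_sqrtr ?mulr_ge0// le_eqVlt; apply/orP; left.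
  by apply/eqP; congr (_ ^+ _); rewrite /d /s; field.
have sQ : N s ^+ Q <= 1 by rewrite exprn_ile1// (latnorm_ge0 latN).
have mQ : 1 - Q%:R * D <= N m ^+ Q.
  apply: le_trans (_ : (1 - D) ^+ Q <= _).
    by rewrite -mulrN bernoulli_ge1//; lra.
  by rewrite lerXn2r ?nnegrE//; [lra|exact: latnorm_ge0 latN _|lra].
have dr : N d <= r.
  rewrite -(@ler_pXn2r _ Q)// ?nnegrE//; first lra.
  exact: latnorm_ge0 latN _.
pose B i := (x i * x' i < 0)%R%:R * x i.
pose B' i := (x' i * x i < 0)%R%:R * x' i.
have : N (fun i => x i - x' i) <= N (fun i => 2 * `|d i| + (`|B i| + `|B' i|)).
  apply: (latnorm_le latN) => i _; rewrite [leRHS]ger0_norm ?addr_ge0 ?mulr_ge0//.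
  rewrite /d /B /B' [x' i * x i]mulrC; case: ltP => xx.
    rewrite !mul1r (le_trans (ler_normB _ _))// lerDr mulr_ge0//.
  rewrite !mul0r normr0 !addr0 normrM ger0_norm// mulrA divff// mul1r.
  have [x0|x0] := ger0P (x i); have [x0'|x0'] := ger0P (x' i) => //.
  - have : x i <= 0 by rewrite -(nmulr_lge0 _ x0').
    by move=> x1; have -> : x i = 0 by [lra]; rewrite !sub0r opprK normrN.
  - have : x' i <= 0 by rewrite -(nmulr_rge0 _ x0).
    by move=> x1; have -> : x' i = 0 by [lra]; rewrite !subr0 normrN.
  - by rewrite -opprD normrN.
move=> /le_trans; apply; apply: le_trans (latnormD latN _ _) _.
rewrite (latnormZ latN) ger0_norm//.
have := latnormD latN (fun i => `|B i|) (fun i => `|B' i|).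
have e (a : nat -> R) : N (fun i => `|a i|) = N a.
  by apply: (latnorm_eq latN) => i _; rewrite normr_id.
rewrite !e; move: o1 o2; rewrite -/B -/B'; lra.
Qed.

End lozanovskii_unif_right.

(** * Existence of [h] for a given [x] *)

Section lozanovskii_exists.
Context {R : realType}.
Implicit Types (N p : (nat -> R) -> R) (s : R) (x h t y : nat -> R).

(* Hahn-Banach, one coordinate at a time, for a functional given on the line
   of constant sequences. *)
Lemma hahn_banach_const p :
  (forall a b, p (fun i => a i + b i) <= p a + p b) ->
  (forall (k : R) a, p (fun i => k * a i) = `|k| * p a) ->
  p (fun=> 1) = 1 ->
  forall m, exists g : nat -> R, forall (s : R) t,
    s + \sum_(i < m) g i * t i <= p (fun i => s + (i < m)%:R * t i).
Proof.
move=> pD pZ p1; elim=> [|m [g IH]].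
  exists (fun=> 0) => s t; rewrite big_ord0 addr0.
  rewrite (_ : (fun i => _) = fun i => s * 1); first by rewrite pZ p1 mulr1 ler_norm.
  by apply/funext => i; rewrite ltn0 mul0r addr0 mulr1.
pose v (s : R) t i := s + (i < m)%:R * t i.
pose f (s : R) t := s + \sum_(i < m) g i * t i.
pose dl (i : nat) : R := (i == m)%:R.
have IHf s t : f s t <= p (v s t) by exact: IH.
pose E := [set z | exists (s : R) t, z = p (fun i => v s t i + dl i) - f s t].
have lbE s' t' : lbound E (f s' t' - p (fun i => v s' t' i - dl i)).
  move=> _ [s [t ->]]; rewrite lerBlDr addrAC lerBrDr.
  have -> : f s' t' + f s t = f (s' + s) (fun i => t' i + t i).
    rewrite /f addrACA -big_split/=; congr (_ + _); apply: eq_bigr => i _; ring.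
  apply: le_trans (IHf _ _) _; rewrite addrC; apply: le_trans (pD _ _).
  by rewrite le_eqVlt; apply/orP; left; apply/eqP; congr p; apply/funext => i; rewrite /v; ring.
have E0 : E !=set0 by exists (p (fun i => v 0 (fun=> 0) i + dl i) - f 0 (fun=> 0)), 0, (fun=> 0).
have hE : has_inf E by split => //; exists (f 0 (fun=> 0) - p (fun i => v 0 (fun=> 0) i - dl i)).
(* [al] will be the value of the functional on the new coordinate vector [dl]. Sublinearity leaves a
   nonempty interval of admissible values, and its right end is taken. *)
pose al := inf E.
have al1 s t : f s t + al <= p (fun i => v s t i + dl i).
  by rewrite -lerBrDl; apply: ge_inf; [case: hE|exists s, t].
have al2 s t : f s t - al <= p (fun i => v s t i - dl i).
  by rewrite lerBlDr addrC -lerBlDr; exact: (lb_le_inf E0 (lbE s t)).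
exists (fun i => if i == m then al else g i) => s t.
rewrite big_ord_recr/= eqxx addrA.
have -> : s + \sum_(i < m) (if (i : nat) == m then al else g i) * t i = f s t.
  by congr (_ + _); apply: eq_bigr => i _; rewrite ltn_eqF.
have -> : (fun i => s + (i < m.+1)%:R * t i) = (fun i => v s t i + t m * dl i).
  apply/funext => i; rewrite /v /dl ltnS leq_eqVlt.
  by case: eqP => [->|_] /=; [rewrite ltnn /=; ring|case: (i < m)%N => /=; ring].
have fZ k s' t' : k * f s' t' = f (k * s') (fun i => k * t' i).
  by rewrite /f mulrDr mulr_sumr; congr (_ + _); apply: eq_bigr => i _; ring.
have [t0|t0|/esym tm0] := ltgtP 0 (t m); last first.
- rewrite tm0 mulr0 addr0 (_ : (fun i => _) = v s t); first exact: IHf.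
  by apply/funext => i; rewrite mul0r addr0.
- have k0 : 0 < - t m by rewrite oppr_gt0.
  have pk a : - t m * p a = p (fun i => - t m * a i) by rewrite pZ (gtr0_norm k0).
  have := al2 (s / - t m) (fun i => t i / - t m).
  rewrite -(ler_pM2l k0) mulrBr fZ pk.
  have e1 (z : R) : - t m * (z / - t m) = z by rewrite mulrC divfK ?gt_eqF.
  rewrite e1 (_ : (fun i => - t m * (t i / _)) = t); last by apply/funext => i; rewrite e1.
  move=> /le_trans; rewrite mulNr opprK [al * _]mulrC; apply.
  rewrite le_eqVlt; apply/orP; left; apply/eqP; congr p; apply/funext => i.
  by rewrite /v mulrBr mulrDr e1 [(_ < _)%:R * _]mulrC mulrA e1; ring.
- have k0 := t0.
  have pk a : t m * p a = p (fun i => t m * a i) by rewrite pZ (gtr0_norm k0).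
  have := al1 (s / t m) (fun i => t i / t m).
  rewrite -(ler_pM2l k0) mulrDr fZ pk.
  have e1 (z : R) : t m * (z / t m) = z by rewrite mulrC divfK ?gt_eqF.
  rewrite e1 (_ : (fun i => t m * (t i / _)) = t); last by apply/funext => i; rewrite e1.
  move=> /le_trans; rewrite [al * _]mulrC; apply.
  rewrite le_eqVlt; apply/orP; left; apply/eqP; congr p; apply/funext => i.
  by rewrite /v !mulrDr e1 [(_ < _)%:R * _]mulrC mulrA e1; ring.
Qed.

(** Hahn-Banach is applied to the seminorm sending [y] to [N (y x)], which is 1 at the constant 1
    because [N x = 1]. *)
Lemma lozanovskii_of_vector n N x : lattice_norm n N -> N x = 1 ->
  exists2 h, lozanovskii_pair n N x h & forall i, (n <= i)%N -> h i = 0.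
Proof.
move=> latN Nx.
have [|||g hg] := @hahn_banach_const (fun y => N (fun i => y i * x i)) _ _ _ n.
- move=> a b; apply: le_trans (latnormD latN _ _).
  by rewrite le_eqVlt; apply/orP; left; apply/eqP; congr N; apply/funext => i /=; ring.
- by move=> k a; rewrite -(latnormZ latN); congr N; apply/funext => i /=; ring.
- by rewrite -[RHS]Nx; congr N; apply/funext => i; rewrite mul1r.
have N0 a : (forall i, (i < n)%N -> a i = 0) -> N a = 0.
  move=> a0; rewrite -(latnorm0 latN); apply: (latnorm_eq latN) => i /a0 ->.
  by [].
have hg0 t : \sum_(i < n) g i * t i <= N (fun i => t i * x i).
  have := hg 0 t; rewrite add0r => /le_trans; apply; rewrite le_eqVlt; apply/orP; left.
  by apply/eqP/(latnorm_eq latN) => i ni; rewrite ni add0r mul1r.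
have sum_delta k : (k < n)%N -> \sum_(i < n) g i * ((i : nat) == k)%:R = g k.
  move=> kn; rewrite (bigD1 (Ordinal kn))//= eqxx mulr1 big1 ?addr0// => i.
  by rewrite -val_eqE/= => /negbTE ->; rewrite mulr0.
have gx0 i : (i < n)%N -> x i = 0 -> g i <= 0.
  move=> ni xi; have := hg0 (fun j => (j == i)%:R); rewrite sum_delta// N0// => j _.
  by case: eqP => [->|_]; rewrite ?xi ?mulr0 ?mul0r.
(* Erasing one coordinate of [x] does not increase its norm, so [1 - g i <= 1]. *)
have g0 i : (i < n)%N -> 0 <= g i.
  move=> ni; have := hg 1 (fun j => - (j == i)%:R).
  under eq_bigr do rewrite mulrN.
  rewrite sumrN sum_delta// => /le_trans/(_ (_ : _ <= 1)) h.
  suff : 1 - g i <= 1 by lra.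
  apply: h; rewrite -[leRHS]Nx; apply: (latnorm_le latN) => j nj; rewrite nj mul1r.
  by case: eqP => _ /=; rewrite ?subrr ?subr0 ?mul0r ?mul1r ?normr0.
have sg1 : \sum_(i < n) g i = 1.
  apply/eqP; rewrite eq_le; apply/andP; split.
    have := hg0 (fun=> 1); under eq_bigr do rewrite mulr1.
    by rewrite (_ : (fun i => _) = x) ?Nx//; apply/funext => i; rewrite mul1r.
  have := hg 1 (fun=> -1); under eq_bigr do rewrite mulrN1.
  rewrite sumrN N0; first by rewrite subr_le0.
  by move=> i ni; rewrite ni mul1r subrr mul0r.
pose h i := if (i < n)%N then Num.sg (x i) * g i else 0.
have habs i : (i < n)%N -> `|h i| = g i.
  move=> ni; rewrite /h ni normrM normr_sg (ger0_norm (g0 _ ni)).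
  case: eqVneq => [xi|_]; rewrite ?mul1r ?mul0r//.
  by apply/eqP; rewrite eq_le g0// gx0.
exists h; last by move=> i; rewrite leqNgt /h => /negbTE ->.
split=> //.
- by rewrite -sg1; apply: eq_bigr => i _; rewrite habs.
- by move=> i ni; rewrite habs// /h ni.
- move=> y; apply: le_trans (hg0 y); rewrite le_eqVlt; apply/orP; left; apply/eqP.
  by apply: eq_bigr => i _; rewrite habs.
Qed.

End lozanovskii_exists.

(** * Existence of [x] for a given [h] *)

Section lozanovskii_maximum.
Context {R : realType}.
Implicit Types (N : (nat -> R) -> R) (x h y : nat -> R).

Lemma ln_le_subr1 (u : R) : 0 < u -> ln u <= u - 1.
Proof. by move=> u0; rewrite lerBrDl -[leRHS]lnK ?posrE// expR_ge1Dx. Qed.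

Lemma ln1D_ge (u : R) : 0 < 1 + u -> u / (1 + u) <= ln (1 + u).
Proof.
move=> u0; have := @ln_le_subr1 (1 + u)^-1; rewrite invr_gt0 lnV ?posrE// => /(_ u0).
rewrite lerNl; apply: le_trans; rewrite le_eqVlt; apply/orP; left; apply/eqP.
by field; rewrite gt_eqF.
Qed.

Lemma rV_lipschitz_continuous n (f : 'rV[R]_n -> R) (C : 'I_n -> R) :
  (forall u v, `|f u - f v| <= \sum_i C i * `|u ord0 i - v ord0 i|) ->
  continuous f.
Proof.
move=> hf v; have FF : Filter (nbhs v) by exact: nbhs_filter.
apply/cvgrPdist_lt => e e0.
have : (fun u : 'rV[R]_n => \sum_i C i * `|v ord0 i - u ord0 i|) @ v -->
    \sum_i C i * `|v ord0 i - v ord0 i|.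
  apply: cvg_big => [|i _]; [exact: add_continuous|]; apply: cvgMl_tmp; apply: cvg_norm; apply: cvgB.
    exact: cvg_cst.
  exact: coord_continuous.
rewrite [X in _ --> X]big1 => [/cvgrPdist_lt/(_ e e0)|i _]; last first.
  by rewrite subrr normr0 mulr0.
apply: filterS => u; rewrite sub0r normrN => h.
by apply: le_lt_trans (hf _ _) _; apply: le_lt_trans h; exact: ler_norm.
Qed.

(** Coordinates where [h] vanishes have no weight in the function to be maximised. They are erased
    from the vector, while the row [v] keeps a positive entry there and every logarithm stays
    meaningful. *)
Definition extend_row n h (v : 'rV[R]_n) (k : nat) : R :=
  if insub k is Some j then (h k != 0)%:R * v ord0 j else 0.

Lemma extend_rowE n h (v : 'rV[R]_n) (i : 'I_n) :
  extend_row h v i = (h i != 0)%:R * v ord0 i.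
Proof. by rewrite /extend_row valK. Qed.

Lemma extend_row_ge n h (v : 'rV[R]_n) k : (n <= k)%N -> extend_row h v k = 0.
Proof. by move=> nk; rewrite /extend_row insubF// ltnNge nk. Qed.

Lemma latnorm_extend_continuous n N h : lattice_norm n N ->
  continuous (fun v : 'rV[R]_n => N (extend_row h v)).
Proof.
move=> latN; apply: (@rV_lipschitz_continuous _ _ (fun i => N (fun k => (k == i)%:R))) => u v.
have key (u' v' : 'rV[R]_n) : N (extend_row h u') - N (extend_row h v') <=
    \sum_(i < n) N (fun k => (k == i)%:R) * `|u' ord0 i - v' ord0 i|.
  rewrite lerBlDl.
  apply: le_trans (_ : N (fun k => extend_row h v' k +
      \sum_(i < n) (u' ord0 i - v' ord0 i) * (h i != 0)%:R * (k == i)%:R) <= _).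
    rewrite le_eqVlt; apply/orP; left; apply/eqP; apply: (latnorm_eq latN) => k kn.
    congr `|_|; rewrite (bigD1 (Ordinal kn))//= eqxx mulr1 big1 ?addr0; last first.
      by move=> i; rewrite -val_eqE/= eq_sym => /negbTE ->; rewrite mulr0.
    by have := extend_rowE h v' (Ordinal kn); have := extend_rowE h u' (Ordinal kn) => /= -> ->; ring.
  apply: le_trans (latnormD latN _ _) _; rewrite lerD2l.
  apply: le_trans (latnorm_sum latN _ _ _) _; apply: ler_sum => i _.
  rewrite (latnormZ latN) mulrC ler_wpM2l ?(latnorm_ge0 latN)//.
  by rewrite normrM ler_piMr// normr_nat; case: (h i != 0); rewrite ?ler01.
rewrite ler_norml key andbT lerNl opprB; apply: le_trans (key _ _) _.
by apply: ler_sum => i _; rewrite distrC.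
Qed.

(* The vector [x] maximises [\sum_i `|h i| * ln (x i)] over the positive part of
   the unit ball, and the first-order condition says that [`|h| / x] is norming. *)
Lemma lozanovskii_of_functional n N h : lattice_norm n N ->
  \sum_(i < n) `|h i| = 1 ->
  exists2 x, lozanovskii_pair n N x h & forall i, (n <= i)%N -> x i = 0.
Proof.
move=> latN h1.
pose ext := @extend_row n h.
pose w (i : 'I_n) : R := `|h i|.
have w0 i : 0 <= w i by exact: normr_ge0.
pose f (v : 'rV[R]_n) := \sum_(i < n) w i * ln (v ord0 i).
pose d (i : nat) := N (fun k => (k == i)%:R).
have d0 (i : 'I_n) : 0 < d i.
  rewrite lt0r (latnorm_ge0 latN) andbT; apply/eqP => /(latnorm0_eq0 latN)/(_ i (ltn_ord i))/eqP.
  by rewrite eqxx oner_eq0.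
(* A common upper bound for the relevant coordinates in the unit ball; the summand 1 makes [ln M]
   nonnegative. *)
pose M := 1 + \sum_(i < n) (d i)^-1.
have dM (i : 'I_n) : (d i)^-1 <= M.
  rewrite /M (bigD1 i)//= addrCA lerDl addr_ge0// sumr_ge0// => j _.
  by rewrite invr_ge0 ltW.
have M1 : 1 <= M by rewrite lerDl sumr_ge0// => j _; rewrite invr_ge0 ltW.
have M0 : 0 < M by apply: lt_le_trans M1.
have boundM (v : 'rV[R]_n) (i : 'I_n) : N (ext v) <= 1 -> h i != 0 -> 0 < v ord0 i -> v ord0 i <= M.
  move=> Nv hi vi; apply: le_trans (dM i); rewrite -[leRHS]mul1r ler_pdivlMr//.
  apply: le_trans Nv; rewrite -(gtr0_norm vi) -(latnormZ latN); apply: (latnorm_le latN) => k kn.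
  have [->|_] := eqVneq k i; last by rewrite mulr0 normr0.
  by rewrite /ext extend_rowE hi mulr1 mul1r.
pose c0 := Num.min 1 (N (fun=> 1) + 1)^-1.
have c0_gt0 : 0 < c0.
  by rewrite lt_min ltr01 invr_gt0 ltr_wpDl// (latnorm_ge0 latN).
have c01 : c0 <= 1 by rewrite ge_min lexx.
pose v0 : 'rV[R]_n := const_mx c0.
have Nv0 : N (ext v0) <= 1.
  apply: le_trans (_ : c0 * N (fun=> 1) <= _).
    rewrite -(gtr0_norm c0_gt0) -(latnormZ latN); apply: (latnorm_le latN) => k kn.
    rewrite mulr1 /ext (extend_rowE h v0 (Ordinal kn))/= mxE.
    by case: (h k != 0); rewrite ?mul1r// mul0r normr0.
  have n0 := latnorm_ge0 latN (fun=> 1).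
  apply: le_trans (_ : (N (fun=> 1) + 1)^-1 * N (fun=> 1) <= _).
    by rewrite ler_wpM2r// ge_min lexx orbT.
  by rewrite mulrC ler_pdivrMr; lra.
have fv0 : f v0 = ln c0.
  rewrite /f -[RHS]mul1r -[in RHS]h1 mulr_suml; apply: eq_bigr => i _.
  by rewrite mxE.
(* If [f v >= f v0 = ln c0] and all relevant coordinates are at most [M], then
   [w i * ln (v i) >= ln c0 - ln M]. So a maximiser can be sought in a compact box away from 0,
   where [ln] is continuous. *)
pose c (i : 'I_n) := if h i == 0 then c0 else Num.min c0 (expR ((ln c0 - ln M) / w i)).
have c_gt0 i : 0 < c i by rewrite /c; case: ifP => // _; rewrite lt_min c0_gt0 expR_gt0.
have cc0 i : c i <= c0 by rewrite /c; case: ifP => // _; rewrite ge_min lexx.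
have boundc (v : 'rV[R]_n) (i : 'I_n) : (forall j, 0 < v ord0 j) -> N (ext v) <= 1 ->
    f v0 <= f v -> h i != 0 -> c i <= v ord0 i.
  move=> vp Nv fv hi; rewrite /c (negbTE hi) ge_min; apply/orP; right.
  have wi : 0 < w i by rewrite normr_gt0.
  rewrite -[leRHS]lnK ?posrE// ler_expR ler_pdivrMr// mulrC.
  rewrite -fv0 lerBlDr; apply: le_trans fv _.
  rewrite /f (bigD1 i)//= lerD2l.
  apply: le_trans (_ : \sum_(j < n) w j * ln M <= _); last first.
    by rewrite -mulr_suml h1 mul1r.
  rewrite [leRHS](bigD1 i)//=; apply: ler_wpDl; first by rewrite mulr_ge0// ln_ge0.
  apply: ler_sum => j _; have [hj|hj] := eqVneq (h j) 0.
    by rewrite /w hj normr0 !mul0r.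
  by rewrite ler_wpM2l// ler_ln ?posrE// boundM.
pose K := [set v : 'rV[R]_n | forall i, `[c i, M]%classic (v ord0 i)] `&`
  [set v | N (ext v) <= 1].
have cK : compact K.
  apply: compact_closedI.
    by apply: (@rV_compact _ _ (fun i => `[c i, M]%classic)) => i; exact: segment_compact.
  apply: (@preimage_closed _ _ (fun v : 'rV[R]_n => N (ext v)) [set z | z <= 1]).
    by move=> v _; exact: latnorm_extend_continuous.
  exact: closed_le.
have Kv0 : K v0.
  split=> // i; rewrite /= in_itv/= mxE cc0/=; exact: le_trans M1.
have fK : {within K, continuous f}.
  apply: continuous_in_subspaceT => v; rewrite inE => -[vK _].
  have FF : Filter (nbhs v) by exact: nbhs_filter.
  apply: cvg_big => [|i _]; [exact: add_continuous|]; apply: cvgMl_tmp.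
  apply: continuous_cvg; last exact: coord_continuous.
  apply: continuous_ln; have := vK i; rewrite /= in_itv/= => /andP[+ _].
  exact: lt_le_trans.
have [v vK maxv] := compact_EVT_max (ex_intro _ v0 Kv0) cK fK.
rewrite inE in vK; case: vK => vbox Nv.
have vp i : 0 < v ord0 i.
  by have := vbox i; rewrite /= in_itv/= => /andP[+ _]; exact: lt_le_trans.
(* Maximality extends from the compact set to all positive [u] in the ball: below [f v0] there is
   nothing to show, and otherwise only the entries with [h i = 0] can leave the box; they are reset
   to [c0], which neither [f] nor [N] notices. *)
have max_f (u : 'rV[R]_n) : (forall i, 0 < u ord0 i) -> N (ext u) <= 1 -> f u <= f v.
  move=> up Nu; have [fu|/ltW fu] := lerP (f u) (f v0).
    by apply: le_trans fu _; apply: maxv; rewrite inE.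
  pose u' : 'rV[R]_n := \row_i if h i == 0 then c0 else u ord0 i.
  have -> : f u = f u'.
    apply: eq_bigr => i _; rewrite mxE; case: eqP => // hi.
    by rewrite /w hi normr0 !mul0r.
  apply: maxv; rewrite inE; split.
    move=> i; rewrite /= in_itv/= mxE; case: ifPn => hi.
      by rewrite cc0 (le_trans c01).
    by rewrite boundc//= boundM.
  rewrite /= (_ : N (ext u') = N (ext u))//; apply: (latnorm_eq latN) => k kn.
  rewrite /ext (extend_rowE h u' (Ordinal kn)) (extend_rowE h u (Ordinal kn))/= mxE/=.
  by case: eqP => //; rewrite !mul0r.
pose x k := Num.sg (h k) * ext v k.
have xabs (y : nat -> R) : N (fun k => y k * x k) = N (fun k => y k * ext v k).
  apply: (latnorm_eq latN) => k kn; rewrite /x !normrM normr_sg.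
  have := extend_rowE h v (Ordinal kn); rewrite -/ext/= => ->.
  by case: eqP => /= _; rewrite ?mul1r ?mul0r ?normr0 ?mulr0.
have norming y : \sum_(i < n) `|h i| * y i <= N (fun i => y i * x i).
  rewrite xabs; set b := N _; have b0 : 0 <= b by exact: latnorm_ge0 latN _.
  pose Y := 1 + \sum_(i < n) `|y i|.
  have Yy (i : 'I_n) : `|y i| <= Y.
    by rewrite /Y (bigD1 i)//= addrCA lerDl addr_ge0// sumr_ge0.
  have Y1 : 1 <= Y by rewrite lerDl sumr_ge0.
  (* The competitor is [v * (1 + t * y) / (1 + t * b)], which stays in the unit ball. The bound on
     [t * Y] keeps [1 + t * y i] above 1/2, so [ln] is linear up to [2 * t ^+ 2 * Y ^+ 2]; after
     division by [t] the error tends to 0. *)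
  have small (t : R) : 0 < t -> t * Y <= 2^-1 ->
      \sum_(i < n) w i * y i <= b + 2 * t * Y ^+ 2.
    move=> t0 tY.
    have ty (i : 'I_n) : `|t * y i| <= 2^-1.
      by rewrite normrM gtr0_norm// (le_trans _ tY)// ler_wpM2l// ltW.
    have ty1 (i : 'I_n) : 2^-1 <= 1 + t * y i.
      by have := ty i; rewrite ler_norml => /andP[]; lra.
    have ty0 (i : 'I_n) : 0 < 1 + t * y i by apply: lt_le_trans (ty1 i).
    have tb : 0 < 1 + t * b by rewrite ltr_wpDr// mulr_ge0// ltW.
    pose u : 'rV[R]_n := \row_i (v ord0 i * (1 + t * y i) / (1 + t * b)).
    have up i : 0 < u ord0 i by rewrite mxE divr_gt0// mulr_gt0.
    have Nu : N (ext u) <= 1.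
      apply: le_trans (_ : N (fun k => (1 + t * b)^-1 * (ext v k + t * (y k * ext v k))) <= _).
        apply: (latnorm_le latN) => k kn.
        rewrite /ext (extend_rowE h u (Ordinal kn)) (extend_rowE h v (Ordinal kn))/= mxE/=.
        by rewrite le_eqVlt; apply/orP; left; apply/eqP; congr `|_|; ring.
      rewrite (latnormZ latN) gtr0_norm ?invr_gt0// mulrC ler_pdivrMr// mul1r.
      apply: le_trans (latnormD latN _ _) _.
      by rewrite (latnormZ latN) gtr0_norm// lerD2r.
    have := max_f u up Nu.
    have -> : f u = f v + \sum_(i < n) w i * ln (1 + t * y i) - ln (1 + t * b).
      rewrite /f -big_split/= -[ln (1 + t * b)]mul1r -[X in _ - X * _]h1 mulr_suml -sumrB.
      apply: eq_bigr => i _; rewrite mxE !lnM ?posrE ?invr_gt0 ?mulr_gt0// lnV ?posrE//.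
      by rewrite -/(w i); ring.
    rewrite -addrA gerDl subr_le0 => le1.
    have le2 : ln (1 + t * b) <= t * b.
      by apply: le_trans (ln_le_subr1 tb) _; rewrite addrC addKr.
    have le3 : \sum_(i < n) w i * (t * y i - 2 * t ^+ 2 * Y ^+ 2) <=
        \sum_(i < n) w i * ln (1 + t * y i).
      apply: ler_sum => i _; rewrite ler_wpM2l//; apply: le_trans (ln1D_ge (ty0 i)).
      rewrite ler_pdivlMr//.
      have : y i ^+ 2 <= Y ^+ 2.
        by rewrite -real_normK ?num_real// lerXn2r ?nnegrE//; apply: le_trans Y1.
      have := ty1 i; have : 0 <= Y ^+ 2 by exact: sqr_ge0.
      set YY := Y ^+ 2; set a := y i => h1' h2' h3'.
      have : t ^+ 2 * a ^+ 2 <= t ^+ 2 * YY by rewrite ler_wpM2l ?sqr_ge0.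
      have : t ^+ 2 * YY * 2^-1 <= t ^+ 2 * YY * (1 + t * a).
        by rewrite ler_wpM2l// mulr_ge0 ?sqr_ge0.
      by rewrite !expr2; lra.
    have : t * (\sum_(i < n) w i * y i) <= t * (b + 2 * t * Y ^+ 2).
      apply: le_trans (_ : t * b + 2 * t ^+ 2 * Y ^+ 2 <= _); last first.
        by rewrite le_eqVlt; apply/orP; left; apply/eqP; ring.
      rewrite -lerBlDr; apply: le_trans le2; apply: le_trans le1; apply: le_trans le3.
      rewrite -[X in _ - X]mul1r -[X in _ - X * _]h1 mulr_suml mulr_sumr -sumrB.
      by rewrite le_eqVlt; apply/orP; left; apply/eqP; apply: eq_bigr => i _; rewrite /w; ring.
    by rewrite ler_pM2l.
  apply/ler_addgt0Pl => e e0.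
  pose t := Num.min (2^-1 / Y) (e / (2 * Y ^+ 2)).
  have Y0 : 0 < Y by apply: lt_le_trans Y1.
  have Y20 : 0 < 2 * Y ^+ 2 by rewrite mulr_gt0// exprn_gt0.
  have t0 : 0 < t by rewrite lt_min !divr_gt0.
  have := small t t0; rewrite -ler_pdivlMr// ge_min lexx => /(_ isT)/le_trans; apply.
  have te : t * (2 * Y ^+ 2) <= e by rewrite -ler_pdivlMr// ge_min lexx orbT.
  have -> : 2 * t * Y ^+ 2 = t * (2 * Y ^+ 2) by ring.
  by rewrite [leRHS]addrC lerD2l.
exists x; last by move=> i ni; rewrite /x /ext extend_row_ge// mulr0.
split=> //.
- apply/eqP; rewrite eq_le; apply/andP; split.
    have := xabs (fun=> 1); under eq_fun do rewrite mul1r.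
    by move=> ->; under eq_fun do rewrite mul1r.
  have := norming (fun=> 1); under eq_bigr do rewrite mulr1.
  by rewrite h1; under eq_fun do rewrite mul1r.
- move=> i ni; rewrite /x; have := extend_rowE h v (Ordinal ni); rewrite -/ext/= => ->.
  have [hi|hi] := eqVneq (h i) 0; first by rewrite hi sgr0 !mul0r sgr0 mul0r.
  by rewrite mul1r sgrM (gtr0_sg (vp _)) mulr1 sgr_id -numEsg.
Qed.

End lozanovskii_maximum.

(** * Lower estimates and power concavity *)

Section lower_estimates.
Context {R : realType}.
Implicit Types (N : (nat -> R) -> R) (u : nat -> R).

(** [C] bounds the sum of [q]-th powers, so it is the [q]-th power of the usual constant of a lower
    [q]-estimate. *)
Definition lower_estimate (n q : nat) (C : R) N : Prop :=
  forall m (B : 'I_m -> pred nat) u,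
    (forall i j k, B j i -> B k i -> j = k) -> N u <= 1 ->
  \sum_(j < m) N (fun i => (B j i)%:R * u i) ^+ q <= C.

Section random_subsets.
Variables (m : nat) (p : 'I_m -> R).
Hypothesis p01 : forall j, 0 <= p j <= 1.

(* The law of a random subset containing each [j] independently with
   probability [p j]. *)
Definition subset_weight (S : {set 'I_m}) : R :=
  \prod_j (if j \in S then p j else 1 - p j).

Lemma subset_weight_ge0 S : 0 <= subset_weight S.
Proof.
apply: prodr_ge0 => j _; case: ifP => _; first by case/andP: (p01 j).
by rewrite subr_ge0; case/andP: (p01 j).
Qed.

(** The probability of containing [T]. Expanding the product of the sums [p j + (1 - p j)], with the
    second term dropped for [j] in [T], lists exactly the sets containing [T]. *)
Lemma sum_subset_weight (T : {set 'I_m}) :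
  \sum_(S : {set 'I_m} | T \subset S) subset_weight S = \prod_(j in T) p j.
Proof.
have -> : \prod_(j in T) p j = \prod_j (p j + if j \in T then 0 else 1 - p j).
  rewrite big_mkcond/=; apply: eq_bigr => j _.
  by case: ifP => _; rewrite ?addr0// addrC subrK.
rewrite bigA_distr big_mkcond/=; apply: eq_bigr => S _.
case: ifPn => TS.
  apply: eq_bigr => j _; case: ifPn => // jS; case: ifPn => // jT.
  by rewrite (fintype.subsetP TS) in jS.
case/fintype.subsetPn: TS => j jT jS; rewrite (bigD1 j)//= (negbTE jS) jT mul0r//.
Qed.

End random_subsets.

(** Bernoulli at [z / c - 1]. Summed against weights, this supporting line replaces Jensen's
    inequality. *)
Lemma exprn_tangent (q : nat) (c z : R) : 0 < c -> 0 <= z ->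
  c ^+ q + q%:R * c ^+ q.-1 * (z - c) <= z ^+ q.
Proof.
case: q => [|q] c0 z0; first by rewrite !mul0r addr0.
have := @bernoulli_ge1 R q.+1 (z / c - 1); rewrite lerBrDr addNr divr_ge0 ?(ltW c0)// => /(_ isT).
rewrite [1 + (_ - 1)]addrC subrK expr_div_n ler_pdivlMr ?exprn_gt0//=.
by apply: le_trans; rewrite le_eqVlt; apply/orP; left; apply/eqP; rewrite exprS; field; rewrite gt_eqF.
Qed.

(* Choose a random set of indices [j] and keep in each chosen [A j] the points
   lying in no other chosen set: what remains is disjoint, and a point of [A j]
   survives with probability at least 1/2. *)
Lemma random_disjointification n q C N m (p : 'I_m -> R) (A : 'I_m -> pred nat) u :
  (0 < q)%N -> lattice_norm n N -> lower_estimate n q C N -> N u <= 1 ->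
  (forall j, 0 <= p j <= 1) ->
  (forall i, (i < n)%N -> \sum_(j < m | A j i) p j <= 2^-1) ->
  \sum_(j < m) p j * (2^-1 * N (fun i => (A j i)%:R * u i)) ^+ q <= C.
Proof.
move=> q0 latN lowN Nu p01 pA.
pose w := subset_weight p.
have w0 S : 0 <= w S by exact: subset_weight_ge0.
pose B (S : {set 'I_m}) j i :=
  [&& j \in S, A j i & [forall k, (k \in S) && A k i ==> (k == j)]].
pose z S j := N (fun i => (B S j i)%:R * u i).
have z0 S j : 0 <= z S j by exact: latnorm_ge0 latN _.
have w1 : \sum_(S : {set 'I_m}) w S = 1.
  have := sum_subset_weight p finset.set0; rewrite finset.big_set0 => <-.
  by apply: eq_bigl => S; rewrite finset.sub0set.
have zC S : \sum_(j < m) z S j ^+ q <= C.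
  apply: lowN => // i j k /and3P[_ _ /forallP/(_ k)] + /and3P[kS kA _].
  by rewrite kS kA => /eqP.
apply: le_trans (_ : \sum_(S : {set 'I_m}) w S * (\sum_(j < m) z S j ^+ q) <= _); last first.
  rewrite -[leRHS]mul1r -w1 mulr_suml; apply: ler_sum => S _.
  by rewrite ler_wpM2l.
under [leRHS]eq_bigr do rewrite mulr_sumr.
rewrite exchange_big/=; apply: ler_sum => j _.
set c := 2^-1 * _.
have c_ge0 : 0 <= c by rewrite mulr_ge0 ?(latnorm_ge0 latN).
have sum_p : \sum_(S : {set 'I_m} | j \in S) w S = p j.
  have := sum_subset_weight p [set j]%SET; rewrite finset.big_set1 => <-.
  by apply: eq_bigl => S; rewrite finset.sub1set.
have [c0|cN0] := eqVneq c 0.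
  rewrite c0 expr0n gtn_eqF// mulr0; apply: sumr_ge0 => S _.
  by rewrite mulr_ge0 ?exprn_ge0.
have c_gt0 : 0 < c by rewrite lt0r cN0.
apply: le_trans (_ : \sum_(S : {set 'I_m} | j \in S) w S * z S j ^+ q <= _); last first.
  rewrite [leRHS](bigID (fun S : {set 'I_m} => j \in S))/= lerDl.
  by apply: sumr_ge0 => S _; rewrite mulr_ge0 ?exprn_ge0.
(* The triangle inequality moves the average over [S] inside the norm, so only a pointwise bound on
   survival probabilities is left. *)
have mean : p j * c <= \sum_(S : {set 'I_m} | j \in S) w S * z S j.
  have -> : \sum_(S : {set 'I_m} | j \in S) w S * z S j =
      \sum_(S : {set 'I_m} | j \in S) N (fun i => w S * ((B S j i)%:R * u i)).
    by apply: eq_bigr => S _; rewrite (latnormZ latN) ger0_norm.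
  apply: le_trans (latnorm_sum latN _ _ _).
  have pj0 : 0 <= p j by case/andP: (p01 j).
  rewrite /c mulrA -[X in X * N _](@ger0_norm _ (p j / 2)) ?divr_ge0// -(latnormZ latN).
  apply: (latnorm_le latN) => i ni.
  under [X in _ <= `|X|]eq_bigr do rewrite mulrA.
  rewrite -mulr_suml mulrA normrM [leRHS]normrM ler_wpM2r//.
  have [Aji|nAji] := boolP (A j i); last first.
    by rewrite mulr0 normr0.
  rewrite mulr1 !ger0_norm ?divr_ge0//; last first.
    by apply: sumr_ge0 => S _; rewrite mulr_ge0.
  (* Union bound: a point of a chosen [A j] is lost only if another chosen [A k] contains it. Pairs
     being independent, this costs at most half of [p j]. *)
  have step (S : {set 'I_m}) : j \in S -> w S - \sum_(k | A k i && (k != j)) w S * (k \in S)%:R <=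
      w S * (B S j i)%:R.
    move=> jS; rewrite -mulr_sumr -{1}[w S]mulr1 -mulrBr ler_wpM2l//.
    rewrite /B jS Aji/=; case: (boolP [forall k, _]) => [_|].
      by rewrite gerBl sumr_ge0.
    rewrite negb_forall => /existsP[k]; rewrite negb_imply => /andP[/andP[kS Ak] kj].
    by rewrite (bigD1 k)/= ?Ak ?kj// kS subr_le0 lerDl sumr_ge0.
  apply: le_trans (ler_sum _ step); rewrite sumrB sum_p exchange_big/=.
  have pair k : k != j -> \sum_(S : {set 'I_m} | j \in S) w S * (k \in S)%:R = p j * p k.
    move=> kj; have := sum_subset_weight p [set j; k]%SET.
    rewrite finset.big_setU1/= ?finset.big_set1 ?inE 1?eq_sym// => <-.
    rewrite big_mkcond [RHS]big_mkcond/=; apply: eq_bigr => S _.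
    rewrite finset.subUset !finset.sub1set; case: (j \in S) => //=.
    by case: (k \in S); rewrite ?mulr1 ?mulr0.
  rewrite (eq_bigr (fun k => p j * p k)); last by move=> k /andP[_]; exact: pair.
  rewrite -mulr_sumr; have := pA i ni; rewrite (bigD1 j)//= => h.
  have : \sum_(k | A k i && (k != j)) p k <= 2^-1 by lra.
  move=> /(ler_wpM2l pj0); lra.
apply: le_trans (_ : \sum_(S : {set 'I_m} | j \in S)
    w S * (c ^+ q + q%:R * c ^+ q.-1 * (z S j - c)) <= _); last first.
  by apply: ler_sum => S _; rewrite ler_wpM2l// exprn_tangent.
under eq_bigr do rewrite mulrDr.
rewrite big_split/= -mulr_suml sum_p lerDl.
under eq_bigr do rewrite mulrCA mulrBr.
rewrite -mulr_sumr sumrB -mulr_suml sum_p.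
by rewrite mulr_ge0 ?subr_ge0// mulr_ge0// exprn_ge0.
Qed.

End lower_estimates.

(** * From disjoint pieces to arbitrary splittings *)

Section power_concavification.
Context {R : realType}.
Implicit Types (N : (nat -> R) -> R) (u f : nat -> R).

Lemma sum_half_pow (K : nat) : \sum_(k < K) (2^-1 : R) ^+ k < 2.
Proof.
have -> : \sum_(k < K) (2^-1 : R) ^+ k = 2 - 2 * 2^-1 ^+ K.
  elim: K => [|K IH]; first by rewrite big_ord0 expr0; lra.
  by rewrite big_ord_recr/= IH exprS; lra.
by rewrite ltrBlDr ltrDl mulr_gt0// exprn_gt0// invr_gt0.
Qed.

(** If every dyadic level [t k = 2 ^ k * v / 2] failed, its level set would have norm below
    [4 ^ -(k + 1)], and the layers of [f u] would sum to less than [v]. The square leaves the factor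
    [2 ^ -k] that makes this sum converge; this is why the exponent [q] becomes [2 * q]. *)
Lemma large_level_set n N f u : lattice_norm n N -> N u <= 1 ->
  (forall i, (i < n)%N -> 0 <= f i <= 1) ->
  exists2 t : R, 0 < t <= 1 &
    N (fun i => f i * u i) ^+ 2 <=
    16 * t ^+ 2 * N (fun i => (t <= f i)%R%:R * u i).
Proof.
move=> latN Nu f01; set v := N (fun i => f i * u i).
have v0 : 0 <= v by exact: latnorm_ge0 latN _.
have A0 (t : R) : 0 <= N (fun i => (t <= f i)%R%:R * u i) by exact: latnorm_ge0 latN _.
have [v00|vN0] := eqVneq v 0.
  exists 1; first by rewrite ltr01 lexx.
  by rewrite v00 expr0n mulr_ge0.
have {vN0} v_gt0 : 0 < v by rewrite lt0r vN0.
pose t (k : nat) : R := 2 ^+ k * (v / 2).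
have t_gt0 k : 0 < t k by rewrite mulr_gt0 ?exprn_gt0// divr_gt0.
apply: contrapT => noT.
have small k : N (fun i => (t k <= f i)%R%:R * u i) < 4^-1 * (4^-1) ^+ k.
  have [t1|t1] := lerP (t k) 1; last first.
    rewrite (_ : N _ = 0) ?mulr_gt0 ?exprn_gt0 ?invr_gt0//.
    rewrite -(latnorm0 latN); apply: (latnorm_eq latN) => i ni.
    have /andP[_ f1] := f01 i ni.
    by rewrite leNgt (le_lt_trans f1 t1) mul0r.
  rewrite ltNge; apply/negP => h; apply: noT; exists (t k); first by rewrite t_gt0.
  apply: le_trans (_ : 16 * t k ^+ 2 * (4^-1 * 4^-1 ^+ k) <= _); last first.
    by rewrite ler_wpM2l// mulr_ge0// sqr_ge0.
  rewrite le_eqVlt; apply/orP; left; apply/eqP; rewrite /t !exprMn -exprM mulnC exprM.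
  have e : (2 ^+ 2) ^+ k * (4^-1) ^+ k = 1 :> R.
    by rewrite -exprMn (_ : 2 ^+ 2 * 4^-1 = 1) ?expr1n//; field.
  have -> : 16 * ((2 ^+ 2) ^+ k * (v ^+ 2 * 2^-1 ^+ 2)) * (4^-1 * 4^-1 ^+ k) =
    ((2 ^+ 2) ^+ k * (4^-1) ^+ k) * v ^+ 2 * (16 * 2^-1 ^+ 2 * 4^-1) by ring.
  by rewrite e; field.
(* Layer-cake bound: only the highest level [t l <= x] matters, because [x] is below the next one,
   which is [2 ^+ l * v]. *)
have layer k x : 0 <= x -> x < t k ->
    x <= v / 2 + \sum_(l < k) 2 ^+ l * v * (t l <= x)%R%:R.
  move=> x0; elim: k => [|k IH] xt.
    by rewrite big_ord0 addr0; move: xt; rewrite /t expr0 mul1r => /ltW.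
  rewrite big_ord_recr/=; have [tx|xt'] := lerP (t k) x; last first.
    by rewrite mulr0 addr0; exact: IH.
  rewrite mulr1; apply: le_trans (ltW xt) _; rewrite /t exprS.
  have : 0 <= \sum_(l < k) 2 ^+ l * v * (t l <= x)%R%:R.
    by apply: sumr_ge0 => l _; rewrite !mulr_ge0// exprn_ge0.
  have -> : 2 * 2 ^+ k * (v / 2) = 2 ^+ k * v by field.
  by move=> h; rewrite addrA lerDr addr_ge0// divr_ge0.
have [K HK] : exists K, 1 < t K.
  have : 0 < v / 2 by rewrite divr_gt0.
  move=> v2; have [K HK] : exists K : nat, (v / 2)^-1 < K%:R.
    by exists (Num.truncn (v / 2)^-1).+1; rewrite truncnS_gt.
  exists K; rewrite /t mulrC -ltr_pdivrMl// mulr1; apply: lt_le_trans HK _.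
  by rewrite -natrX ler_nat ltnW// ltn_expl.
suff : v < v by rewrite ltxx.
apply: le_lt_trans (_ : N (fun i => v / 2 * u i + \sum_(l < K) 2 ^+ l * v *
    ((t l <= f i)%R%:R * u i)) < _).
  apply: (latnorm_le latN) => i ni; have /andP[f0 f1] := f01 i ni.
  have -> : v / 2 * u i + \sum_(l < K) 2 ^+ l * v * ((t l <= f i)%R%:R * u i) =
    (v / 2 + \sum_(l < K) 2 ^+ l * v * (t l <= f i)%R%:R) * u i.
    by rewrite mulrDl mulr_suml; congr (_ + _); apply: eq_bigr => l _; rewrite mulrA.
  rewrite !normrM ler_wpM2r// ger0_norm//; apply: le_trans (ler_norm _).
  by apply: layer => //; exact: le_lt_trans HK.
apply: le_lt_trans (latnormD latN _ _) _.
rewrite (latnormZ latN) ger0_norm ?divr_ge0//.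
have h1 : v / 2 * N u <= v / 2 by rewrite ler_piMr// divr_ge0.
suff h2 : N (fun i => \sum_(l < K) 2 ^+ l * v * ((t l <= f i)%R%:R * u i)) < v / 2 by lra.
apply: le_lt_trans (latnorm_sum latN _ _ _) _.
apply: le_lt_trans (_ : \sum_(l < K) v / 4 * 2^-1 ^+ l < _).
  apply: ler_sum => l _; rewrite (latnormZ latN) ger0_norm ?mulr_ge0 ?exprn_ge0//.
  apply: le_trans (_ : 2 ^+ l * v * (4^-1 * 4^-1 ^+ l) <= _).
    by rewrite ler_wpM2l ?mulr_ge0 ?exprn_ge0// ltW.
  have e : (2 : R) ^+ l * (4^-1) ^+ l = 2^-1 ^+ l.
    by rewrite -exprMn; congr (_ ^+ _); field.
  by rewrite -e le_eqVlt; apply/orP; left; apply/eqP; ring.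
rewrite -mulr_sumr; have := sum_half_pow K => hK.
have : v / 4 * (\sum_(k < K) 2^-1 ^+ k) < v / 4 * 2 by rewrite ltr_pM2l// divr_gt0.
by lra.
Qed.

Definition power_partition (n Q : nat) m (f : 'I_m -> nat -> R) : Prop :=
  (forall j i, (i < n)%N -> 0 <= f j i) /\
  (forall i, (i < n)%N -> \sum_(j < m) f j i ^+ Q <= 1).

Lemma power_partition_le1 n Q m (f : 'I_m -> nat -> R) : (0 < Q)%N ->
  power_partition n Q f -> forall j i, (i < n)%N -> f j i <= 1.
Proof.
move=> Q0 [f0 f1] j i ni; rewrite -(@ler_pXn2r _ Q)// ?nnegrE ?f0// expr1n.
apply: le_trans (f1 i ni); rewrite (bigD1 j)//= lerDl sumr_ge0// => k _.
by rewrite exprn_ge0// f0.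
Qed.

(** Each [f j] is replaced by one of its level sets [A j], at height [t j], and [A j] is chosen with
    probability [t j ^+ (2 * q) / 2]. Since [t j <= f j] on [A j], the probabilities at a point add
    up to at most 1/2. The factor [16 ^+ q] comes from the level sets, [2 * 2 ^+ q] from the random
    choice. *)
Lemma lower_estimate_power_concave n q C N m (f : 'I_m -> nat -> R) u :
  (0 < q)%N -> lattice_norm n N -> lower_estimate n q C N ->
  power_partition n (2 * q) f -> N u <= 1 ->
  \sum_(j < m) N (fun i => f j i * u i) ^+ (2 * q) <= 16 ^+ q * (2 * (2 ^+ q * C)).
Proof.
move=> q0 latN lowN fP Nu.
have f1 := power_partition_le1 (_ : (0 < 2 * q)%N) fP.
have {}f1 : forall j i, (i < n)%N -> f j i <= 1 by apply: f1; rewrite muln_gt0.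
case: fP => f0 fS.
have H j : exists t : R, 0 < t <= 1 /\
    N (fun i => f j i * u i) ^+ 2 <= 16 * t ^+ 2 * N (fun i => (t <= f j i)%R%:R * u i).
  have [t t01 tN] := large_level_set latN Nu (fun i ni => introT andP (conj (f0 j i ni) (f1 j i ni))).
  by exists t.
have [t tP] := choice H.
pose p j := t j ^+ (2 * q) / 2.
pose A j : pred nat := fun i => (i < n)%N && (t j <= f j i).
have tpos j : 0 <= t j by case: (tP j) => /andP[/ltW].
have := @random_disjointification R n q C N m p A u q0 latN lowN Nu.
have p01 j : 0 <= p j <= 1.
  rewrite /p divr_ge0 ?exprn_ge0//=.
  have : t j ^+ (2 * q) <= 1 by rewrite exprn_ile1//; case: (tP j) => /andP[].
  by lra.
move=> /(_ p01) h; apply: le_trans (_ : 16 ^+ q * (2 * (2 ^+ q *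
   (\sum_(j < m) p j * (2^-1 * N (fun i => (A j i)%:R * u i)) ^+ q))) <= _).
  rewrite !mulr_sumr; apply: ler_sum => j _.
  rewrite exprM; apply: le_trans (_ : (16 * t j ^+ 2 * N (fun i => (t j <= f j i)%R%:R * u i)) ^+ q <= _).
    rewrite lerXn2r ?nnegrE ?sqr_ge0//; last by case: (tP j).
    by rewrite !mulr_ge0 ?sqr_ge0// (latnorm_ge0 latN).
  have -> : N (fun i => (t j <= f j i)%R%:R * u i) = N (fun i => (A j i)%:R * u i).
    by apply: (latnorm_eq latN) => i ni; rewrite /A ni.
  rewrite exprMn [(16 * _) ^+ q]exprMn -exprM [(2^-1 * _) ^+ q]exprMn /p.
  have e : (2 : R) ^+ q * 2^-1 ^+ q = 1 by rewrite -exprMn divff ?expr1n.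
  set a := N _ ^+ q; set b := t j ^+ _.
  have -> : 16 ^+ q * (2 * (2 ^+ q * (b / 2 * (2^-1 ^+ q * a)))) =
    16 ^+ q * b * a * (2 ^+ q * 2^-1 ^+ q) by field.
  by rewrite e mulr1.
rewrite !ler_wpM2l ?exprn_ge0//; apply: h => i ni.
rewrite /p -mulr_suml -[leRHS]mul1r ler_wpM2r//.
apply: le_trans (fS i ni); rewrite big_mkcond/=; apply: ler_sum => j _.
rewrite /A ni/=; case: ifPn => tf; last by rewrite exprn_ge0// f0.
by rewrite lerXn2r ?nnegrE// f0.
Qed.

End power_concavification.

(** * The equivalent concave norm *)

Definition power_sum (R : realType) Q (N : (nat -> R) -> R) m
    (f : 'I_m -> nat -> R) a : R :=
  \sum_(j < m) N (fun i => f j i * a i) ^+ Q.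

Definition power_sums (R : realType) n Q (N : (nat -> R) -> R) a : set R :=
  [set z | exists m (f : 'I_m -> nat -> R),
    power_partition n Q f /\ z = power_sum Q N f a].

(* The [Q]-th power is superadditive in [a ^ Q], being a supremum over all
   ways of splitting [a ^ Q]: the envelope is concave with constant 1. *)
HB.lock Definition power_envelope (R : realType) n Q (N : (nat -> R) -> R) a : R :=
  sup (power_sums n Q N a) `^ (Q%:R^-1).

Section power_envelope.
Context {R : realType}.
Implicit Types (N : (nat -> R) -> R) (a b c : nat -> R).

Lemma exprn_convex (Q : nat) (k l x y : R) : (0 < Q)%N -> 0 <= k -> 0 <= l ->
  k + l = 1 -> 0 <= x -> 0 <= y ->
  (k * x + l * y) ^+ Q <= k * x ^+ Q + l * y ^+ Q.
Proof.
move=> Q0 k0 l0 kl x0 y0; set c := k * x + l * y.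
have c0 : 0 <= c by rewrite addr_ge0// mulr_ge0.
have [->|cN0] := eqVneq c 0.
  by rewrite expr0n gtn_eqF// addr_ge0// mulr_ge0// exprn_ge0.
have c_gt0 : 0 < c by rewrite lt0r cN0.
have := ler_wpM2l k0 (exprn_tangent Q c_gt0 x0).
have := ler_wpM2l l0 (exprn_tangent Q c_gt0 y0).
set d := Q%:R * _; have : (k + l) * c ^+ Q = c ^+ Q by rewrite kl mul1r.
have : d * (k * x + l * y - (k + l) * c) = 0 by rewrite kl mul1r subrr mulr0.
by lra.
Qed.

Section theory.
Variables (n Q : nat) (N : (nat -> R) -> R) (K : R).
Hypothesis Q0 : (0 < Q)%N.
Hypothesis latN : lattice_norm n N.
Hypothesis K0 : 0 <= K.
Hypothesis bndN : forall m (f : 'I_m -> nat -> R) u,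
  power_partition n Q f -> N u <= 1 -> power_sum Q N f u <= K.

Let F a := sup (power_sums n Q N a).

Lemma power_sum_le m (f : 'I_m -> nat -> R) a : power_partition n Q f ->
  power_sum Q N f a <= K * N a ^+ Q.
Proof.
move=> fP; have [a0|aN0] := eqVneq (N a) 0.
  rewrite /power_sum big1 ?mulr_ge0 ?exprn_ge0 ?(latnorm_ge0 latN)// => j _.
  rewrite (_ : N _ = 0) ?expr0n ?gtn_eqF// -(latnorm0 latN).
  by apply: (latnorm_eq latN) => i ni; rewrite (latnorm0_eq0 latN a0)// mulr0.
have a0 : 0 < N a by rewrite lt0r aN0 (latnorm_ge0 latN).
have := bndN (u := fun i => (N a)^-1 * a i) fP.
rewrite (latnormZ latN) gtr0_norm ?invr_gt0// mulVf// => /(_ (lexx _)).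
rewrite -ler_pdivrMr ?exprn_gt0//; apply: le_trans.
rewrite mulr_suml le_eqVlt; apply/orP; left; apply/eqP; apply: eq_bigr => j _.
rewrite -exprVn -exprMn; congr (_ ^+ _).
rewrite -[X in _ * X]gtr0_norm ?invr_gt0// mulrC -(latnormZ latN).
by congr N; apply/funext => i; rewrite mulrCA.
Qed.

Lemma power_sums_sup a : has_sup (power_sums n Q N a).
Proof.
split.
  exists (power_sum Q N (fun (_ : 'I_0) _ => 0) a), 0%N, (fun _ _ => 0).
  by split=> //; split=> [[]|i _] //; rewrite big_ord0.
by exists (K * N a ^+ Q) => _ [m [f [fP ->]]]; exact: power_sum_le.
Qed.

Lemma power_sum_le_sup m (f : 'I_m -> nat -> R) a : power_partition n Q f ->
  power_sum Q N f a <= F a.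
Proof.
by move=> fP; apply: ub_le_sup; [case: (power_sums_sup a)|exists m, f].
Qed.

Lemma sup_power_sum_le a z :
  (forall m (f : 'I_m -> nat -> R), power_partition n Q f ->
    power_sum Q N f a <= z) -> F a <= z.
Proof.
move=> h; apply: ge_sup; first by case: (power_sums_sup a).
by move=> _ [m [f [fP ->]]]; exact: h.
Qed.

Lemma sup_power_sums_ge a : N a ^+ Q <= F a.
Proof.
apply: le_trans (_ : power_sum Q N (fun (_ : 'I_1) _ => 1) a <= _).
  rewrite /power_sum big_ord1 le_eqVlt; apply/orP; left; apply/eqP.
  by congr (N _ ^+ _); apply/funext => i; rewrite mul1r.
by apply: power_sum_le_sup; split=> // i _; rewrite big_ord1 expr1n.
Qed.

Lemma sup_power_sums_ge0 a : 0 <= F a.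
Proof. by apply: le_trans (sup_power_sums_ge a); rewrite exprn_ge0 ?(latnorm_ge0 latN). Qed.

Lemma power_envelope_ge0 a : 0 <= power_envelope n Q N a.
Proof. by rewrite power_envelope.unlock powR_ge0. Qed.

Lemma power_envelopeX a : power_envelope n Q N a ^+ Q = F a.
Proof.
rewrite power_envelope.unlock -powR_mulrn ?powR_ge0// -powRrM mulVf ?pnatr_eq0 -?lt0n//.
by rewrite powRr1// sup_power_sums_ge0.
Qed.

Lemma power_envelope_ge a : N a <= power_envelope n Q N a.
Proof.
rewrite -(@ler_pXn2r _ Q)// ?nnegrE ?power_envelope_ge0 ?(latnorm_ge0 latN)//.
by rewrite power_envelopeX sup_power_sums_ge.
Qed.

Lemma power_envelope_le (k : R) a : 0 <= k -> K <= k ^+ Q ->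
  power_envelope n Q N a <= k * N a.
Proof.
move=> k0 Kk; rewrite -(@ler_pXn2r _ Q)// ?nnegrE ?power_envelope_ge0 ?mulr_ge0 ?(latnorm_ge0 latN)//.
rewrite power_envelopeX exprMn; apply: le_trans (_ : K * N a ^+ Q <= _).
  by apply: sup_power_sum_le => m f; exact: power_sum_le.
by rewrite ler_wpM2r// exprn_ge0// (latnorm_ge0 latN).
Qed.

Lemma sup_power_sums_homo a b : (forall i, (i < n)%N -> `|a i| <= `|b i|) ->
  F a <= F b.
Proof.
move=> ab; apply: sup_power_sum_le => m f fP; apply: le_trans (power_sum_le_sup _ fP).
apply: ler_sum => j _; rewrite lerXn2r ?nnegrE ?(latnorm_ge0 latN)//.
by apply: (latnorm_le latN) => i ni; rewrite !normrM ler_wpM2l// ab.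
Qed.

Lemma sup_power_sumsZ (k : R) a : F (fun i => k * a i) <= `|k| ^+ Q * F a.
Proof.
apply: sup_power_sum_le => m f fP.
apply: le_trans (_ : `|k| ^+ Q * power_sum Q N f a <= _); last first.
  by rewrite ler_wpM2l ?exprn_ge0// power_sum_le_sup.
rewrite /power_sum mulr_sumr le_eqVlt; apply/orP; left; apply/eqP.
apply: eq_bigr => j _; rewrite -exprMn -(latnormZ latN); congr (N _ ^+ _).
by apply/funext => i; rewrite mulrCA.
Qed.

(** Minkowski's inequality for the [Q]-th power sums: normalise [a] by [A] and [b] by [B], and use
    convexity of the power with weights [A / (A + B)] and [B / (A + B)]. *)
Lemma sup_power_sumsD a b (A B : R) : 0 < A -> 0 < B ->
  F a <= A ^+ Q -> F b <= B ^+ Q -> F (fun i => a i + b i) <= (A + B) ^+ Q.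
Proof.
move=> A_gt0 B_gt0 FA FB; have AB : 0 < A + B by rewrite addr_gt0.
apply: sup_power_sum_le => m f fP.
have Sa : power_sum Q N f a / A ^+ Q <= 1.
  rewrite ler_pdivrMr ?exprn_gt0// mul1r; apply: le_trans FA; exact: power_sum_le_sup.
have Sb : power_sum Q N f b / B ^+ Q <= 1.
  rewrite ler_pdivrMr ?exprn_gt0// mul1r; apply: le_trans FB; exact: power_sum_le_sup.
have pA : 0 <= A / (A + B) by rewrite divr_ge0// ltW.
have pB : 0 <= B / (A + B) by rewrite divr_ge0// ltW.
have pAB : A / (A + B) + B / (A + B) = 1 by rewrite -mulrDl divff// gt_eqF.
have ABQ : 0 <= (A + B) ^+ Q by rewrite exprn_ge0// ltW.
apply: le_trans (_ : (A + B) ^+ Q * (A / (A + B) * (power_sum Q N f a / A ^+ Q) +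
    B / (A + B) * (power_sum Q N f b / B ^+ Q)) <= _); last first.
  rewrite -[leRHS]mulr1 ler_wpM2l//.
  by rewrite -[leRHS]pAB lerD// ler_piMr.
rewrite /power_sum !mulr_suml !mulr_sumr -big_split/= mulr_sumr; apply: ler_sum => j _ /=.
have x0 := latnorm_ge0 latN (fun i => f j i * (a i + b i)).
have y0 := latnorm_ge0 latN (fun i => f j i * a i).
have z0 := latnorm_ge0 latN (fun i => f j i * b i).
have xyz : N (fun i => f j i * (a i + b i)) <=
    N (fun i => f j i * a i) + N (fun i => f j i * b i).
  apply: le_trans (latnormD latN _ _).
  by rewrite le_eqVlt; apply/orP; left; apply/eqP; congr N; apply/funext => i; rewrite mulrDr.
move: x0 y0 z0 xyz; move: (N _) (N _) (N _) => z y x x0 y0 z0 xyz.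
apply: le_trans (_ : (y + z) ^+ Q <= _); first by rewrite lerXn2r ?nnegrE ?addr_ge0.
have -> : y + z = (A + B) * (A / (A + B) * (y / A) + B / (A + B) * (z / B)).
  by field; rewrite !gt_eqF.
rewrite exprMn ler_wpM2l// -!expr_div_n exprn_convex//.
  by rewrite divr_ge0// ltW.
by rewrite divr_ge0// ltW.
Qed.

Lemma power_envelope_lattice : lattice_norm n (power_envelope n Q N).
Proof.
have leX a b : (F a <= F b) = (power_envelope n Q N a <= power_envelope n Q N b).
  by rewrite -!power_envelopeX ler_pXn2r ?nnegrE ?power_envelope_ge0.
have sep a : power_envelope n Q N a = 0 -> forall i, (i < n)%N -> a i = 0.
  move=> a0; apply: (latnorm0_eq0 latN); apply/eqP; rewrite eq_le (latnorm_ge0 latN) andbT.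
  by rewrite -a0 power_envelope_ge.
have mono a b : (forall i, (i < n)%N -> `|a i| <= `|b i|) ->
    power_envelope n Q N a <= power_envelope n Q N b.
  by move=> ab; rewrite -leX sup_power_sums_homo.
split=> //.
- move=> a b; set A := power_envelope _ _ _ a; set B := power_envelope _ _ _ b.
  have A0 : 0 <= A by exact: power_envelope_ge0.
  have B0 : 0 <= B by exact: power_envelope_ge0.
  have [a0|aN0] := eqVneq A 0.
    rewrite a0 add0r; apply: mono => i ni; by rewrite (sep _ a0)// add0r.
  have [b0|bN0] := eqVneq B 0.
    rewrite b0 addr0; apply: mono => i ni; by rewrite (sep _ b0)// addr0.
  rewrite -(@ler_pXn2r _ Q)// ?nnegrE; [|exact: power_envelope_ge0|exact: addr_ge0].
  rewrite power_envelopeX; apply: sup_power_sumsD; rewrite ?lt0r ?aN0 ?bN0//.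
    by rewrite -power_envelopeX.
  by rewrite -power_envelopeX.
- move=> k a; apply/eqP; rewrite eq_le; apply/andP; split.
    rewrite -(@ler_pXn2r _ Q)// ?nnegrE ?mulr_ge0 ?power_envelope_ge0//.
    by rewrite exprMn !power_envelopeX sup_power_sumsZ.
  have [->|k0] := eqVneq k 0; first by rewrite normr0 mul0r power_envelope_ge0.
  rewrite -(@ler_pXn2r _ Q)// ?nnegrE ?mulr_ge0 ?power_envelope_ge0//.
  rewrite exprMn !power_envelopeX mulrC -ler_pdivlMr ?exprn_gt0 ?normr_gt0//.
  have := sup_power_sumsZ k^-1 (fun i => k * a i).
  rewrite normrV ?unitfE// exprVn mulrC; apply: le_trans.
  by apply: sup_power_sums_homo => i ni; rewrite mulKf.
Qed.

(** A splitting [f] for [a] and a splitting [g] for [b], weighted by [|a| / |c|] and [|b| / |c|],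
    together form one splitting for [c]. Where [c] vanishes so do [a] and [b], so the division by
    zero is harmless. *)
Lemma power_envelope_concave : power_concave n Q (power_envelope n Q N).
Proof.
move=> a b c abc; rewrite !power_envelopeX.
rewrite -lerBrDr; apply: sup_power_sum_le => m f fP.
rewrite lerBrDr addrC -lerBrDr; apply: sup_power_sum_le => l g gP.
rewrite lerBrDr addrC.
pose h (j : 'I_(m + l)) (i : nat) : R := match fintype.split j with
  | inl k => f k i * (`|a i| / `|c i|)
  | inr k => g k i * (`|b i| / `|c i|) end.
have hl k : h (lshift l k) = fun i => f k i * (`|a i| / `|c i|).
  by apply/funext => i; rewrite /h (fintype.unsplitK (inl k)).
have hr k : h (rshift m k) = fun i => g k i * (`|b i| / `|c i|).
  by apply/funext => i; rewrite /h (fintype.unsplitK (inr k)).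
have Qn0 (x : R) : x ^+ Q = 0 -> x = 0 by move=> /eqP; rewrite expf_eq0 Q0 => /eqP.
have ca i : (i < n)%N -> c i = 0 -> a i = 0 /\ b i = 0.
  move=> ni ci; have := abc i ni; rewrite ci normr0 expr0n gtn_eqF//= => s0.
  have a0 : 0 <= `|a i| ^+ Q by rewrite exprn_ge0.
  have b0 : 0 <= `|b i| ^+ Q by rewrite exprn_ge0.
  by split; apply/normr0_eq0/Qn0; lra.
have hP : power_partition n Q h.
  case: fP gP => f0 f1 [g0 g1]; split=> [j i ni|i ni].
    rewrite -(fintype.splitK j); case: (fintype.split j) => k /=; rewrite ?hl ?hr.
      by rewrite mulr_ge0 ?divr_ge0// f0.
    by rewrite mulr_ge0 ?divr_ge0// g0.
  rewrite big_split_ord/=; under eq_bigr do rewrite hl exprMn.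
  under [X in _ + X]eq_bigr do rewrite hr exprMn.
  rewrite -!mulr_suml.
  apply: le_trans (_ : (`|a i| / `|c i|) ^+ Q + (`|b i| / `|c i|) ^+ Q <= _).
    by rewrite lerD// ler_piMl ?exprn_ge0 ?divr_ge0 ?f1 ?g1.
  have [c0|c0] := eqVneq (c i) 0.
    by rewrite c0 normr0 invr0 !mulr0 expr0n gtn_eqF// addr0.
  by rewrite !expr_div_n -mulrDl ler_pdivrMr ?exprn_gt0 ?normr_gt0// mul1r abc.
apply: le_trans (power_sum_le_sup c hP); rewrite /power_sum big_split_ord/=.
rewrite le_eqVlt; apply/orP; left; apply/eqP; congr (_ + _); apply: eq_bigr => j _.
  congr (_ ^+ _); apply: (latnorm_eq latN) => i ni; rewrite hl !normrM normfV !normr_id.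
  have [c0|c0] := eqVneq (c i) 0; first by rewrite (ca i ni c0).1 normr0 !mul0r !mulr0 mul0r.
  by rewrite -!mulrA mulVf ?normr_eq0// mulr1.
congr (_ ^+ _); apply: (latnorm_eq latN) => i ni; rewrite hr !normrM normfV !normr_id.
have [c0|c0] := eqVneq (c i) 0; first by rewrite (ca i ni c0).2 normr0 !mul0r !mulr0 mul0r.
by rewrite -!mulrA mulVf ?normr_eq0// mulr1.
Qed.

End theory.

(** On short vectors the envelopes for different lengths agree, so they define one norm on finitely
    supported sequences. *)
Lemma power_envelope_widen n m Q N N' a : (0 < Q)%N -> (n <= m)%N ->
  (forall b, (forall i, (n <= i)%N -> b i = 0) -> N b = N' b) ->
  (forall i, (n <= i)%N -> a i = 0) ->
  power_envelope n Q N a = power_envelope m Q N' a.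
Proof.
move=> Q0 nm NN a0; rewrite power_envelope.unlock; congr (sup _ `^ _).
apply/seteqP; split => z [l [f [[f0 f1] ->]]]; exists l.
  exists (fun j i => (i < n)%N%:R * f j i); split.
    split=> [j i _|i _]; first by case: ltnP => ni; rewrite ?mul0r// mul1r f0.
    case: (ltnP i n) => ni; first by under eq_bigr do rewrite mul1r; rewrite f1.
    rewrite big1// => j _; by rewrite mul0r expr0n gtn_eqF.
  apply: eq_bigr => j _; congr (_ ^+ _).
  rewrite NN => [|i ni]; last by rewrite a0// mulr0.
  congr N'; apply/funext => i; case: ltnP => ni; rewrite ?mul1r//.
  by rewrite a0// !mulr0.
exists f; split.
  split=> [j i ni|i ni]; first by rewrite f0// (leq_trans ni nm).
  by rewrite f1// (leq_trans ni nm).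
by apply: eq_bigr => j _; rewrite NN// => i ni; rewrite a0// mulr0.
Qed.

End power_envelope.

(** * Growth of disjoint sums and lower estimates *)

Section growth_of_disjoint_sums.
Context {R : realType}.
Implicit Types (N : (nat -> R) -> R) (u : nat -> R).

(** The quantitative form of the absence of [ell_infty^d]: a failure provides [d] disjoint pieces
    that behave like its unit vectors up to a factor 2. *)
Definition doubles_disjoint (d : nat) N : Prop :=
  forall (A : 'I_d -> pred nat) u r,
    (forall i j k, A j i -> A k i -> j = k) ->
    (forall j, r <= N (fun i => (A j i)%:R * u i)) -> 2 * r <= N u.

(** Iterate by cutting [d ^ k.+1] pieces into [d] consecutive groups of [d ^ k]; the offset [o] lets
    the induction hypothesis apply to each group. *)
Lemma doubles_disjointX n d N : lattice_norm n N -> doubles_disjoint d N ->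
  forall k o (B : nat -> pred nat) u r,
  (forall i j l, B j i -> B l i -> j = l) ->
  (forall j, (o <= j < o + d ^ k)%N -> r <= N (fun i => (B j i)%:R * u i)) ->
  2 ^+ k * r <=
  N (fun i => [exists j : 'I_(d ^ k), B (o + j)%N i]%:R * u i).
Proof.
move=> latN dN; elim=> [|k IH] o B u r Bd Br.
  rewrite expr0 mul1r; apply: le_trans (Br o _) _; first by rewrite leqnn addn1 ltnS/=.
  apply: (latnorm_le latN) => i _; rewrite !normrM ler_wpM2r// !normr_nat ler_nat.
  case: (boolP (B o i)) => // Bo; case: existsP => // h; exfalso; apply: h.
  by exists (Ordinal (ltn0Sn 0)); rewrite addn0.
pose A (l : 'I_d) : pred nat := fun i => [exists j : 'I_(d ^ k), B (o + l * d ^ k + j)%N i].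
rewrite exprS -mulrA; apply: (dN A) => [i j l|j].
  move=> /existsP[a Ba] /existsP[b Bb]; have := Bd _ _ _ Ba Bb => /eqP.
  rewrite -!addnA eqn_add2l => /eqP e; apply: val_inj => /=.
  have dk0 : (0 < d ^ k)%N by apply: leq_trans (ltn_ord a).
  have := congr1 (divn^~ (d ^ k)%N) e.
  by rewrite !divnMDl// !divn_small// !addn0.
apply: le_trans (IH (o + j * d ^ k)%N B u r Bd _) _.
  move=> l /andP[l1 l2]; apply: Br; rewrite (leq_trans _ l1) ?leq_addr//=.
  rewrite (leq_trans l2)// -addnA leq_add2l expnS addnC -mulSn leq_mul2r.
  by rewrite ltn_ord orbT.
apply: (latnorm_le latN) => i _; rewrite /A.
case: existsP => [[a Ba]|_]; last by rewrite mul0r normr0.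
rewrite mul1r; case: existsP => [_|[]]; first by rewrite /= !mul1r.
have lt : (j * d ^ k + a < d ^ k.+1)%N.
  apply: leq_trans (_ : j.+1 * d ^ k <= _)%N; first by rewrite mulSn addnC ltn_add2r.
  by rewrite expnS leq_mul2r ltn_ord orbT.
by exists (Ordinal lt); rewrite /= addnA.
Qed.

Lemma dyadic_level (v : R) : 0 < v <= 1 ->
  exists l : nat, 2^-1 ^+ l.+1 <= v <= 2^-1 ^+ l.
Proof.
move=> /andP[v0 v1].
have ex : exists l : nat, 2^-1 ^+ l.+1 <= v.
  exists (Num.truncn v^-1); rewrite exprVn -[leRHS]invrK lef_pV2 ?posrE ?exprn_gt0 ?invr_gt0//.
  apply: le_trans (_ : (Num.truncn v^-1).+1%:R <= _); first exact/ltW/truncnS_gt.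
  by rewrite -natrX ler_nat ltnW// ltn_expl.
case: (ex_minnP ex) => -[|l] hl minl; first by exists 0%N; rewrite hl expr0.
exists l.+1; rewrite hl/= leNgt; apply/negP => /ltW h.
by have := minl l h; rewrite ltnn.
Qed.

(** Sort the pieces by dyadic size and count each class. The exponent [d.+1] is large enough for the
    counts because [d <= 2 ^ d]. *)
Lemma doubles_disjoint_lower_estimate n d N : lattice_norm n N ->
  doubles_disjoint d N -> lower_estimate n d.+1 (2 * d%:R ^+ 2) N.
Proof.
move=> latN dN m B u Bd Nu.
pose v j := N (fun i => (B j i)%:R * u i).
have v0 j : 0 <= v j by exact: latnorm_ge0 latN _.
have v1 j : v j <= 1.
  apply: le_trans Nu; apply: (latnorm_le latN) => i _.
  by case: (B j i); rewrite ?mul1r// mul0r normr0.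
have lev j : exists l : nat, v j != 0 -> 2^-1 ^+ l.+1 <= v j <= 2^-1 ^+ l.
  have [->|vj] := eqVneq (v j) 0; first by exists 0%N.
  have [|l hl] := @dyadic_level (v j); first by rewrite lt0r vj v0 v1.
  by exists l.
have [lv lvP] := choice lev.
pose L := (\max_j lv j).+1.
pose J l := [pred j | (lv j == l) && (v j != 0)].
(* With [d ^ l.+2] pieces of norm at least [2 ^ -(l + 1)], doubling [l.+2] times would give norm 2
   in the unit ball. *)
have card_J l : (#|J l| < d ^ l.+2)%N.
  rewrite ltnNge; apply/negP => h.
  pose B' k : pred nat := if (k < #|J l|)%N =P true is ReflectT kl then B (enum_val (Ordinal kl)) else pred0.
  have := @doubles_disjointX n d N latN dN l.+2 0%N B' u (2^-1 ^+ l.+1) _ _.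
  have h1 : forall i j k, B' j i -> B' k i -> j = k.
    move=> i j k; rewrite /B'; case: eqP => // jl Bj; case: eqP => // kl Bk.
    by have /enum_val_inj/(congr1 val) := Bd _ _ _ Bj Bk.
  have h2 j : (0 <= j < 0 + d ^ l.+2)%N -> 2^-1 ^+ l.+1 <= N (fun i => (B' j i)%:R * u i).
    move=> /= jd; rewrite /B'; case: eqP => [jl|]; last by rewrite (leq_trans jd).
    set k := enum_val _; have : k \in J l by exact: enum_valP.
    by rewrite inE => /andP[/eqP <- vk]; case/andP: (lvP k vk).
  move=> /(_ h1 h2).
  rewrite exprS -mulrA -exprMn divff// expr1n mulr1 => /le_trans/(_ (_ : _ <= 1)) h3.
  suff : (2 : R) <= 1 by lra.
  apply: h3; apply: le_trans Nu; apply: (latnorm_le latN) => i _.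
  by case: [exists _, _]; rewrite ?mul1r// mul0r normr0.
apply: le_trans (_ : \sum_(j < m) \sum_(l < L) (J l j)%:R * (2^-1 ^+ l) ^+ d.+1 <= _).
  apply: ler_sum => j _; rewrite -/(v j).
  have [vj0|vj] := eqVneq (v j) 0.
    rewrite vj0 expr0n/=; apply: sumr_ge0 => l _.
    by rewrite mulr_ge0 ?exprn_ge0.
  have lL : (lv j < L)%N by rewrite ltnS; exact: leq_bigmax.
  rewrite (bigD1 (Ordinal lL))//= eqxx vj mul1r.
  apply: ler_wpDr; first by apply: sumr_ge0 => l _; rewrite mulr_ge0 ?exprn_ge0.
  by rewrite lerXn2r ?nnegrE ?exprn_ge0//; case/andP: (lvP j vj).
rewrite exchange_big/=.
(* Class [l] contributes at most [d ^ (l + 2) * 2 ^ -(l * (d + 1))], which is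
   [d ^ 2 * (d / 2 ^ (d + 1)) ^ l], and the ratio is at most 1/2. *)
apply: le_trans (_ : \sum_(l < L) d%:R ^+ 2 * 2^-1 ^+ l <= _); last first.
  rewrite -mulr_sumr mulrC ler_wpM2r ?exprn_ge0//; exact/ltW/sum_half_pow.
apply: ler_sum => l _; rewrite -mulr_suml.
have -> : \sum_(j < m) (J l j)%:R = #|J l|%:R :> R.
  by rewrite -natr_sum -big_mkcond/= sum1_card.
apply: le_trans (_ : (d ^ l.+2)%:R * (2^-1 ^+ l) ^+ d.+1 <= _).
  by rewrite ler_wpM2r ?exprn_ge0// ler_nat ltnW// card_J.
have -> : (2^-1 ^+ l) ^+ d.+1 = (2^-1 ^+ d.+1) ^+ l :> R by rewrite -!exprM mulnC.
rewrite -addn2 natrX addnC exprD -mulrA ler_wpM2l ?exprn_ge0// -exprMn.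
rewrite lerXn2r ?nnegrE ?mulr_ge0 ?exprn_ge0//.
rewrite exprS mulrCA ler_piMr// exprVn ler_pdivrMr ?exprn_gt0// mul1r.
by rewrite -natrX ler_nat ltnW// ltn_expl.
Qed.

End growth_of_disjoint_sums.

(** * Unconditional bases *)

Section block_permutation.
Variables (m : nat -> nat) (A : nat -> pred nat).
Hypothesis m0 : m 0%N = 0%N.
Hypothesis m_incr : forall k, (m k < m k.+1)%N.

Let block k := [seq i <- index_iota (m k) (m k.+1) | A k i] ++
  [seq i <- index_iota (m k) (m k.+1) | ~~ A k i].

Let perm_block k : perm_eq (block k) (index_iota (m k) (m k.+1)).
Proof. by apply/permPl; exact: perm_filterC. Qed.

Let size_block k : size (block k) = (m k.+1 - m k)%N.
Proof. by rewrite (perm_size (perm_block k)) size_iota. Qed.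

Let uniq_block k : uniq (block k).
Proof. by rewrite (perm_uniq (perm_block k)) iota_uniq. Qed.

Let mem_block k i : (i \in block k) = (m k <= i < m k.+1)%N.
Proof. by rewrite (perm_mem (perm_block k)) mem_index_iota. Qed.

Let block_of i : {k | (m k <= i < m k.+1)%N}.
Proof.
apply: cid; elim: i => [|i [k /andP[k1 k2]]]; first by exists 0%N; rewrite m0 -[X in (X < _)%N]m0 m_incr.
have [ki|ki] := ltnP i.+1 (m k.+1); first by exists k; rewrite ki (leq_trans k1).
have -> : i.+1 = m k.+1 by apply/eqP; rewrite eqn_leq k2 ki.
by exists k.+1; rewrite leqnn m_incr.
Qed.

Let block_inj k l i : (m k <= i < m k.+1)%N -> (m l <= i < m l.+1)%N -> k = l.
Proof.
have mm : {homo m : a b / (a <= b)%N} by apply: homo_leq => // [b a c|a]; [exact: leq_trans|exact: ltnW].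
move=> /andP[k1 k2] /andP[l1 l2]; apply/eqP; rewrite eqn_leq.
apply/andP; split; rewrite leqNgt; apply/negP => h.
  by have := mm _ _ h; rewrite leqNgt (leq_ltn_trans k1 l2).
by have := mm _ _ h; rewrite leqNgt (leq_ltn_trans l1 k2).
Qed.

(** Listing [A k] first inside the block from [m k] to [m k.+1] makes a sum over a subset a sum over
    consecutive indices, to which the Cauchy criterion for the rearranged series applies. *)
Lemma exists_block_permutation : exists s : nat -> nat, bijective s /\
  forall (V : zmodType) (u : nat -> V) k, exists l,
    \sum_(m k <= i < m k + l) u (s i) = \sum_(m k <= i < m k.+1 | A k i) u i.
Proof.
pose kk i := sval (block_of i).
have kkP i : (m (kk i) <= i < m (kk i).+1)%N by exact: (svalP (block_of i)).
have kkE k i : (m k <= i < m k.+1)%N -> kk i = k by move=> h; exact: block_inj (kkP i) h.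
pose s i := nth 0%N (block (kk i)) (i - m (kk i)).
pose t j := (m (kk j) + index j (block (kk j)))%N.
have s_in i : s i \in block (kk i).
  apply: mem_nth; rewrite size_block ltn_sub2r//; by case/andP: (kkP i).
have kks i : kk (s i) = kk i by apply: kkE; rewrite -mem_block.
have t_in j : (m (kk j) <= t j < m (kk j).+1)%N.
  rewrite leq_addr/= -ltn_subRL -size_block index_mem mem_block; exact: kkP.
have kkt j : kk (t j) = kk j by apply: kkE.
exists s; split.
  exists t => [i|j].
    rewrite /t kks index_uniq// ?size_block ?subnKC//; first by case/andP: (kkP i).
    by rewrite ltn_sub2r//; case/andP: (kkP i).
  rewrite /s kkt /t addKn nth_index// mem_block; exact: kkP.
move=> V u k; exists (size [seq i <- index_iota (m k) (m k.+1) | A k i]).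
set l := size _; rewrite -[RHS]big_filter.
have lm : (l <= m k.+1 - m k)%N by rewrite -size_block /block size_cat leq_addr.
rewrite -[X in \big[_/_]_(X <= _ < _) _]add0n big_addn [(m k + l)%N]addnC addnK.
rewrite [RHS](big_nth 0%N) -/l !big_mkord.
apply: eq_bigr => i _; congr u; rewrite /s.
have -> : kk (i + m k)%N = k.
  apply: kkE; rewrite leq_addl/= addnC -ltn_subRL; exact: leq_trans lm.
by rewrite addnK /block nth_cat ltn_ord.
Qed.

End block_permutation.

Section unconditional_bounded.
Context {R : realType} (X : normedModType R).
Implicit Types (u : nat -> X).

(** A point of the cube is a convex combination of vertices, resolved one coordinate at a time; the
    translation [v] carries the coordinates already resolved. *)
Lemma norm_sum_convex (M : R) n v u (b : nat -> R) :
  (forall A : pred nat, `|v + \sum_(i < n | A i) u i| <= M) ->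
  (forall i, 0 <= b i <= 1) -> `|v + \sum_(i < n) b i *: u i| <= M.
Proof.
move=> vM b01; elim: n v vM => [|n IH] v vM.
  by have := vM xpredT; rewrite !big_ord0.
have /andP[b0 b1] := b01 n.
have -> : v + \sum_(i < n.+1) b i *: u i =
    (1 - b n) *: (v + \sum_(i < n) b i *: u i) +
    b n *: (v + u n + \sum_(i < n) b i *: u i).
  rewrite big_ord_recr/= [v + u n + _]addrAC [b n *: (_ + u n)]scalerDr [RHS]addrA -scalerDl subrK scale1r.
  by rewrite addrA.
have IH0 : `|v + \sum_(i < n) b i *: u i| <= M.
  apply: IH => A; have := vM (fun i => (i < n)%N && A i).
  rewrite big_mkcond big_ord_recr/= ltnn addr0 [X in _ -> `|_ + X| <= _]big_mkcond.
  by under eq_bigr do rewrite ltn_ord.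
have IH1 : `|v + u n + \sum_(i < n) b i *: u i| <= M.
  apply: IH => A; have := vM (fun i => (i == n) || A i).
  rewrite big_mkcond big_ord_recr/= eqxx [X in _ -> `|_ + X| <= _]big_mkcond.
  under eq_bigr do rewrite ltn_eqF//.
  by rewrite -addrA [u n + _]addrC.
apply: le_trans (ler_normD _ _) _; rewrite !normrZ (ger0_norm b0) ger0_norm ?subr_ge0//.
rewrite -[leRHS](_ : (1 - b n) * M + b n * M = M); last by rewrite -mulrDl subrK mul1r.
by rewrite lerD// ler_wpM2l// subr_ge0.
Qed.

Lemma norm_multiplier_le (M : R) n u (b : nat -> R) :
  (forall A : pred nat, `|\sum_(i < n | A i) u i| <= M) ->
  (forall i, `|b i| <= 1) -> `|\sum_(i < n) b i *: u i| <= 2 * M.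
Proof.
move=> uM b1.
have part (c : nat -> R) : (forall i, 0 <= c i <= 1) -> `|\sum_(i < n) c i *: u i| <= M.
  by move=> c01; rewrite -[X in `|X|]add0r; apply: norm_sum_convex => // A; rewrite add0r.
have -> : \sum_(i < n) b i *: u i =
    \sum_(i < n) Num.max (b i) 0 *: u i - \sum_(i < n) Num.max (- b i) 0 *: u i.
  rewrite -sumrB; apply: eq_bigr => i _; rewrite -scalerBl; congr (_ *: _).
  rewrite maxC [X in _ - X]maxC; case: (lerP 0 (b i)) => b0.
    by rewrite max_l ?subr0// oppr_le0.
  by rewrite max_r ?sub0r ?opprK// oppr_ge0 ltW.
apply: le_trans (ler_normB _ _) _; rewrite mulr_natl mulr2n.
apply: lerD;
  [apply: (part (fun i => Num.max (b i) 0))|apply: (part (fun i => Num.max (- b i) 0))] => i.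
  by have := b1 i; rewrite ler_norml le_max lexx orbT ge_max ler01 => /andP[_ ->].
by have := b1 i; rewrite ler_norml le_max lexx orbT ge_max ler01 lerNl => /andP[->].
Qed.

(* Otherwise the rearrangement listing first, in each of infinitely many blocks
   of indices, a subset with large sum is not Cauchy. *)
Lemma unconditionally_cvg_tail u : unconditionally_cvg u ->
  exists m, forall n (A : pred nat), `|\sum_(m <= i < n | A i) u i| <= 1.
Proof.
move=> uu; apply: contrapT => /forallNP H.
have {}H m : exists nA : nat * pred nat,
    (m < nA.1)%N /\ 1 < `|\sum_(m <= i < nA.1 | nA.2 i) u i|.
  have /existsNP[n /existsNP[A /negP]] := H m; rewrite -ltNge => h.
  exists (n, A); split => //=; rewrite ltnNge; apply/negP => nm.
  by rewrite big_geq// normr0 ltr10 in h.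
have [g gP] := choice H.
pose m := fix m k := if k is k'.+1 then (g (m k')).1 else 0%N.
have m_incr k : (m k < m k.+1)%N by case: (gP (m k)).
have [s [sb sP]] := exists_block_permutation (fun k => (g (m k)).2) (erefl : m 0%N = 0%N) m_incr.
have mk k : (k <= m k)%N.
  by elim: k => // k IH; exact: leq_ltn_trans IH (m_incr k).
have := uu s sb => /cvg_cauchy/cauchy_seriesP/(_ 1 ltr01).
move=> [[P Q] /= [[a _ Pa] [b _ Qb]] PQ].
pose k := maxn a b.
have [l hl] := sP _ u k.
have := PQ (m k, m k + l)%N; rewrite /= hl => PQk.
have [_ /ltW] := gP (m k); rewrite leNgt => /negP; apply; apply: PQk; split.
  by apply: Pa; rewrite /= (leq_trans _ (mk k))// leq_maxl.
apply: Qb; rewrite /= (leq_trans _ (leq_addr _ _))// (leq_trans _ (mk k))//.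
exact: leq_maxr.
Qed.

Lemma unconditionally_cvg_bounded u : unconditionally_cvg u ->
  exists M, forall n (b : nat -> R), (forall i, `|b i| <= 1) ->
    `|\sum_(i < n) b i *: u i| <= M.
Proof.
move=> /unconditionally_cvg_tail[m hm].
exists (2 * (\sum_(i < m) `|u i| + 1)) => n b b1; apply: norm_multiplier_le => // A.
have [nm|mn] := leqP n m.
  apply: le_trans (_ : \sum_(i < n) `|u i| <= _).
    rewrite (le_trans (ler_norm_sum _ _ _))// big_mkcond/=; apply: ler_sum => i _.
    by case: ifP.
  rewrite -(subnKC nm) big_split_ord/= -addrA lerDl addr_ge0// sumr_ge0//.
rewrite -(big_mkord A u) (big_cat_nat (n := m))//=; last exact: ltnW.
rewrite (le_trans (ler_normD _ _))// lerD// big_mkord.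
rewrite (le_trans (ler_norm_sum _ _ _))// big_mkcond/=; apply: ler_sum => i _.
by case: ifP.
Qed.

End unconditional_bounded.

(** * A multiplier bound uniform over all vectors *)

Section basis_constant.
Context {R : realType}.

Lemma cvgn_of_cauchy (V : completeNormedModType R) (s : nat -> V) :
  (forall e : R, 0 < e -> exists J0, forall J, (J0 <= J)%N -> `|s J - s J0| < e) ->
  cvgn s.
Proof.
move=> h; apply/cauchy_cvgP/cauchy_exP => e e0; have [J0 hJ0] := h e e0.
exists (s J0); exists J0 => // J /= /hJ0; rewrite -ball_normE/= distrC.
by [].
Qed.

Lemma cvgn_norm_le (V : normedModType R) (s : nat -> V) (l : V) (M : R) :
  s @ \oo --> l -> (forall n, `|s n| <= M) -> `|l| <= M.
Proof.
move=> sl sM; apply/ler_addgt0Pr => e e0.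
have /cvgrPdist_lt/(_ e e0)[n _ /(_ n (leqnn n))/ltW h] := sl.
by rewrite -[l](subrK (s n)) addrC (le_trans (ler_normD _ _))// lerD.
Qed.

Lemma cvg_half_pow : (fun J => (2^-1 : R) ^+ J) @ \oo --> (0 : R).
Proof. by apply: cvg_expr; rewrite ger0_norm//; lra. Qed.

Variables (X : completeNormedModType R) (e : nat -> X) (c : X -> nat -> R).
Hypothesis c_cvg : forall x, series (fun k => c x k *: e k) @ \oo --> x.
Hypothesis c_uniq : forall x a, series (fun k => a k *: e k) @ \oo --> x -> a = c x.
Hypothesis c_bounded : forall x, exists M, forall n (b : nat -> R),
  (forall i, `|b i| <= 1) -> `|\sum_(i < n) (b i * c x i) *: e i| <= M.

Let V (M : R) : set X := [set x | forall n (b : nat -> R), (forall i, `|b i| <= 1) ->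
  `|\sum_(i < n) (b i * c x i) *: e i| <= M].

Let cD x y i : c (x + y) i = c x i + c y i.
Proof.
rewrite -(@c_uniq _ (fun i => c x i + c y i))//.
rewrite (_ : series _ = fun n => series (fun k => c x k *: e k) n + series (fun k => c y k *: e k) n).
  exact: (cvgD (@c_cvg x) (@c_cvg y)).
by apply/funext => n; rewrite /series/= -big_split/=; apply: eq_bigr => k _; rewrite scalerDl.
Qed.

Let cZ t x i : c (t *: x) i = t * c x i.
Proof.
rewrite -(@c_uniq _ (fun i => t * c x i))//.
rewrite (_ : series _ = fun n => t *: series (fun k => c x k *: e k) n).
  by apply: (@cvgZl_tmp _ _ _ _ _ t (series (fun k => c x k *: e k))); exact: c_cvg.
by apply/funext => n; rewrite /series/= scaler_sumr; apply: eq_bigr => k _; rewrite scalerA.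
Qed.

Let cB x y i : c (x - y) i = c x i - c y i.
Proof. by rewrite cD -scaleN1r cZ mulN1r. Qed.

Let c0 i : c 0 i = 0.
Proof. by rewrite -(subrr (0 : X)) cB subrr. Qed.

Lemma basis_neq0 i : e i != 0.
Proof.
apply/eqP => ei; have := @c_uniq 0 (fun k => (k == i)%:R).
rewrite (_ : series _ = fun=> 0) => [/(_ (@cvg_cst _ _ _ _ _))/(congr1 (@^~ i))|].
  by rewrite c0 eqxx => /eqP; rewrite oner_eq0.
apply/funext => n; rewrite /series/= big1// => k _.
by case: eqP => [->|_]; rewrite ?ei ?scaler0 ?scale0r.
Qed.

Let VD M M' x y : V M x -> V M' y -> V (M + M') (x + y).
Proof.
move=> Vx Vy n b b1; apply: le_trans (lerD (Vx n b b1) (Vy n b b1)).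
rewrite (le_trans _ (ler_normD _ _))// -big_split/= le_eqVlt; apply/orP; left; apply/eqP.
by congr `|_|; apply: eq_bigr => i _; rewrite cD mulrDr scalerDl.
Qed.

Let VZ M t x : V M x -> V (`|t| * M) (t *: x).
Proof.
move=> Vx n b b1; have := ler_wpM2l (normr_ge0 t) (Vx n b b1); apply: le_trans.
rewrite -normrZ scaler_sumr le_eqVlt; apply/orP; left; apply/eqP.
by congr `|_|; apply: eq_bigr => i _; rewrite cZ scalerA mulrCA.
Qed.

Let VS M M' x : M <= M' -> V M x -> V M' x.
Proof. by move=> MM Vx n b b1; apply: le_trans MM; exact: Vx. Qed.

(** Completeness for the multiplier norm, although the coordinates [c] are not yet known to be
    continuous on [X]: they converge along [w] because a bound [V M x] controls each
    [|c x i| * |e i|]. The limits expand [y], by an estimate uniform in the length of the sum, so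
    uniqueness identifies them with [c y]. *)
Let V_complete (w : nat -> X) (y : X) (d : nat -> R) : w @ \oo --> y -> d @ \oo --> (0 : R) ->
  (forall J J', (J <= J')%N -> V (d J) (w J' - w J)) -> forall J, V (d J) (y - w J).
Proof.
move=> wy d0 wV.
have ccvg i : cvgn (fun J => c (w J) i : R).
  apply: cvgn_of_cauchy => r r0.
  have ei : 0 < `|e i| by rewrite normr_gt0 basis_neq0.
  have /cvgrPdist_lt/(_ _ (mulr_gt0 r0 ei))[J0 _ hJ0] := d0.
  exists J0 => J JJ; have := hJ0 J0 (leqnn _); rewrite /= sub0r normrN => hr.
  rewrite -(ltr_pM2r ei); apply: le_lt_trans hr; rewrite -normrZ -cB.
  apply: le_trans (ler_norm _).
  have := wV J0 J JJ i.+1 (fun k => (k == i)%:R).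
  rewrite big_ord_recr/= eqxx mul1r big1 ?add0r; first by apply=> k; rewrite normr_nat; case: eqP.
  by move=> k _; rewrite ltn_eqF ?ltn_ord// mul0r scale0r.
pose a i := limn (fun J => c (w J) i : R).
have aV J n (b : nat -> R) : (forall i, `|b i| <= 1) ->
    `|\sum_(i < n) (b i * (a i - c (w J) i)) *: e i| <= d J.
  move=> b1.
  apply: (@cvgn_norm_le _ (fun J' => \sum_(i < n) (b i * (c (w (J' + J)%N) i - c (w J) i)) *: e i)).
    apply: cvg_big => [|i _]; first exact: add_continuous.
    apply: cvgZr_tmp; apply: cvgMl_tmp; apply: cvgB; last exact: cvg_cst.
    by rewrite (cvg_shiftn J (fun J => c (w J) i : R)); exact: ccvg.
  move=> J'; have := wV J (J' + J)%N (leq_addl _ _) n b b1.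
  by under eq_bigr do rewrite cB.
have ya : a = c y.
  apply: c_uniq; apply/cvgrPdist_lt => r r0.
  have r3 : 0 < r / 3 by rewrite divr_gt0.
  have /cvgrPdist_lt/(_ _ r3)[J1 _ hJ1] := d0.
  have /cvgrPdist_lt/(_ _ r3)[J2 _ hJ2] := wy.
  pose J := maxn J1 J2.
  have dJ : d J < r / 3.
    have := hJ1 J (leq_maxl _ _); rewrite /= sub0r normrN.
    by apply: le_lt_trans; exact: ler_norm.
  have wJ := hJ2 J (leq_maxr _ _); rewrite /= in wJ.
  have /cvgrPdist_lt/(_ _ r3)[n0 _ hn0] := @c_cvg (w J).
  exists n0 => // n /= nn0; have := hn0 n nn0; rewrite /= => sn.
  have -> : y - series (fun k => a k *: e k) n =
      (y - w J) + ((w J - series (fun k => c (w J) k *: e k) n) -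
       \sum_(i < n) (1 * (a i - c (w J) i)) *: e i).
    under eq_bigr do rewrite mul1r scalerBl.
    by rewrite sumrB /series/= !big_mkord opprB !subrKA.
  have := aV J n (fun=> 1); rewrite normr1 => /(_ (fun=> lexx _)) aJ.
  apply: le_lt_trans (ler_normD _ _) _.
  have := ler_normB (w J - series (fun k => c (w J) k *: e k) n)
     (\sum_(i < n) (1 * (a i - c (w J) i)) *: e i).
  lra.
move=> J n b b1; have := aV J n b b1.
by under eq_bigr do rewrite ya -cB.
Qed.

(* The open mapping argument for the norm [sup |\sum b i c i e i|]: by Baire its
   unit ball is dense near 0, and [V_complete] sums successive approximations. *)
Lemma basis_multiplier_bound : exists2 K : R, 0 < K & forall n (a b : nat -> R),
  (forall i, `|b i| <= 1) ->
  `|\sum_(i < n) (b i * a i) *: e i| <= K * `|\sum_(i < n) a i *: e i|.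
Proof.
have [k [U [[x0 Ux0] oU UV]]] : exists (k : nat) (U : set X),
    [/\ U !=set0, open U & U `<=` closure (V k%:R)].
  apply: contrapT => H.
  have dF k : open (~` closure (V k%:R)) /\ dense (~` closure (V k%:R)).
    split; first by apply: closed_openC; exact: closed_closure.
    move=> U U0 oU; apply: contrapT => /set0P/negP/negPn/eqP UV; apply: H.
    exists k, U; split => //; rewrite -[X in _ `<=` X]setCK.
    by apply/disjoints_subset.
  have [x [_ xF]] := Baire dF (ex_intro _ (0 : X) I) openT.
  have [M xM] := c_bounded x.
  apply: (xF (Num.truncn M).+1 I); apply: subset_closure => n b b1.
  exact: le_trans (xM n b b1) (ltW (truncnS_gt _)).
have [r r0 rU] : exists2 r : R, 0 < r & ball x0 r `<=` U.
  have /nbhs_ballP[r r0 rU] : nbhs x0 U by exact: open_nbhs_nbhs.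
  by exists r.
pose M : R := k%:R; have M0 : 0 <= M by exact: ler0n.
have near1 z ep : `|x0 - z| < r -> 0 < ep -> exists2 v, V M v & `|z - v| < ep.
  move=> zr ep0; have zU : U z by apply: rU; rewrite -ball_normE.
  have [v [Vv]] := UV z zU (ball z ep) (nbhsx_ballx _ _ ep0).
  by rewrite -ball_normE/= => zv; exists v.
(* Density near [x0] becomes density near 0, since [V M] is symmetric and convex and [y] is half the
   difference of [x0 + y] and [x0 - y]. *)
have near2 y ep : `|y| < r -> 0 < ep -> exists2 v, V M v & `|y - v| < ep.
  move=> yr ep0.
  have [|v Vv yv] := near1 (x0 + y) ep _ ep0; first by rewrite opprD addNKr normrN.
  have [|v' Vv' yv'] := near1 (x0 - y) ep _ ep0; first by rewrite opprB addrCA subrr addr0.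
  exists (2^-1 *: (v - v')).
    have : V (M + M) (v - v').
      by apply: VD => //; have := VZ (-1) Vv'; rewrite normrN1 mul1r scaleN1r.
    move=> /(VZ (2^-1)); rewrite ger0_norm// (_ : 2^-1 * (M + M) = M)//; lra.
  have -> : y - 2^-1 *: (v - v') = 2^-1 *: ((x0 + y - v) - (x0 - y - v')).
    rewrite [- (x0 - y - v')]opprD opprK addrACA opprB [x0 + y]addrC [y + x0 + _]addrACA subrr addr0.
    rewrite [RHS]scalerDr (_ : y + y = (2 : R) *: y) ?scalerA ?mulVf ?scale1r//; last first.
      by rewrite scaler_nat mulr2n.
    congr (_ + _).
    by rewrite -scalerN opprB addrC.
  rewrite normrZ ger0_norm//; have := ler_normB (x0 + y - v) (x0 - y - v'); lra.
have near3 y rho ep : 0 < rho -> `|y| < rho -> 0 < ep ->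
    exists2 v, V (M / r * rho) v & `|y - v| < ep.
  move=> rho0 yrho ep0.
  have rr : 0 < r / rho by rewrite divr_gt0.
  have [||v Vv yv] := near2 (r / rho *: y) (r / rho * ep).
  - by rewrite normrZ gtr0_norm// -ltr_pdivlMl// invf_div divfK ?gt_eqF.
  - by rewrite mulr_gt0.
  have rri : 0 < rho / r by rewrite divr_gt0.
  exists (rho / r *: v).
    by have := VZ (rho / r) Vv; rewrite gtr0_norm// [M / r * rho]mulrAC [M * rho]mulrC -mulrAC.
  have -> : y - rho / r *: v = rho / r *: (r / rho *: y - v).
    by rewrite scalerBr scalerA mulf_div [rho * r]mulrC divff ?scale1r// gt_eqF// mulr_gt0.
  by rewrite normrZ gtr0_norm// -ltr_pdivlMl// invf_div.
pose K := M / r; have K0 : 0 <= K by rewrite divr_ge0// ltW.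
pose h J : R := 2^-1 ^+ J.
have h0 J : 0 < h J by rewrite exprn_gt0// invr_gt0.
have hS J : h J = 2 * h J.+1 by rewrite /h exprS mulrA divff// mul1r.
(* [w J] approximates [y] within [2 ^ -J], and its [J]-th increment lies in [V (K * 2 ^ -J)]; these
   radii sum to [2 * K]. The choice function takes the pair of [J] and [w J], with value 0 outside
   the relevant pairs. *)
have unit_ball y : `|y| < 1 -> V (2 * K) y.
  move=> y1.
  have H (p : nat * X) : exists v, `|y - p.2| < h p.1 ->
      V (K * h p.1) v /\ `|y - (p.2 + v)| < h p.1.+1.
    have [yp|yp] := pselect (`|y - p.2| < h p.1); last by exists 0.
    have [v Vv yv] := near3 _ _ _ (h0 p.1) yp (h0 p.1.+1).
    by exists v => _; rewrite opprD addrA.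
  have [g gP] := choice H.
  pose w := fix w J := if J is J'.+1 then w J' + g (J', w J') else 0.
  have wP J : `|y - w J| < h J.
    elim: J => [|J IH]; first by rewrite /= subr0 /h expr0.
    by have [] := gP (J, w J) IH.
  have wV J J' : (J <= J')%N -> V (2 * K * h J) (w J' - w J).
    move=> /subnKC <-; set l := (J' - J)%N.
    have : V (2 * K * (h J - h (J + l)%N)) (w (J + l)%N - w J).
      elim: l => [|l IH].
        rewrite addn0 !subrr mulr0 => n b b1.
        by rewrite big1 ?normr0// => i _; rewrite c0 mulr0 scale0r.
      rewrite addnS /= addrAC; have [Vg _] := gP (_, _) (wP (J + l)%N).
      apply: VS (VD IH Vg); rewrite /= (hS (J + l)%N); lra.
    apply: VS; apply: ler_wpM2l; first by rewrite mulr_ge0.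
    by rewrite gerBl ltW.
  have wy : w @ \oo --> y.
    apply/cvgrPdist_lt => ep ep0.
    have /cvgrPdist_lt/(_ _ ep0)[J0 _ hJ0] := cvg_half_pow.
    exists J0 => // J /hJ0; rewrite /= sub0r normrN ger0_norm ?exprn_ge0//.
    exact: lt_trans (wP J).
  have d0 : (fun J => 2 * K * h J) @ \oo --> (0 : R).
    by rewrite -[X in _ --> X](mulr0 (2 * K)); apply: cvgMl_tmp; exact: cvg_half_pow.
  by have := V_complete wy d0 wV 0%N; rewrite /= subr0 /h expr0 mulr1.
(* Vectors are scaled to norm 1/2 to enter the open unit ball, which doubles [2 * K]; the 1 ensures
   positivity. *)
exists (4 * K + 1); first by rewrite ltr_wpDl// mulr_ge0.
move=> n a b b1; set x := \sum_(i < n) a i *: e i.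
have xa i : c x i = (i < n)%N%:R * a i.
  rewrite -(@c_uniq x (fun i => (i < n)%N%:R * a i))//.
  apply/cvgrPdist_lt => ep ep0; exists n => // m /= nm.
  rewrite (_ : series _ m = x) ?subrr ?normr0// /series/= big_mkord.
  rewrite -(subnKC nm) big_split_ord/= [X in _ + X]big1 ?addr0.
    by apply: eq_bigr => k' _; rewrite ltn_ord mul1r.
  by move=> k' _; rewrite ltnNge leq_addr mul0r scale0r.
have -> : \sum_(i < n) (b i * a i) *: e i = \sum_(i < n) (b i * c x i) *: e i.
  by apply: eq_bigr => i _; rewrite xa ltn_ord mul1r.
have [->|x0'] := eqVneq x 0.
  by rewrite big1 ?normr0 ?mulr0// => i _; rewrite c0 mulr0 scale0r.
have nx : 0 < `|x| by rewrite normr_gt0.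
have : V (2 * K) ((2 * `|x|)^-1 *: x).
  apply: unit_ball; rewrite normrZ ger0_norm ?invr_ge0 ?mulr_ge0//.
  by rewrite invfM -mulrA mulVf ?gt_eqF// mulr1; lra.
move=> /(VZ (2 * `|x|)); rewrite scalerA divff ?mulf_neq0 ?gt_eqF// scale1r.
move=> /(_ n b b1)/le_trans; apply.
rewrite ger0_norm ?mulr_ge0//.
have : 0 <= K * `|x| by rewrite mulr_ge0.
lra.
Qed.

End basis_constant.

(** * The unconditional norm, and copies of [ell_infty^n] *)

Definition multiplier_norms (R : realType) (X : normedModType R) (e : nat -> X)
    n (a : nat -> R) : set R :=
  [set z | exists2 b : nat -> R, (forall i, `|b i| <= 1) &
    z = `|\sum_(i < n) (b i * a i) *: e i|].

HB.lock Definition unconditional_norm (R : realType) (X : normedModType R)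
    (e : nat -> X) n (a : nat -> R) : R :=
  sup (multiplier_norms e n a).

Section unconditional_norm.
Context {R : realType} (X : normedModType R) (e : nat -> X).
Implicit Types (a b u : nat -> R).

Hypothesis e_neq0 : forall i, e i != 0.

Let sup_norms n a : has_sup (multiplier_norms e n a).
Proof.
split; first by exists `|\sum_(i < n) (1 * a i) *: e i|, (fun=> 1) => // i; rewrite normr1.
exists (\sum_(i < n) `|a i| * `|e i|) => _ [b b1 ->].
apply: le_trans (ler_norm_sum _ _ _) _; apply: ler_sum => i _.
by rewrite normrZ normrM ler_wpM2r// ler_piMl.
Qed.

Lemma unconditional_norm_ge n a b : (forall i, `|b i| <= 1) ->
  `|\sum_(i < n) (b i * a i) *: e i| <= unconditional_norm e n a.
Proof.
move=> b1; rewrite unconditional_norm.unlock.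
by apply: ub_le_sup; [case: (sup_norms n a)|exists b].
Qed.

Lemma unconditional_norm_le n a (M : R) : (forall b, (forall i, `|b i| <= 1) ->
  `|\sum_(i < n) (b i * a i) *: e i| <= M) -> unconditional_norm e n a <= M.
Proof.
move=> h; rewrite unconditional_norm.unlock.
by apply: ge_sup => [|_ [b b1 ->]]; [case: (sup_norms n a)|exact: h].
Qed.

Lemma norm_le_unconditional_norm n a :
  `|\sum_(i < n) a i *: e i| <= unconditional_norm e n a.
Proof.
apply: le_trans (@unconditional_norm_ge n a (fun=> 1) _); last by move=> _; rewrite normr1.
by under [in leRHS]eq_bigr do rewrite mul1r.
Qed.

Lemma unconditional_norm_widen n m a : (n <= m)%N ->
  (forall i, (n <= i)%N -> a i = 0) ->
  unconditional_norm e n a = unconditional_norm e m a.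
Proof.
move=> nm a0; rewrite unconditional_norm.unlock; congr sup.
have E b : \sum_(i < m) (b i * a i) *: e i = \sum_(i < n) (b i * a i) *: e i.
  rewrite -(subnKC nm) big_split_ord/= [X in _ + X]big1 ?addr0// => i _.
  by rewrite a0 ?leq_addr// mulr0 scale0r.
by apply/seteqP; split => z [b b1 ->]; exists b; rewrite // E.
Qed.

(** Taking the supremum over multipliers makes the basis 1-unconditional. Monotonicity follows by
    absorbing the ratios [a i / b i] into the multiplier. *)
Lemma unconditional_norm_lattice n : lattice_norm n (unconditional_norm e n).
Proof.
have mono a b : (forall i, (i < n)%N -> `|a i| <= `|b i|) ->
    unconditional_norm e n a <= unconditional_norm e n b.
  move=> ab; apply: unconditional_norm_le => g g1.
  pose g' i := if (i < n)%N then g i * (a i / b i) else 0.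
  have -> : \sum_(i < n) (g i * a i) *: e i = \sum_(i < n) (g' i * b i) *: e i.
    apply: eq_bigr => i _; congr (_ *: _); rewrite /g' ltn_ord -mulrA; congr (_ * _).
    have [b0|b0] := eqVneq (b i) 0; last by rewrite divfK.
    by have := ab i (ltn_ord i); rewrite b0 normr0 normr_le0 => /eqP ->; rewrite mulr0.
  apply: unconditional_norm_ge => i; rewrite /g'; case: ifPn => ni; last by rewrite normr0.
  rewrite normrM mulr_ile1// normrM normfV.
  have [b0|b0] := eqVneq (b i) 0; first by rewrite b0 normr0 invr0 mulr0.
  by rewrite ler_pdivrMr ?normr_gt0// mul1r ab.
have ge0 a : 0 <= unconditional_norm e n a.
  exact: le_trans (norm_le_unconditional_norm n a).
have homo k a : unconditional_norm e n (fun i => k * a i) <= `|k| * unconditional_norm e n a.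
  apply: unconditional_norm_le => b b1.
  apply: le_trans (ler_wpM2l (normr_ge0 k) (unconditional_norm_ge n a b1)).
  rewrite -normrZ scaler_sumr le_eqVlt; apply/orP; left; apply/eqP; congr `|_|.
  by apply: eq_bigr => i _; rewrite scalerA mulrCA.
split=> //.
- move=> a b; apply: unconditional_norm_le => g g1.
  apply: le_trans (lerD (unconditional_norm_ge n a g1) (unconditional_norm_ge n b g1)).
  rewrite (le_trans _ (ler_normD _ _))// -big_split/= le_eqVlt; apply/orP; left; apply/eqP.
  by congr `|_|; apply: eq_bigr => i _; rewrite mulrDr scalerDl.
- move=> k a; apply/eqP; rewrite eq_le homo/=.
  have [->|k0] := eqVneq k 0; first by rewrite normr0 mul0r.
  rewrite -ler_pdivlMl ?normr_gt0// -normfV; apply: le_trans (homo _ _).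
  by apply: mono => i _; rewrite mulKf.
- move=> a a0 i ni; have := @unconditional_norm_ge n a (fun k => (k == i)%:R).
  rewrite a0 (bigD1 (Ordinal ni))//= eqxx mul1r big1 ?addr0 => [h|k].
    have {h} : `|a i *: e i| <= 0 by apply: h => k; rewrite normr_nat; case: eqP.
    by rewrite normr_le0 scaler_eq0 (negbTE (e_neq0 i)) orbF => /eqP.
  by rewrite -val_eqE/= => /negbTE ->; rewrite mul0r scale0r.
Qed.

End unconditional_norm.

Section linfty_of_disjoint.
Context {R : realType} (X : normedModType R).

Lemma rV_norm_le n (w : 'rV[R]_n) (M : R) : 0 <= M ->
  (forall j, `|w ord0 j| <= M) -> `|w| <= M.
Proof.
move=> M0 wM; rewrite /Num.Def.normr/= mx_normrE; apply: bigmax_le => // -[i j] _ /=.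
by rewrite (ord1 i).
Qed.

Lemma le_rV_norm n (w : 'rV[R]_n) j : `|w ord0 j| <= `|w|.
Proof.
rewrite [leRHS]/Num.Def.normr/= mx_normrE.
exact: (le_bigmax _ (fun ij => `|w ij.1 ij.2|) (ord0, j)).
Qed.

Lemma banach_mazur_linfty_le (d : nat) (x : 'I_d -> X) (r K : R) : 0 < r -> 0 <= K ->
  (forall t : 'I_d -> R, forall j, `|t j| * r <= K * `|\sum_j t j *: x j|) ->
  (forall t : 'I_d -> R, (forall j, `|t j| <= 1) -> `|\sum_j t j *: x j| <= 2 * r) ->
  exists E : set X, has_dimension d E /\
    (banach_mazur_dist E [set: 'rV[R]_d] <= (2 * K)%:E)%E.
Proof.
move=> r0 K0 low up.
have free (t : 'I_d -> R) : \sum_j t j *: x j = 0 -> forall j, t j = 0.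
  move=> t0 j; have := low t j; rewrite t0 normr0 mulr0 pmulr_lle0// normr_le0.
  by move/eqP.
pose E := [set \sum_j t j *: x j | t in [set: 'I_d -> R]].
exists E; split; first by exists x; split.
have inj (t s : 'I_d -> R) : \sum_j t j *: x j = \sum_j s j *: x j -> t = s.
  move=> ts; apply/funext => j; apply/eqP; rewrite -subr_eq0; apply/eqP.
  apply: (free (fun j => t j - s j)); under eq_bigr do rewrite scalerBl.
  by rewrite sumrB ts subrr.
have coord z : exists t : 'I_d -> R, E z -> z = \sum_j t j *: x j.
  have [[t _ <-]|nz] := pselect (E z); first by exists t.
  by exists (fun=> 0).
have [g gP] := choice coord.
pose T z : 'rV[R]_d := \row_j g z j.
pose T' (w : 'rV[R]_d) : X := \sum_j w ord0 j *: x j.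
have ET' w : E (T' w) by exists (fun j => w ord0 j).
have TK z : E z -> T' (T z) = z.
  by move=> Ez; rewrite [RHS](gP z Ez); apply: eq_bigr => j _; rewrite mxE.
have T'K w : T (T' w) = w.
  apply/rowP => j; rewrite mxE; have /inj := gP (T' w) (ET' w).
  by move=> /(congr1 (@^~ j)).
apply: le_trans (_ : (opnorm_on E T * opnorm_on setT T' <= _)%E).
  apply: ereal_inf_lbound; exists T, T'; split=> //; split=> //.
  - move=> k y z Ey Ez; apply: (can_inj T'K) => /=.
    have Ekyz : E (k *: y + z).
      rewrite (gP y Ey) (gP z Ez) scaler_sumr -big_split/=.
      exists (fun j => k * g y j + g z j) => //.
      by apply: eq_bigr => j _; rewrite scalerDl scalerA.
    rewrite TK// -[in LHS](TK _ Ey) -[in LHS](TK _ Ez) /T' scaler_sumr -big_split/=.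
    by apply: eq_bigr => j _; rewrite !mxE scalerDl scalerA.
  - by move=> z; rewrite inE; exact: TK.
have h1 : (opnorm_on E T <= (K / r)%:E)%E.
  apply: ge_ereal_sup => _ [z [Ez z1] <-]; rewrite lee_fin.
  apply: rV_norm_le => [|j]; first by rewrite divr_ge0// ltW.
  rewrite mxE ler_pdivlMr//; apply: le_trans (low _ _) _; rewrite -(gP z Ez).
  by rewrite ler_piMr.
have h2 : (opnorm_on setT T' <= (2 * r)%:E)%E.
  apply: ge_ereal_sup => _ [w [_ w1] <-]; rewrite lee_fin; apply: up => j.
  exact: le_trans (le_rV_norm w j) w1.
have -> : 2 * K = K / r * (2 * r) by field; rewrite gt_eqF.
rewrite EFinM; apply: lee_pmul => //.
  apply: (@le_trans _ _ `|T 0|%:E); first by rewrite lee_fin.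
  apply: ereal_sup_ubound; exists 0 => //; split; last by rewrite normr0.
  by exists (fun=> 0) => //; rewrite big1// => j _; rewrite scale0r.
apply: (@le_trans _ _ `|T' 0|%:E); first by rewrite lee_fin.
by apply: ereal_sup_ubound; exists 0 => //; split; rewrite ?normr0.
Qed.

End linfty_of_disjoint.

(** If no [d] works, each [d] yields disjoint pieces of norm at least [r] whose vector [u] has norm
    below [2 * r]. Monotonicity gives both estimates against the sup norm of the coefficients, and
    the distance bound [2 * K] is free of [d] and [r]. *)
Lemma doubles_disjoint_or_linfty (R : realType) (X : normedModType R) (e : nat -> X)
    (K : R) : (forall i, e i != 0) -> 0 <= K ->
  (forall n a, unconditional_norm e n a <= K * `|\sum_(i < n) a i *: e i|) ->
  ~ contains_linfty_uniformly X ->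
  exists d, forall n, doubles_disjoint d (unconditional_norm e n).
Proof.
move=> e0 K0 NK; apply: contra_notP => /forallNP H; exists (2 * K) => d.
have /existsNP[n /existsNP[A /existsNP[u /existsNP[r]]]] := H d.
move=> /not_implyP[dA /not_implyP[rA /negP]]; rewrite -ltNge => ur.
set N := unconditional_norm e n in rA ur.
have latN : lattice_norm n N by exact: unconditional_norm_lattice.
have r0 : 0 < r by have := latnorm_ge0 latN u; lra.
pose at_ (t : 'I_d -> R) i := \sum_j t j * ((A j i)%:R * u i).
pose x j := \sum_(i < n) ((A j i)%:R * u i) *: e i.
have xE t : \sum_j t j *: x j = \sum_(i < n) at_ t i *: e i.
  rewrite /x; under eq_bigr do rewrite scaler_sumr.
  rewrite exchange_big/=; apply: eq_bigr => i _; rewrite scaler_suml.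
  by apply: eq_bigr => j _; rewrite scalerA.
have atA t i j : A j i -> at_ t i = t j * u i.
  move=> Aji; rewrite /at_ (bigD1 j)//= Aji mul1r big1 ?addr0// => k kj.
  case: (boolP (A k i)) => Aki; last by rewrite mul0r mulr0.
  by rewrite (dA i k j Aki Aji) eqxx in kj.
have atN t i : (forall j, ~~ A j i) -> at_ t i = 0.
  by move=> nA; rewrite /at_ big1// => j _; rewrite (negbTE (nA j)) mul0r mulr0.
apply: (@banach_mazur_linfty_le _ X d x r K) => // [t j|t t1].
  rewrite xE; apply: le_trans (NK _ _); rewrite -/N.
  apply: le_trans (ler_wpM2l (normr_ge0 _) (rA j)) _; rewrite -(latnormZ latN).
  apply: (latnorm_le latN) => i _; case: (boolP (A j i)) => Aji.
    by rewrite (atA t i j)// mul1r.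
  by rewrite mul0r mulr0 normr0.
rewrite xE; apply: le_trans (norm_le_unconditional_norm _ _ _) _.
apply: le_trans (ltW ur); apply: (latnorm_le latN) => i _.
have [[j Aji]|/forallNP nA] := pselect (exists j, A j i).
  by rewrite (atA t i j)// normrM ler_piMl.
by rewrite atN ?normr0// => j; apply/negP.
Qed.

(** * Uniform homeomorphisms from dense correspondences *)

Section spheres.
Context {R : realType}.

(** A predicate on normed spaces, so that [X] and [ell1 R], which carries only a normed structure
    here, can be treated alike. *)
Definition cauchy_complete (V : normedModType R) : Prop :=
  forall s : nat -> V,
    (forall e : R, 0 < e -> exists J0, forall J, (J0 <= J)%N -> `|s J - s J0| < e) ->
  cvgn s.

Definition normalize (V : normedModType R) (u : V) : V := `|u|^-1 *: u.

Lemma norm_normalize (V : normedModType R) (u : V) : u != 0 -> `|normalize u| = 1.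
Proof. by move=> u0; rewrite normrZ normfV normr_id mulVf ?normr_eq0. Qed.

Lemma normalize_id (V : normedModType R) (u : V) : `|u| = 1 -> normalize u = u.
Proof. by move=> u1; rewrite /normalize u1 invr1 scale1r. Qed.

Lemma normalize_dist (V : normedModType R) (u v : V) : u != 0 -> v != 0 ->
  `|normalize u - normalize v| <= 2 * `|u - v| / `|u|.
Proof.
move=> u0 v0; have nu : 0 < `|u| by rewrite normr_gt0.
have nv : 0 < `|v| by rewrite normr_gt0.
rewrite ler_pdivlMr// -[X in _ * X](@ger0_norm _ `|u|)// mulrC -normrZ.
have -> : `|u| *: (normalize u - normalize v) = (u - v) - (`|u| - `|v|) *: normalize v.
  have e (w : V) : w != 0 -> `|w| *: normalize w = w.
    by move=> w0; rewrite /normalize scalerA divff ?normr_eq0// scale1r.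
  by rewrite scalerBr scalerBl !e// opprB addrA subrK.
rewrite (le_trans (ler_normB _ _))// mulr_natl mulr2n lerD2l normrZ.
by rewrite norm_normalize// mulr1 ler_dist_dist.
Qed.

Section closure_graph.
Variables (X Y : normedModType R) (G : X -> Y -> Prop).

(** A modulus of continuity for a relation. Taken at [x = x'], it already forces [y] to be
    determined by [x]. *)
Definition unif_graph : Prop := forall ep : R, 0 < ep -> exists2 d : R, 0 < d &
  forall x y x' y', G x y -> G x' y' -> `|x - x'| < d -> `|y - y'| < ep.

Definition closure_graph x y : Prop := forall ep : R, 0 < ep ->
  exists x' y', [/\ G x' y', `|x - x'| < ep & `|y - y'| < ep].

Lemma dist3 (V : normedModType R) (x y x' y' : V) :
  `|x - y| <= `|x - x'| + `|x' - y'| + `|y - y'|.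
Proof.
have -> : x - y = (x - x') + (x' - y') + (y' - y) by rewrite !subrKA.
rewrite (le_trans (ler_normD _ _))// [`|y' - y|]distrC lerD2r.
exact: ler_normD.
Qed.

Lemma unif_closure_graph : unif_graph -> forall ep : R, 0 < ep -> exists2 d : R, 0 < d &
  forall x y x' y', closure_graph x y -> closure_graph x' y' ->
  `|x - x'| < d -> `|y - y'| < ep.
Proof.
move=> GU ep ep0; have ep3 : 0 < ep / 3 by rewrite divr_gt0.
have [d d0 hd] := GU _ ep3; have d3 : 0 < d / 3 by rewrite divr_gt0.
exists (d / 3) => // x y x' y' xy xy' xx'.
have m0 : 0 < Num.min (d / 3) (ep / 3) by rewrite lt_min d3.
have [x1 [y1 [G1]]] := xy _ m0; rewrite !lt_min => /andP[xx1 _] /andP[_ yy1].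
have [x2 [y2 [G2]]] := xy' _ m0; rewrite !lt_min => /andP[xx2 _] /andP[_ yy2].
have h : `|y1 - y2| < ep / 3.
  apply: (hd _ _ _ _ G1 G2); have := dist3 x1 x2 x x'.
  by rewrite [`|x1 - x|]distrC [`|x2 - x'|]distrC; lra.
have := dist3 y y' y1 y2; lra.
Qed.

Lemma closure_graph_total : cauchy_complete Y -> unif_graph ->
  (forall x y, G x y -> `|y| = 1) ->
  (forall x, `|x| = 1 -> forall ep : R, 0 < ep -> exists x' y', G x' y' /\ `|x - x'| < ep) ->
  forall x, `|x| = 1 -> exists y, `|y| = 1 /\ closure_graph x y.
Proof.
move=> cY GU G1 GD x x1.
have H n : exists p : X * Y, G p.1 p.2 /\ `|x - p.1| < 2^-1 ^+ n.
  have [|x' [y' xy]] := GD x x1 (2^-1 ^+ n); first by rewrite exprn_gt0// invr_gt0.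
  by exists (x', y').
have [p pP] := choice H.
have px (ep : R) : 0 < ep -> exists n0, forall n, (n0 <= n)%N -> `|x - (p n).1| < ep.
  move=> ep0; have /cvgrPdist_lt/(_ _ ep0)[n0 _ hn0] := @cvg_half_pow R.
  exists n0 => n /hn0; rewrite /= sub0r normrN ger0_norm ?exprn_ge0//.
  by apply: lt_trans; case: (pP n).
have /cY py : forall ep : R, 0 < ep -> exists J0, forall J, (J0 <= J)%N ->
    `|(p J).2 - (p J0).2| < ep.
  move=> ep ep0; have [d d0 hd] := GU _ ep0.
  have d2 : 0 < d / 2 by rewrite divr_gt0.
  have [n0 hn0] := px _ d2; exists n0 => J n0J.
  apply: (hd _ _ _ _ (pP J).1 (pP n0).1); have := hn0 J n0J; have := hn0 n0 (leqnn _).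
  have := dist3 (p J).1 (p n0).1 x x; rewrite subrr normr0.
  by rewrite [`|_ - x|]distrC [`|(p n0).1 - x|]distrC; lra.
pose y := limn (fun n => (p n).2); exists y; split.
  have cy : (fun n => `|(p n).2|) @ \oo --> `|y| by apply: cvg_norm.
  have c1 : (fun n => `|(p n).2|) @ \oo --> (1 : R).
    by under eq_fun do rewrite (G1 _ _ (pP _).1); exact: cvg_cst.
  exact: (cvg_unique (@norm_hausdorff _ _) cy c1).
move=> ep ep0; have [n1 hn1] := px _ ep0.
have /cvgrPdist_lt/(_ _ ep0)[n2 _ hn2] := py.
exists (p (maxn n1 n2)).1, (p (maxn n1 n2)).2; split; first by case: (pP (maxn n1 n2)).
  by apply: hn1; exact: leq_maxl.
by apply: hn2; exact: leq_maxr.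
Qed.

End closure_graph.

(** Both maps are chosen inside the same closed relation. Completeness and density make it total on
    either side, and the two moduli make it single-valued, so the choices are inverse to each other
    and uniformly continuous. *)
Lemma dense_correspondence (X Y : normedModType R) (G : X -> Y -> Prop) :
  cauchy_complete X -> cauchy_complete Y ->
  (forall x y, G x y -> `|x| = 1 /\ `|y| = 1) ->
  unif_graph G -> unif_graph (fun y x => G x y) ->
  (forall x, `|x| = 1 -> forall ep : R, 0 < ep -> exists x' y', G x' y' /\ `|x - x'| < ep) ->
  (forall y, `|y| = 1 -> forall ep : R, 0 < ep -> exists x' y', G x' y' /\ `|y - y'| < ep) ->
  uniformly_homeomorphic (unit_sphere X) (unit_sphere Y).
Proof.
move=> cX cY G1 GU GU' GD GD'.
have flip x y : closure_graph (fun y x => G x y) y x -> closure_graph G x y.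
  by move=> h ep /h[y' [x' [? ? ?]]]; exists x', y'.
have flip' x y : closure_graph G x y -> closure_graph (fun y x => G x y) y x.
  by move=> h ep /h[y' [x' [? ? ?]]]; exists x', y'.
have F (x : unit_sphere X) : exists y : unit_sphere Y, closure_graph G (set_val x) (set_val y).
  have [|y [y1 xy]] := closure_graph_total cY GU (fun x y h => (G1 x y h).2) GD (x := set_val x).
    exact: set_valP x.
  by exists (SigSub (mem_set y1 : y \in unit_sphere Y)).
have F' (y : unit_sphere Y) : exists x : unit_sphere X, closure_graph G (set_val x) (set_val y).
  have GD2 : forall y, `|y| = 1 -> forall ep : R, 0 < ep -> exists y' x', G x' y' /\ `|y - y'| < ep.
    by move=> y' y1 ep /(GD' y' y1)[a [b ?]]; exists b, a.
  have [|x [x1 xy]] := closure_graph_total cX GU' (fun y x h => (G1 x y h).1) GD2 (x := set_val y).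
    exact: set_valP y.
  by exists (SigSub (mem_set x1 : x \in unit_sphere X)); exact: flip.
have [f fP] := choice F; have [g gP] := choice F'.
have U := unif_closure_graph GU; have U' := unif_closure_graph GU'.
have small (V : normedModType R) (u v : V) : (forall ep : R, 0 < ep -> `|u - v| < ep) -> u = v.
  move=> h; apply/eqP; rewrite -subr_eq0 -normr_le0; apply/ler_addgt0Pl => ep ep0.
  by rewrite addr0 ltW// h.
exists f, g; split.
- move=> x; apply: val_inj; apply: small => ep /U'[d d0 hd].
  apply: (hd _ _ _ _ (flip' _ _ (gP (f x))) (flip' _ _ (fP x))).
  by rewrite subrr normr0.
- move=> y; apply: val_inj; apply: small => ep /U[d d0 hd].
  apply: (hd _ _ _ _ (fP (g y)) (gP y)).
  by rewrite subrr normr0.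
- apply/unif_continuous_sphereP => ep /U[d d0 hd]; exists d => // x y.
  exact: hd.
- apply/unif_continuous_sphereP => ep /U'[d d0 hd]; exists d => // x y.
  by apply: hd; exact: flip'.
Qed.

End spheres.

Section ell1_theory.
Context {R : realType}.
Implicit Types (h : ell1 R) (a : nat -> R).

Lemma ell1_norm_ge h n : \sum_(k < n) `|h k| <= `|h|.
Proof.
rewrite ell1_normE -(big_mkord xpredT (fun k => `|h k|)).
apply: (@nondecreasing_cvgn_le _ (series (fun k => `|h k|))); last exact: ell1_cvg.
by apply: nondecreasing_series => k _; rewrite normr_ge0.
Qed.

Lemma ell1_norm_le h (M : R) : (forall n, \sum_(k < n) `|h k| <= M) -> `|h| <= M.
Proof.
move=> hM; rewrite ell1_normE; apply: limr_le; first exact: ell1_cvg.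
by apply: nearW => n; rewrite /series/= big_mkord.
Qed.

Lemma ell1_of_bounded a (M : R) : (forall n, \sum_(k < n) `|a k| <= M) ->
  a \in ell1_pred.
Proof.
move=> aM; rewrite inE/=; apply: nondecreasing_is_cvgn.
  by apply: nondecreasing_series => k _; rewrite normr_ge0.
by exists M => _ [n _ <-]; rewrite /series/= big_mkord.
Qed.

Lemma finite_ell1_subproof n a : (fun i => (i < n)%N%:R * a i) \in @ell1_pred R.
Proof.
apply: (@ell1_of_bounded _ (\sum_(k < n) `|a k|)) => m.
apply: le_trans (_ : \sum_(k < m + n) `|(k < n)%N%:R * a k| <= _).
  by rewrite big_split_ord/= lerDl sumr_ge0.
rewrite addnC big_split_ord/= [X in _ + X]big1 ?addr0 => [|k _].
  by apply: ler_sum => k _; rewrite ltn_ord mul1r.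
by rewrite ltnNge leq_addr mul0r normr0.
Qed.

Definition finite_ell1 n a : ell1 R := Ell1 (finite_ell1_subproof n a).

Lemma norm_finite_ell1 n a : `|finite_ell1 n a| = \sum_(k < n) `|a k|.
Proof.
apply/eqP; rewrite eq_le; apply/andP; split.
  apply: ell1_norm_le => m /=.
  apply: le_trans (_ : \sum_(k < m + n) `|(k < n)%N%:R * a k| <= _).
    by rewrite big_split_ord/= lerDl sumr_ge0.
  rewrite addnC big_split_ord/= [X in _ + X]big1 ?addr0 => [|k _].
    by apply: ler_sum => k _; rewrite ltn_ord mul1r.
  by rewrite ltnNge leq_addr mul0r normr0.
apply: le_trans (ell1_norm_ge (finite_ell1 n a) n).
by apply: ler_sum => k _ /=; rewrite ltn_ord mul1r.
Qed.

Lemma ell1_finite_dense h (ep : R) : 0 < ep -> exists n, `|h - finite_ell1 n h| < ep.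
Proof.
move=> ep0; have ep2 : 0 < ep / 2 by rewrite divr_gt0.
have /cvgrPdist_lt/(_ _ ep2)[n _ /(_ n (leqnn n))] := @ell1_cvg R h.
rewrite /= -ell1_normE /series/= big_mkord => hn; exists n.
apply: le_lt_trans (_ : `|h| - \sum_(k < n) `|h k| < _); last first.
  by apply: le_lt_trans (ler_norm _) _; lra.
apply: ell1_norm_le => m; rewrite lerBrDr.
apply: le_trans (ell1_norm_ge h (n + m)).
apply: le_trans (_ : \sum_(k < n + m) `|(h - finite_ell1 n h) k| + \sum_(k < n) `|h k| <= _).
  by rewrite lerD2r addnC big_split_ord/= lerDl sumr_ge0.
have -> : \sum_(k < n + m) `|(h - finite_ell1 n h) k| =
    \sum_(k < n + m) `|h k - (k < n)%N%:R * h k| by [].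
rewrite !big_split_ord/= big1 => [|k _]; last by rewrite ltn_ord mul1r subrr normr0.
rewrite add0r [leLHS]addrC lerD2l; apply: ler_sum => k _.
by rewrite ltnNge leq_addr mul0r subr0.
Qed.

Lemma ell1_complete : cauchy_complete (ell1 R).
Proof.
move=> s sC.
have coord (h : ell1 R) k : `|h k| <= `|h|.
  apply: le_trans (ell1_norm_ge h k.+1); rewrite big_ord_recr/= lerDr.
  by rewrite sumr_ge0.
have ck k : cvgn (fun J => s J k : R).
  apply: cvgn_of_cauchy => ep /sC[J0 hJ0]; exists J0 => J /hJ0; apply: le_lt_trans.
  exact: (coord (s J - s J0)).
pose a k := limn (fun J => s J k : R).
have near_lim J0 (ep : R) : (forall J, (J0 <= J)%N -> `|s J - s J0| < ep) ->
    forall n, \sum_(k < n) `|a k - s J0 k| <= ep.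
  move=> h n; rewrite -[leLHS]ger0_norm ?sumr_ge0//.
  apply: (@cvgn_norm_le _ _ (fun J => \sum_(k < n) `|s (J + J0)%N k - s J0 k|)).
    apply: cvg_big => [|k _]; first exact: add_continuous.
    apply: cvg_norm; apply: cvgB; last exact: cvg_cst.
    by rewrite (cvg_shiftn J0 (fun J => s J k : R)); exact: ck.
  move=> J; rewrite ger0_norm ?sumr_ge0//; apply: le_trans (ltW (h (J + J0)%N (leq_addl _ _))).
  exact: (ell1_norm_ge (s (J + J0)%N - s J0)).
have [J1 hJ1] := sC 1 ltr01.
have aM : a \in @ell1_pred R.
  apply: (@ell1_of_bounded _ (1 + `|s J1|)) => n.
  apply: le_trans (lerD (near_lim _ _ hJ1 n) (ell1_norm_ge (s J1) n)).
  by rewrite -big_split/=; apply: ler_sum => k _; rewrite -[a k in leLHS](subrK ((s J1) k)) ler_normD.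
apply/cvg_ex; exists (Ell1 aM); apply/cvgrPdist_le => ep ep0.
have ep2 : 0 < ep / 2 by rewrite divr_gt0.
have [J0 hJ0] := sC _ ep2; exists J0 => // J /= J0J.
have h1 : `|Ell1 aM - s J0| <= ep / 2.
  by apply: ell1_norm_le => n; exact: near_lim.
have := hJ0 J J0J; have := dist3 (Ell1 aM) (s J) (s J0) (s J0).
by rewrite subrr normr0; lra.
Qed.

End ell1_theory.

(** * The homeomorphism with the sphere of [ell_1] *)

Section lozanovskii_sphere.
Context {R : realType} (X : completeNormedModType R) (e : nat -> X).
Variables (Q : nat) (N : nat -> (nat -> R) -> R) (B : R).
Hypothesis Q0 : (0 < Q)%N.
Hypothesis Qeven : ~~ odd Q.
Hypothesis B0 : 0 < B.
Hypothesis latN : forall n, lattice_norm n (N n).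
Hypothesis concN : forall n, power_concave n Q (N n).
Hypothesis N_ge : forall n (a : nat -> R), `|\sum_(i < n) a i *: e i| <= N n a.
Hypothesis N_le : forall n (a : nat -> R), N n a <= B * `|\sum_(i < n) a i *: e i|.
Hypothesis N_widen : forall n m a, (n <= m)%N -> (forall i, (n <= i)%N -> a i = 0) ->
  N n a = N m a.
Hypothesis dense_span : forall (x : X) (ep : R), 0 < ep ->
  exists n (a : nat -> R), `|x - \sum_(i < n) a i *: e i| < ep.

Let supp n (a : nat -> R) := forall i, (n <= i)%N -> a i = 0.

Let emb n (a : nat -> R) : X := \sum_(i < n) a i *: e i.

Let sum_widen (V : zmodType) n m (f : nat -> V) : (n <= m)%N ->
  (forall i, (n <= i)%N -> f i = 0) -> \sum_(i < m) f i = \sum_(i < n) f i.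
Proof.
move=> nm f0; rewrite -(subnKC nm) big_split_ord/= [X in _ + X]big1 ?addr0// => i _.
by rewrite f0 ?leq_addr.
Qed.

Let pair_widen n m a g : (n <= m)%N -> supp n a -> supp n g ->
  lozanovskii_pair n (N n) a g -> lozanovskii_pair m (N m) a g.
Proof.
move=> nm sa sg [Na g1 gs gN]; split.
- by rewrite -(N_widen nm).
- by rewrite (sum_widen nm (f := fun i => `|g i|))// => i /sg ->; rewrite normr0.
- move=> i _; have [ni|ni] := ltnP i n; first exact: gs.
  by rewrite sg// normr0 mulr0.
- move=> y; rewrite (sum_widen nm (f := fun i => `|g i| * y i)).
    by rewrite -(N_widen nm)// => i /sa ->; rewrite mulr0.
  by move=> i /sg ->; rewrite normr0 mul0r.
Qed.

Let emb_widen n m a : (n <= m)%N -> supp n a -> emb n a = emb m a.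
Proof.
by move=> nm sa; rewrite /emb (sum_widen nm (f := fun i => a i *: e i))// => i /sa ->; rewrite scale0r.
Qed.

Let ell1_widen n m g : (n <= m)%N -> supp n g -> finite_ell1 n g = finite_ell1 m g.
Proof.
move=> nm sg; apply/val_inj/funext => i /=; have [ni|ni] := ltnP i n.
  by rewrite (leq_trans ni nm).
by rewrite sg// !mulr0.
Qed.

(** Pairs live on the sphere of [N n]; [normalize] projects radially to the sphere of the given norm
    of [X]. *)
Definition lozanovskii_graph (x : X) (h : ell1 R) : Prop := exists n a g,
  [/\ supp n a, supp n g, lozanovskii_pair n (N n) a g,
      x = normalize (emb n a) & h = finite_ell1 n g].

Let graph2 x h x' h' : lozanovskii_graph x h -> lozanovskii_graph x' h' ->
  exists n a g a' g', [/\ lozanovskii_pair n (N n) a g, lozanovskii_pair n (N n) a' g',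
    x = normalize (emb n a) /\ x' = normalize (emb n a') &
    h = finite_ell1 n g /\ h' = finite_ell1 n g'].
Proof.
move=> [n [a [g [sa sg ag -> ->]]]] [n' [a' [g' [sa' sg' ag' -> ->]]]].
have nm := leq_maxl n n'; have nm' := leq_maxr n n'.
exists (maxn n n'), a, g, a', g'; split.
- exact: pair_widen ag.
- exact: pair_widen ag'.
- by rewrite -(emb_widen nm)// -(emb_widen nm').
- by rewrite -(ell1_widen nm)// -(ell1_widen nm').
Qed.

Let embN n a : N n a = 1 -> 1 <= B * `|emb n a|.
Proof. by move=> <-; exact: N_le. Qed.

Let emb_neq0 n a : N n a = 1 -> emb n a != 0.
Proof. by move/embN; apply: contraTneq => ->; rewrite normr0 mulr0 ler10. Qed.

Let dist_ell1 n (g g' : nat -> R) : `|finite_ell1 n g - finite_ell1 n g'| = \sum_(i < n) `|g i - g' i|.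
Proof.
rewrite -(norm_finite_ell1 n (fun i => g i - g' i)); congr `|_|.
by apply/val_inj/funext => i /=; rewrite mulrBr.
Qed.

Let embB n (a a' : nat -> R) : emb n (fun i => a i - a' i) = emb n a - emb n a'.
Proof. by rewrite /emb -sumrB; apply: eq_bigr => i _; rewrite scalerBl. Qed.

Let embZ n k (a : nat -> R) : emb n (fun i => k * a i) = k *: emb n a.
Proof. by rewrite /emb scaler_sumr; apply: eq_bigr => i _; rewrite scalerA. Qed.

(** The inverse of the radial projection is Lipschitz: [a - a'] splits into [l] times the difference
    of the projections and a multiple of [a'], each of norm at most [l * D] with [l <= 1]. *)
Let dist_pull n (a a' : nat -> R) : N n a = 1 -> N n a' = 1 ->
  N n (fun i => a i - a' i) <= 2 * B * `|normalize (emb n a) - normalize (emb n a')|.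
Proof.
move=> a1 a1'; have ea := emb_neq0 a1; have ea' := emb_neq0 a1'.
set l := `|emb n a|; set l' := `|emb n a'|.
have l0 : 0 < l by rewrite normr_gt0.
have l0' : 0 < l' by rewrite normr_gt0.
have l1 : l <= 1 by rewrite -a1; exact: N_ge.
pose D := N n (fun i => l^-1 * a i - l'^-1 * a' i).
have DB : D <= B * `|normalize (emb n a) - normalize (emb n a')|.
  have -> : normalize (emb n a) - normalize (emb n a') =
      emb n (fun i => l^-1 * a i - l'^-1 * a' i).
    by rewrite (embB n (fun i => l^-1 * a i) (fun i => l'^-1 * a' i)) !embZ.
  exact: N_le.
have Nl : N n (fun i => l^-1 * a i) = l^-1.
  by rewrite (latnormZ (latN n)) a1 mulr1 gtr0_norm ?invr_gt0.
have Nl' : N n (fun i => l'^-1 * a' i) = l'^-1.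
  by rewrite (latnormZ (latN n)) a1' mulr1 gtr0_norm ?invr_gt0.
have tri1 : l^-1 - l'^-1 <= D.
  rewrite lerBlDr -Nl -Nl'; apply: le_trans (latnormD (latN n) _ _).
  by rewrite le_eqVlt; apply/orP; left; apply/eqP; congr (N n); apply/funext => i; rewrite subrK.
have tri2 : l'^-1 - l^-1 <= D.
  have -> : D = N n (fun i => l'^-1 * a' i - l^-1 * a i).
    by rewrite -(latnormN (latN n)) /D; congr (N n); apply/funext => i; rewrite opprB.
  rewrite lerBlDr -[leLHS]Nl' -[X in _ + X]Nl; apply: le_trans (latnormD (latN n) _ _).
  by rewrite le_eqVlt; apply/orP; left; apply/eqP; congr (N n); apply/funext => i; rewrite subrK.
have D0 : 0 <= D by exact: latnorm_ge0 (latN n) _.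
suff h : N n (fun i => a i - a' i) <= 2 * l * D.
  apply: le_trans h _; apply: le_trans (_ : 2 * 1 * D <= _); last by lra.
  by rewrite ler_wpM2r// ler_wpM2l.
have -> : (fun i => a i - a' i) =
    (fun i => l * (l^-1 * a i - l'^-1 * a' i) + (l / l' - 1) * a' i).
  by apply/funext => i; field; rewrite !gt_eqF.
apply: le_trans (latnormD (latN n) _ _) _; rewrite !(latnormZ (latN n)) a1' mulr1 (gtr0_norm l0) -/D.
suff : `|l / l' - 1| <= l * D by lra.
have -> : l / l' - 1 = l * (l'^-1 - l^-1) by field; rewrite !gt_eqF.
rewrite normrM (gtr0_norm l0) ler_wpM2l ?(ltW l0)// ler_norml tri2 andbT; lra.
Qed.

Let dist_push n (a a' : nat -> R) : N n a = 1 -> N n a' = 1 ->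
  `|normalize (emb n a) - normalize (emb n a')| <= 2 * B * N n (fun i => a i - a' i).
Proof.
move=> a1 a1'; have ea := emb_neq0 a1; have ea' := emb_neq0 a1'.
apply: le_trans (normalize_dist ea ea') _.
have l0 : 0 < `|emb n a| by rewrite normr_gt0.
rewrite -embB ler_pdivrMr//.
apply: le_trans (_ : 2 * N n (fun i => a i - a' i) * 1 <= _).
  by rewrite mulr1 ler_wpM2l//; exact: N_ge.
have -> : 2 * B * N n (fun i => a i - a' i) * `|emb n a| =
  2 * N n (fun i => a i - a' i) * (B * `|emb n a|) by ring.
by rewrite ler_wpM2l ?mulr_ge0 ?(latnorm_ge0 (latN n))// embN.
Qed.

Let graph_unif : unif_graph lozanovskii_graph.
Proof.
move=> ep ep0; have [C C0 HC] := @lozanovskii_unif_left R Q Q0.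
pose t := Num.min 1 (ep / (2 * (C + 1))).
have C1 : 0 < 2 * (C + 1) by rewrite mulr_gt0// ltr_wpDl.
have t0 : 0 < t by rewrite lt_min ltr01 divr_gt0.
have t1 : t <= 1 by rewrite ge_min lexx.
have Ct : C * t <= ep / 2.
  have : t * (2 * (C + 1)) <= ep by rewrite -ler_pdivlMr// ge_min lexx orbT.
  by lra.
(* The factor 4 of the modulus and the [2 * B] of [dist_pull] turn this into less than [ep / 2]; the
   term [C * t] uses the other half. *)
exists (ep * t / (16 * B)); first by rewrite divr_gt0 ?mulr_gt0.
move=> x h x' h' xh xh'; have [n [a [g [a' [g' [ag ag' [-> ->] [-> ->]]]]]]] := graph2 xh xh'.
move=> d; rewrite dist_ell1.
have t01 : 0 < t <= 1 by rewrite t0.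
apply: le_lt_trans (HC _ _ _ _ _ _ (latN n) (@concN n) ag ag' _ t01) _.
case: ag ag' => a1 _ _ _ [a1' _ _ _]; have D := dist_pull a1 a1'.
rewrite ltr_pdivlMr ?mulr_gt0// in d.
have -> : ep = ep / 2 + (ep / 2 * t) / t by field; rewrite gt_eqF.
rewrite ler_ltD// ltr_pM2r ?invr_gt0//.
move: d D; set y := `|_ - _|; lra.
Qed.

Let graph_unif' : unif_graph (fun h x => lozanovskii_graph x h).
Proof.
move=> ep ep0; pose r := ep / (16 * B).
have r0 : 0 < r by rewrite divr_gt0// mulr_gt0.
pose d := Num.min 1 (r ^+ Q / Q%:R).
have Qr0 : 0 < Q%:R :> R by rewrite ltr0n.
have d0 : 0 < d by rewrite lt_min ltr01 divr_gt0// exprn_gt0.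
exists d => // h x h' x' xh xh'.
have [n [a [g [a' [g' [ag ag' [-> ->] [-> ->]]]]]]] := graph2 xh xh'.
rewrite dist_ell1 => /ltW hd.
have Qd : Q%:R * d <= r ^+ Q.
  by rewrite mulrC -ler_pdivlMr// ge_min lexx orbT.
have d1 : d <= 1 by rewrite ge_min lexx.
have := lozanovskii_unif_right Q0 Qeven (latN n) (@concN n) ag ag' hd d1 (ltW r0) Qd.
case: ag ag' => a1 _ _ _ [a1' _ _ _]; have D := dist_push a1 a1' => h4.
apply: le_lt_trans D _; apply: le_lt_trans (_ : 2 * B * (4 * r) < _).
  by rewrite ler_wpM2l// mulr_ge0// ltW.
have -> : 2 * B * (4 * r) = ep / 2 by rewrite /r; field; rewrite gt_eqF.
lra.
Qed.

Let dense_normalize (V : normedModType R) (x u : V) (ep : R) : `|x| = 1 ->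
  `|x - u| < Num.min 1 (ep / 2) -> u != 0 /\ `|x - normalize u| < ep.
Proof.
move=> x1; rewrite lt_min => /andP[xu1 xu].
have u0 : u != 0 by apply: contraTneq xu1 => ->; rewrite subr0 x1 ltxx.
split=> //; rewrite -{1}(normalize_id x1).
have x0 : x != 0 by rewrite -normr_gt0 x1.
by apply: le_lt_trans (normalize_dist x0 u0) _; rewrite x1 divr1; lra.
Qed.

Let graph_dense x : `|x| = 1 -> forall ep : R, 0 < ep ->
  exists x' h', lozanovskii_graph x' h' /\ `|x - x'| < ep.
Proof.
move=> x1 ep ep0; have m0 : 0 < Num.min 1 (ep / 2) by rewrite lt_min ltr01 divr_gt0.
have [n [a' xa']] := dense_span x m0.
pose a i := (i < n)%N%:R * a' i.
have ea : \sum_(i < n) a' i *: e i = emb n a.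
  by apply: eq_bigr => i _; rewrite /a ltn_ord mul1r.
rewrite ea in xa'; have [u0 xu] := dense_normalize x1 xa'.
have Na : 0 < N n a by apply: lt_le_trans (N_ge n a); rewrite normr_gt0.
pose b i := (N n a)^-1 * a i.
have Nb : N n b = 1.
  by rewrite (latnormZ (latN n)) gtr0_norm ?invr_gt0// mulVf// gt_eqF.
have [g bg sg] := lozanovskii_of_vector (latN n) Nb.
exists (normalize (emb n b)), (finite_ell1 n g); split.
  exists n, b, g; split => // i; rewrite leqNgt /b /a => /negbTE ->.
  by rewrite mul0r mulr0.
rewrite (_ : normalize (emb n b) = normalize (emb n a))//.
rewrite /normalize /b embZ normrZ scalerA normfV gtr0_norm//.
by rewrite invfM invrK mulrAC divff ?mul1r// gt_eqF.
Qed.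

Let graph_dense' (h : ell1 R) : `|h| = 1 -> forall ep : R, 0 < ep ->
  exists x' h', lozanovskii_graph x' h' /\ `|h - h'| < ep.
Proof.
move=> h1 ep ep0; have m0 : 0 < Num.min 1 (ep / 2) by rewrite lt_min ltr01 divr_gt0.
have [n hn] := ell1_finite_dense h m0.
have [u0 hu] := dense_normalize h1 hn.
set u := finite_ell1 n h in u0 hu.
have nu : 0 < `|u| by rewrite normr_gt0.
pose g i := (i < n)%N%:R * (`|u|^-1 * h i).
have g1 : \sum_(i < n) `|g i| = 1.
  under eq_bigr do rewrite /g ltn_ord mul1r normrM gtr0_norm ?invr_gt0//.
  by rewrite -mulr_sumr -norm_finite_ell1 mulVf// gt_eqF.
have [a ag sa] := lozanovskii_of_functional (latN n) g1.
exists (normalize (emb n a)), (finite_ell1 n g); split.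
  by exists n, a, g; split => // i; rewrite leqNgt /g => /negbTE ->; rewrite mul0r.
rewrite (_ : finite_ell1 n g = normalize u)//.
apply/val_inj/funext => i.
change ((i < n)%N%:R * g i = `|u|^-1 * ((i < n)%N%:R * h i)).
by rewrite /g; case: (i < n)%N; rewrite /= ?mul1r// !mul0r mulr0.
Qed.

Lemma sphere_homeomorphic_ell1 :
  uniformly_homeomorphic (unit_sphere X) (unit_sphere (ell1 R)).
Proof.
apply: (dense_correspondence (G := lozanovskii_graph)).
- exact: cvgn_of_cauchy.
- exact: ell1_complete.
- move=> x h [n [a [g [_ _ [a1 g1 _ _] -> ->]]]].
  by rewrite norm_normalize ?emb_neq0// norm_finite_ell1.
- exact: graph_unif.
- exact: graph_unif'.
- exact: graph_dense.
- exact: graph_dense'.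
Qed.

End lozanovskii_sphere.

Lemma schauder_coefficients (R : realType) (X : normedModType R) (e : nat -> X) :
  schauder_basis e -> exists c : X -> nat -> R,
    (forall x : X, series (fun k => c x k *: e k) @ \oo --> x) /\
    (forall (x : X) (a : nat -> R), series (fun k => a k *: e k) @ \oo --> x -> a = c x).
Proof.
move=> be; have H (x : X) : exists a : nat -> R, series (fun k => a k *: e k) @ \oo --> x /\
    forall b, series (fun k => b k *: e k) @ \oo --> x -> b = a.
  by have [a [ax au]] := be x; exists a; split => // b /au.
have [c cP] := choice H; exists c.
by split=> [x|x a]; case: (cP x) => // _; exact.
Qed.

Lemma sphere_homeomorphic_of_not_linfty (R : realType) (X : completeNormedModType R)
    (e : nat -> X) : unconditional_basis e -> ~ contains_linfty_uniformly X ->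
  uniformly_homeomorphic (unit_sphere X) (unit_sphere (ell1 R)).
Proof.
move=> [be ue] nl; have [c [c_cvg c_uniq]] := schauder_coefficients be.
have c_bnd x : exists M, forall n (b : nat -> R), (forall i, `|b i| <= 1) ->
    `|\sum_(i < n) (b i * c x i) *: e i| <= M.
  have [|M hM] := @unconditionally_cvg_bounded R X (fun k => c x k *: e k).
    by apply: ue; apply/cvg_ex; exists x; exact: c_cvg.
  exists M => n b b1; apply: le_trans (hM n b b1).
  by under eq_bigr do rewrite -scalerA.
have e0 i : e i != 0 by exact: basis_neq0 c_cvg c_uniq i.
have [K K0 hK] := basis_multiplier_bound c_cvg c_uniq c_bnd.
have NK n (a : nat -> R) : unconditional_norm e n a <= K * `|\sum_(i < n) a i *: e i|.
  by apply: unconditional_norm_le => // b b1; exact: hK.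
have [d hd] := doubles_disjoint_or_linfty e0 (ltW K0) NK nl.
(* The lower estimate has exponent [d.+1] and constant [2 * d ^ 2]; [K1] is what concavification
   makes of them. *)
pose Q := (2 * d.+1)%N.
pose K1 : R := 16 ^+ d.+1 * (2 * (2 ^+ d.+1 * (2 * d%:R ^+ 2))).
have K10 : 0 <= K1 by rewrite !mulr_ge0 ?exprn_ge0.
have lat0 n : lattice_norm n (unconditional_norm e n) by exact: unconditional_norm_lattice.
have bnd n m (f : 'I_m -> nat -> R) u : power_partition n Q f ->
    unconditional_norm e n u <= 1 -> power_sum Q (unconditional_norm e n) f u <= K1.
  move=> fP u1; apply: (lower_estimate_power_concave _ (lat0 n) _ fP u1) => //.
  exact: doubles_disjoint_lower_estimate (lat0 n) (hd n).
have Q0 : (0 < Q)%N by [].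
have [k k0 kQ] := exprn_root Q0 K10.
(* [k] compares the envelope with the unconditional norm and [K] compares the latter with the norm
   of [X]; [k + 1] stays positive even when [K1] is 0. *)
apply: (@sphere_homeomorphic_ell1 R X e Q (fun n => power_envelope n Q (unconditional_norm e n))
  ((k + 1) * K)) => //.
- by rewrite /Q mul2n odd_double.
- by rewrite mulr_gt0// ltr_wpDl.
- move=> n; exact: power_envelope_lattice Q0 (lat0 n) K10 (@bnd n).
- move=> n; exact: power_envelope_concave Q0 (lat0 n) K10 (@bnd n).
- move=> n a; apply: le_trans (norm_le_unconditional_norm e n a) _.
  exact: power_envelope_ge Q0 (lat0 n) K10 (@bnd n) a.
- move=> n a; rewrite -mulrA; apply: le_trans (_ : (k + 1) * unconditional_norm e n a <= _).
    apply: (power_envelope_le Q0 (lat0 n) K10 (@bnd n)); first lra.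
    by rewrite -kQ lerXn2r ?nnegrE//; lra.
  by rewrite ler_wpM2l//; lra.
- move=> n m a nm sa; apply: power_envelope_widen => // b sb.
  exact: unconditional_norm_widen.
- move=> x ep ep0; have /cvgrPdist_lt/(_ _ ep0)[n _ /(_ n (leqnn n))] := c_cvg x.
  by rewrite /= /series/= big_mkord => h; exists n, (c x).
Qed.

(** * Averages over a cube in a finite abelian group *)

Section cube_averages.
Context {R : realType} (V : finZmodType) (n : nat) (v : 'I_n -> V).
Implicit Types (g : V -> R) (E : {ffun 'I_n -> bool}) (x : V) (j : 'I_n).

Let sg (b : bool) : R := if b then 1 else -1.

Definition cube_vertex E : V := \sum_j (if E j then v j else - v j).

Let c : R := (2 ^+ n)^-1.

Let c_gt0 : 0 < c. Proof. by rewrite invr_gt0 exprn_gt0. Qed.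

Let card_cube : #|{ffun 'I_n -> bool}|%:R = c^-1 :> R.
Proof. by rewrite card_ffun card_bool card_ord natrX /c invrK. Qed.

Let sum_c : \sum_(E : {ffun 'I_n -> bool}) c = 1.
Proof. by rewrite sumr_const -mulr_natr card_cube mulfV// gt_eqF. Qed.

Let shift_sum (f : V -> R) y : \sum_x f (x + y) = \sum_x f x.
Proof. by rewrite [RHS](reindex_inj (addIr y)). Qed.

Let P g x : R := \sum_(E : {ffun 'I_n -> bool}) c * g (x + cube_vertex E).

(** The [j]-th Rademacher coefficient of [g] on the cube centred at [x]; [P] is the mean over that
    cube. *)
Let Q g j x : R := \sum_(E : {ffun 'I_n -> bool}) c * (sg (E j) * g (x + cube_vertex E)).

Let flip j E : {ffun 'I_n -> bool} := [ffun k => if k == j then ~~ E k else E k].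

Let flipK j : involutive (flip j).
Proof.
by move=> E; apply/ffunP => k; rewrite !ffunE; case: eqP => // _; rewrite negbK.
Qed.

Let vertex_flip j E : E j -> cube_vertex (flip j E) = cube_vertex E - v j - v j.
Proof.
move=> Ej; rewrite /cube_vertex (bigD1 j)//= [in RHS](bigD1 j)//= ffunE eqxx Ej/=.
rewrite addrAC [v j + _]addrC addrK addrC; congr (_ - _).
by apply: eq_bigr => k /negbTE kj; rewrite ffunE kj.
Qed.

(* Averaging over the cube turns a difference in direction [v j] into a Rademacher
   coefficient, and these are controlled by Bessel's inequality. *)
Let P_diff g j x : P g (x + v j) - P g (x - v j) = Q g j (x + v j) + Q g j (x - v j).
Proof.
suff h : P g (x + v j) - Q g j (x + v j) = P g (x - v j) + Q g j (x - v j) by lra.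
rewrite /P /Q -sumrB -big_split/= [LHS](reindex_inj (can_inj (flipK j))).
apply: eq_bigr => E _; rewrite ffunE eqxx; case: (boolP (E j)) => Ej /=; last by ring.
have -> : x + v j + cube_vertex (flip j E) = x - v j + cube_vertex E; last by ring.
by rewrite vertex_flip// [RHS]addrAC -!addrA; congr (_ + _); rewrite addrCA !addrA addrK.
Qed.

Let sum_sg i j : \sum_(E : {ffun 'I_n -> bool}) c * (sg (E i) * sg (E j)) = (i == j)%:R.
Proof.
have [->|ij] := eqVneq i j.
  rewrite -[RHS]sum_c; apply: eq_bigr => E _.
  by rewrite /sg; case: (E j); ring.
suff h : \sum_(E : {ffun 'I_n -> bool}) c * (sg (E i) * sg (E j)) =
    - \sum_(E : {ffun 'I_n -> bool}) c * (sg (E i) * sg (E j)) by rewrite /=; lra.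
rewrite [LHS](reindex_inj (can_inj (flipK i))) -sumrN; apply: eq_bigr => E _.
by rewrite !ffunE eqxx eq_sym (negbTE ij) /sg; case: (E i); case: (E j) => /=; ring.
Qed.

Let bessel g x : \sum_j Q g j x ^+ 2 <= \sum_(E : {ffun 'I_n -> bool}) c * g (x + cube_vertex E) ^+ 2.
Proof.
have : 0 <= \sum_(E : {ffun 'I_n -> bool}) c * (g (x + cube_vertex E) - \sum_j Q g j x * sg (E j)) ^+ 2.
  by apply: sumr_ge0 => E _; rewrite mulr_ge0 ?sqr_ge0// ltW.
have -> : \sum_(E : {ffun 'I_n -> bool}) c * (g (x + cube_vertex E) - \sum_j Q g j x * sg (E j)) ^+ 2 =
    \sum_(E : {ffun 'I_n -> bool}) c * g (x + cube_vertex E) ^+ 2 -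
    2 * \sum_j Q g j x ^+ 2 + \sum_j Q g j x ^+ 2.
  have -> : \sum_j Q g j x ^+ 2 =
      \sum_(E : {ffun 'I_n -> bool}) c * (g (x + cube_vertex E) * \sum_j Q g j x * sg (E j)).
    under [RHS]eq_bigr do rewrite !mulr_sumr.
    rewrite exchange_big/=; apply: eq_bigr => j _; rewrite expr2 [X in _ * X]/Q mulr_sumr.
    by apply: eq_bigr => E _; ring.
  have e2 : \sum_(E : {ffun 'I_n -> bool}) c * (\sum_j Q g j x * sg (E j)) ^+ 2 =
      \sum_(E : {ffun 'I_n -> bool}) c * (g (x + cube_vertex E) * \sum_j Q g j x * sg (E j)).
    transitivity (\sum_j Q g j x ^+ 2).
      transitivity (\sum_i \sum_j Q g i x * Q g j x *
        \sum_(E : {ffun 'I_n -> bool}) c * (sg (E i) * sg (E j))).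
        under eq_bigr do rewrite expr2 mulr_suml mulr_sumr.
        rewrite exchange_big/=; apply: eq_bigr => i _.
        under eq_bigr do rewrite !mulr_sumr.
        rewrite exchange_big/=; apply: eq_bigr => j _.
        by rewrite mulr_sumr; apply: eq_bigr => E _; ring.
      apply: eq_bigr => i _; rewrite (bigD1 i)//= sum_sg eqxx mulr1 big1 ?addr0 ?expr2// => j ij.
      by rewrite sum_sg eq_sym (negbTE ij) mulr0.
    under [RHS]eq_bigr do rewrite !mulr_sumr.
    rewrite exchange_big/=; apply: eq_bigr => j _; rewrite expr2 [X in _ * X]/Q mulr_sumr.
    by apply: eq_bigr => E _; ring.
  rewrite -[X in _ = _ + X]e2 mulr_sumr -sumrB -big_split/=.
  by apply: eq_bigr => E _; ring.
by lra.
Qed.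

Let sum_vertex g : \sum_x \sum_(E : {ffun 'I_n -> bool}) c * g (x + cube_vertex E) = \sum_x g x.
Proof.
rewrite exchange_big/=; under eq_bigr do rewrite -mulr_sumr shift_sum.
by rewrite -mulr_suml sum_c mul1r.
Qed.

(** The bound does not grow with [n], because Bessel controls the coefficients of all directions at
    once. *)
Let sum_P_diff g : \sum_j \sum_x (P g (x + v j + v j) - P g x) ^+ 2 <= 4 * \sum_x g x ^+ 2.
Proof.
apply: le_trans (_ : \sum_j 4 * \sum_x Q g j x ^+ 2 <= _); last first.
  rewrite -mulr_sumr ler_wpM2l// exchange_big/=.
  rewrite -[leRHS](sum_vertex (fun x => g x ^+ 2)).
  by apply: ler_sum => x _; exact: bessel.
apply: ler_sum => j _.
rewrite -(shift_sum _ (- v j)); apply: le_trans (_ : \sum_x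
    (2 * Q g j (x + v j) ^+ 2 + 2 * Q g j (x - v j) ^+ 2) <= _).
  apply: ler_sum => x _; rewrite subrK P_diff.
  have := sqr_ge0 (Q g j (x + v j) - Q g j (x - v j)).
  by move: (Q g j (x + v j)) (Q g j (x - v j)) => a b; rewrite !expr2; lra.
rewrite big_split/= -!mulr_sumr (shift_sum (fun x => Q g j x ^+ 2)).
by rewrite (shift_sum (fun x => Q g j x ^+ 2)); lra.
Qed.

Let jensen g x : (g x - P g x) ^+ 2 <= \sum_(E : {ffun 'I_n -> bool}) c * (g (x + cube_vertex E) - g x) ^+ 2.
Proof.
set a := g x - P g x.
have -> : \sum_(E : {ffun 'I_n -> bool}) c * (g (x + cube_vertex E) - g x) ^+ 2 =
   \sum_(E : {ffun 'I_n -> bool}) c * (g (x + cube_vertex E) - g x + a) ^+ 2 + a ^+ 2.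
  have -> : a ^+ 2 = \sum_(E : {ffun 'I_n -> bool})
      c * (- 2 * a * (g (x + cube_vertex E) - g x + a) + a ^+ 2).
    under eq_bigr do rewrite mulrDr.
    rewrite big_split/= -mulr_suml sum_c mul1r.
    suff -> : \sum_(E : {ffun 'I_n -> bool})
        c * (- 2 * a * (g (x + cube_vertex E) - g x + a)) = 0 by rewrite add0r.
    under eq_bigr do rewrite mulrCA.
    rewrite -mulr_sumr; apply/eqP; rewrite mulf_eq0; apply/orP; right; apply/eqP.
    transitivity (P g x - (\sum_(E : {ffun 'I_n -> bool}) c) * (g x - a)).
      rewrite /P mulr_suml -sumrB; apply: eq_bigr => E _; ring.
    by rewrite sum_c /a; ring.
  by rewrite -big_split/=; apply: eq_bigr => E _; ring.
by rewrite lerDr sumr_ge0// => E _; rewrite mulr_ge0 ?sqr_ge0// ltW.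
Qed.

Let sqr_sum_le (r : nat) (d : nat -> R) : (\sum_(l < r) d l) ^+ 2 <= r%:R * \sum_(l < r) d l ^+ 2.
Proof.
elim: r => [|r IH]; first by rewrite !big_ord0 expr0n mul0r.
rewrite !big_ord_recr/=; move: IH; set s := \sum_(_ < _) _; set q := \sum_(_ < _) _ => IH.
have q0 : 0 <= q by apply: sumr_ge0 => l _; exact: sqr_ge0.
have h : 2 * s * d r <= q + r%:R * d r ^+ 2.
  have b0 : 0 <= q + r%:R * d r ^+ 2 by rewrite addr_ge0// mulr_ge0// sqr_ge0.
  rewrite (le_trans (ler_norm _))// -(@ler_pXn2r _ 2)// ?nnegrE// real_normK ?num_real//.
  have -> : (2 * s * d r) ^+ 2 = 4 * d r ^+ 2 * s ^+ 2 by ring.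
  apply: le_trans (_ : 4 * d r ^+ 2 * (r%:R * q) <= _).
    by rewrite ler_wpM2l// mulr_ge0// sqr_ge0.
  rewrite -subr_ge0; have -> : (q + r%:R * d r ^+ 2) ^+ 2 - 4 * d r ^+ 2 * (r%:R * q) =
    (q - r%:R * d r ^+ 2) ^+ 2 by ring.
  exact: sqr_ge0.
rewrite -[r.+1]addn1 natrD mulrDl mul1r; have -> : (s + d r) ^+ 2 = s ^+ 2 + 2 * s * d r + d r ^+ 2 by ring.
by rewrite mulrDr; lra.
Qed.

(** Replacing [g] by its cube average [P g] costs the diagonal displacement, by Jensen, and [P g] is
    moved by [2 * r] in [r] double steps, with a factor [r ^ 2] from Cauchy-Schwarz. Splitting a
    square into three terms gives [6 = 3 + 3] and [12 = 3 * 4]. *)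
Lemma cube_inequality (r : nat) g :
  \sum_j \sum_x (g (x + v j *+ (2 * r)) - g x) ^+ 2 <=
  6 * n%:R * (\sum_(E : {ffun 'I_n -> bool}) c * \sum_x (g (x + cube_vertex E) - g x) ^+ 2) +
  12 * r%:R ^+ 2 * \sum_x g x ^+ 2.
Proof.
set D := \sum_(E : {ffun 'I_n -> bool}) _.
have gP : \sum_x (g x - P g x) ^+ 2 <= D.
  apply: le_trans (_ : \sum_x \sum_(E : {ffun 'I_n -> bool}) c * (g (x + cube_vertex E) - g x) ^+ 2 <= _).
    by apply: ler_sum => x _; exact: jensen.
  by rewrite exchange_big/= le_eqVlt; apply/orP; left; apply/eqP; apply: eq_bigr => E _; rewrite mulr_sumr.
have PP : \sum_j \sum_x (P g (x + v j *+ (2 * r)) - P g x) ^+ 2 <= r%:R ^+ 2 * (4 * \sum_x g x ^+ 2).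
  apply: le_trans (ler_wpM2l (sqr_ge0 _) (sum_P_diff g)); rewrite mulr_sumr.
  apply: ler_sum => j _.
  apply: le_trans (_ : \sum_x r%:R * \sum_(l < r)
      (P g (x + v j *+ (2 * l) + v j + v j) - P g (x + v j *+ (2 * l))) ^+ 2 <= _).
    apply: ler_sum => x _; apply: le_trans (sqr_sum_le r (fun l =>
      P g (x + v j *+ (2 * l) + v j + v j) - P g (x + v j *+ (2 * l)))).
    rewrite le_eqVlt; apply/orP; left; apply/eqP; congr (_ ^+ 2).
    elim: r => [|k IH]; first by rewrite big_ord0 muln0 mulr0n addr0 subrr.
    rewrite big_ord_recr/= -IH [RHS]addrC subrKA.
    by rewrite mulnS addnC addn2 !mulrSr !addrA.
  rewrite -mulr_sumr expr2 -mulrA ler_wpM2l// exchange_big/=.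
  under eq_bigr do rewrite (shift_sum (fun x => (P g (x + v j + v j) - P g x) ^+ 2)).
  by rewrite sumr_const card_ord mulr_natl.
apply: le_trans (_ : \sum_j (6 * D + 3 * \sum_x (P g (x + v j *+ (2 * r)) - P g x) ^+ 2) <= _).
  apply: ler_sum => j _.
  apply: le_trans (_ : \sum_x (3 * (g (x + v j *+ (2 * r)) - P g (x + v j *+ (2 * r))) ^+ 2 +
      3 * (g x - P g x) ^+ 2 + 3 * (P g (x + v j *+ (2 * r)) - P g x) ^+ 2) <= _).
    apply: ler_sum => x _; move: (g (x + _)) (P g (x + _)) (g x) (P g x) => a b a' b'.
    have := sqr_ge0 (a - b + (a' - b')); have := sqr_ge0 (a - b - (b - b')).
    have := sqr_ge0 (a' - b' + (b - b')).
    by rewrite !expr2; lra.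
  rewrite !big_split/= -!mulr_sumr (shift_sum (fun x => (g x - P g x) ^+ 2)).
  by rewrite lerD2r; lra.
rewrite big_split/= sumr_const card_ord -mulr_sumr -mulr_natr.
by lra.
Qed.

End cube_averages.

(** * Spheres of spaces containing [ell_infty^n] *)

Section linfty_embedding.
Context {R : realType} (X : normedModType R).

(** A nearly optimal inverse isomorphism [T'], rescaled by the norm of [T], has lower bound 1. The
    constant is enlarged by 1 to get strictly above the infimum. *)
Lemma linfty_embedding : contains_linfty_uniformly X -> exists2 C : R, 0 < C &
  forall n, (0 < n)%N -> exists S : 'rV[R]_n -> X,
    (forall (k : R) w v, S (k *: w + v) = k *: S w + S v) /\
    (forall w, `|w| <= `|S w| <= C * `|w|).
Proof.
move=> [C0 HC]; exists (`|C0| + 1) => [|n n0]; first by rewrite ltr_wpDl.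
have [E [[b [_ bE]]]] := HC n.
move=> hdist; have {hdist} : (banach_mazur_dist E [set: 'rV[R]_n] < (`|C0| + 1)%:E)%E.
  by apply: le_lt_trans hdist _; rewrite lte_fin; have := ler_norm C0; lra.
move=> /ereal_inf_lt[_ [T [T' [[Tlin TE TE' TK TK']] ->]]] TT.
have TK1 x : E x -> T' (T x) = x by move=> Ex; apply: TK; rewrite inE.
have TK2 w : T (T' w) = w by apply: TK'; rewrite inE.
have ET' w : E (T' w) by exact: TE'.
have Ecomb k x y : E x -> E y -> E (k *: x + y).
  rewrite bE => -[s _ <-] [t _ <-]; exists (fun i => k * s i + t i) => //.
  by rewrite scaler_sumr -big_split/=; apply: eq_bigr => i _; rewrite scalerDl scalerA.
have E0 : E 0 by rewrite bE; exists (fun=> 0) => //; rewrite big1// => i _; rewrite scale0r.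
have EZ k x : E x -> E (k *: x) by move=> Ex; rewrite -[_ *: _]addr0; exact: Ecomb.
have T0 : T 0 = 0.
  by have := Tlin 1 0 0 E0 E0; rewrite scale1r addr0 scale1r => /esym/eqP;
    rewrite addrC -subr_eq0 addrK => /eqP.
have TZ k x : E x -> T (k *: x) = k *: T x.
  by move=> Ex; have := Tlin k x 0 Ex E0; rewrite addr0 T0 addr0.
have T'lin k w u : T' (k *: w + u) = k *: T' w + T' u.
  have <- : T (k *: T' w + T' u) = k *: w + u by rewrite Tlin ?TK2.
  by rewrite TK1//; exact: Ecomb.
have T'0 : T' 0 = 0 by rewrite -T0 TK1.
have T'Z k w : T' (k *: w) = k *: T' w by have := T'lin k w 0; rewrite addr0 T'0 addr0.
pose w1 : 'rV[R]_n := const_mx 1.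
have w10 : w1 != 0.
  by apply/eqP => /matrixP/(_ ord0 (Ordinal n0))/eqP; rewrite !mxE oner_eq0.
have x10 : T' w1 != 0.
  by apply: contraNneq w10 => e; rewrite -(TK2 w1) e T0.
have A_ge x : E x -> `|x| <= 1 -> (`|T x|%:E <= opnorm_on E T)%E.
  by move=> Ex x1; apply: ereal_sup_ubound; exists x.
have B_ge w : `|w| <= 1 -> (`|T' w|%:E <= opnorm_on setT T')%E.
  by move=> w11; apply: ereal_sup_ubound; exists w.
(* Both norms are positive since the dimension is, so neither can be infinite: the product would
   then be [+oo]. *)
have A0 : (0 < opnorm_on E T)%E.
  apply: lt_le_trans (A_ge (normalize (T' w1)) _ _).
  - rewrite lte_fin normr_gt0 TZ// TK2 scaler_eq0 invr_eq0 normr_eq0.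
    by rewrite (negbTE x10) (negbTE w10).
  - exact: EZ.
  - by rewrite norm_normalize.
have B0 : (0 < opnorm_on setT T')%E.
  apply: lt_le_trans (B_ge (normalize w1) _).
  - rewrite lte_fin normr_gt0 T'Z scaler_eq0 invr_eq0 normr_eq0.
    by rewrite (negbTE x10) (negbTE w10).
  - by rewrite norm_normalize.
case: (opnorm_on E T) A_ge A0 TT => [al| |]//; case: (opnorm_on setT T') B_ge B0 => [be| |]//; last 2 first.
- by move=> _ _ _ al0; rewrite gt0_muley.
- by move=> _ be0 _ _; rewrite gt0_mulye.
- move=> B_ge; rewrite lte_fin => be0 A_ge; rewrite lte_fin => al0; rewrite -EFinM lte_fin => albe.
  have TN x : E x -> `|T x| <= al * `|x|.
    move=> Ex; have [->|x0] := eqVneq x 0; first by rewrite T0 !normr0 mulr0.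
    have := A_ge (normalize x) (EZ _ _ Ex); rewrite norm_normalize// => /(_ (lexx _)).
    by rewrite lee_fin TZ// normrZ normfV normr_id mulrC ler_pdivrMr ?normr_gt0.
  have T'N w : `|T' w| <= be * `|w|.
    have [->|w0] := eqVneq w 0; first by rewrite T'0 !normr0 mulr0.
    have := B_ge (normalize w); rewrite norm_normalize// => /(_ (lexx _)).
    by rewrite lee_fin T'Z normrZ normfV normr_id mulrC ler_pdivrMr ?normr_gt0.
  exists (fun w => al *: T' w); split=> [k w u|w].
    by rewrite T'lin scalerDr !scalerA mulrC.
  rewrite normrZ gtr0_norm//; apply/andP; split.
    by rewrite -{1}(TK2 w); exact: TN.
  apply: le_trans (_ : al * (be * `|w|) <= _); first by rewrite ler_wpM2l// ltW.
  by rewrite mulrA ler_wpM2r// ltW.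
Qed.

End linfty_embedding.

(** * A periodic wave on the cyclic group *)

Section triangle_wave.
Context {R : realType}.
Variable r : nat.
Hypothesis r0 : (0 < r)%N.

Definition triangle_wave (a : nat) : R :=
  `|(a %% (4 * r))%N%:R - 2 * r%:R| / r%:R - 1.

Let rR : 0 < r%:R :> R. Proof. by rewrite ltr0n. Qed.

Lemma triangle_wave_mod a : triangle_wave (a %% (4 * r)) = triangle_wave a.
Proof. by rewrite /triangle_wave modn_mod. Qed.

Let wave (y : R) := `|y - 2 * r%:R| / r%:R - 1.

(** A shift by at most one period wraps around at most once, which turns statements about residues
    into linear arithmetic on the real [b]. *)
Let triangle_waveD a c : (c <= 4 * r)%N -> exists b : R,
  [/\ 0 <= b, b <= 4 * r%:R, triangle_wave a = wave b &
      (b + c%:R <= 4 * r%:R /\ triangle_wave (a + c) = wave (b + c%:R)) \/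
      (4 * r%:R <= b + c%:R /\ triangle_wave (a + c) = wave (b + c%:R - 4 * r%:R))].
Proof.
move=> c4; set m := (4 * r)%N; have m0 : (0 < m)%N by rewrite muln_gt0.
have mR : m%:R = 4 * r%:R :> R by rewrite natrM.
exists (a %% m)%N%:R; split; [exact: ler0n| |by []|].
  by rewrite -mR ler_nat ltnW// ltn_pmod.
rewrite /triangle_wave -/m -modnDml; have [h|h] := ltnP (a %% m + c) m.
  by left; rewrite (modn_small h) -mR -natrD ler_nat ltnW.
right; rewrite -mR -natrD ler_nat h; split=> //.
have h' : (a %% m + c - m < m)%N.
  by rewrite ltn_subLR// -addSn leq_add// ltn_pmod.
by rewrite -natrB// -[in LHS](subnK h) modnDr (modn_small h').
Qed.

Let waveE (y : R) : (wave y + 1) * r%:R = `|y - 2 * r%:R|.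
Proof. by rewrite /wave subrK divfK// gt_eqF. Qed.

Let pull (y z : R) : y * r%:R <= z * r%:R -> y <= z.
Proof. by rewrite ler_pM2r. Qed.

Lemma norm_triangle_wave_le1 a : `|triangle_wave a| <= 1.
Proof.
have [b [b0 b4 -> _]] := triangle_waveD a (leq0n _).
have := waveE b; rewrite ler_norml => h.
by apply/andP; split; apply: pull; move: h; case: (ger0P (b - 2 * r%:R)); lra.
Qed.

Lemma triangle_wave_lipschitz a : `|triangle_wave (a + 1) - triangle_wave a| <= r%:R^-1.
Proof.
have c4 : (1 <= 4 * r)%N by rewrite muln_gt0.
have r1 : 1 <= r%:R :> R by rewrite ler1n.
have [b [b0 b4 -> H]] := triangle_waveD a c4.
have e := waveE b; rewrite ler_norml; apply/andP.
case: H => -[h ->]; [have := waveE (b + 1)|have := waveE (b + 1 - 4 * r%:R)] => e'.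
all: split; apply: pull; rewrite ?mulNr mulVf ?gt_eqF//; move: e e'.
all: case: (ger0P (b - 2 * r%:R)) => ?; case: ger0P => ?; lra.
Qed.

Lemma triangle_wave_antiperiodic a : triangle_wave (a + 2 * r) = - triangle_wave a.
Proof.
have c4 : (2 * r <= 4 * r)%N by rewrite leq_mul2r orbT.
have [b [b0 b4 -> H]] := triangle_waveD a c4; have e := waveE b.
apply: (mulIf (lt0r_neq0 rR)); rewrite natrM in H.
case: H => -[h ->]; [have := waveE (b + 2 * r%:R)|have := waveE (b + 2 * r%:R - 4 * r%:R)] => e'.
all: move: e e'; case: (ger0P (b - 2 * r%:R)) => ?; case: ger0P => ?; lra.
Qed.

(** Values a quarter period apart play the roles of cosine and sine: they cannot both be small. *)
Lemma triangle_wave_large a :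
  2^-1 <= `|triangle_wave a| \/ 2^-1 <= `|triangle_wave (a + r)|.
Proof.
have c4 : (r <= 4 * r)%N by rewrite leq_pmull.
have [b [b0 b4 -> H]] := triangle_waveD a c4; have e := waveE b.
have [h|h] := lerP 2^-1 `|wave b|; [by left|right].
move: h; rewrite ltr_norml -(ltr_pM2r rR) -[X in _ && X](ltr_pM2r rR) => /andP[h1 h2].
have N (y : R) : 2^-1 * r%:R <= y * r%:R \/ y * r%:R <= - 2^-1 * r%:R -> 2^-1 <= `|y|.
  by rewrite !ler_pM2r// ler_normr => -[->|h]//; rewrite lerNr h orbT.
case: H => -[h ->]; [have := waveE (b + r%:R)|have := waveE (b + r%:R - 4 * r%:R)] => e'.
all: apply: N; move: e e'; case: (ger0P (b - 2 * r%:R)) => ?; case: ger0P => ? ? ?.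
all: try (by left; lra).
all: try (by right; lra).
all: by exfalso; lra.
Qed.

End triangle_wave.

(** * The Mazur map from [ell_1] to [ell_2] *)

Section mazur_map.
Context {R : realType}.

Definition mazur (a : R) : R := Num.sg a * Num.sqrt `|a|.

Lemma mazur_sqr (a : R) : mazur a ^+ 2 = `|a|.
Proof.
rewrite /mazur exprMn sqr_sqrtr// sqr_sg; case: eqP => [->|_]; rewrite ?mul1r//.
by rewrite normr0 mulr0.
Qed.

Lemma mazurK (a : R) : mazur a * `|mazur a| = a.
Proof.
rewrite {2}/mazur normrM normr_sg (ger0_norm (sqrtr_ge0 _)) /mazur.
have [->|a0] := eqVneq a 0; first by rewrite sgr0 !mul0r.
by rewrite mul1r -mulrA -expr2 sqr_sqrtr// -numEsg.
Qed.

Let signed_squareB (x y : R) : x * `|x| - y * `|y| =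
  2^-1 * ((x - y) * (`|x| + `|y|) + (x + y) * (`|x| - `|y|)).
Proof. by field. Qed.

Let signed_square_dist (x y : R) : (x - y) ^+ 2 <= 2 * `|x * `|x| - y * `|y| |.
Proof.
rewrite signed_squareB normrM ger0_norm// mulVKf//.
set p := _ * (_ + _); set q := (x + y) * _.
have pq : 0 <= p * q.
  have -> : p * q = (x ^+ 2 - y ^+ 2) * (`|x| ^+ 2 - `|y| ^+ 2) by rewrite /p /q; ring.
  by rewrite !real_normK ?num_real// -expr2 sqr_ge0.
apply: le_trans (_ : `|p| <= _).
  rewrite normrM -real_normK ?num_real// expr2 ler_wpM2l//.
  by rewrite [leRHS]ger0_norm ?addr_ge0// ler_normB.
rewrite -(@ler_pXn2r _ 2)// ?nnegrE// !real_normK ?num_real//.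
have -> : (p + q) ^+ 2 = p ^+ 2 + (2 * (p * q) + q ^+ 2) by ring.
by rewrite lerDl addr_ge0 ?sqr_ge0// mulr_ge0.
Qed.

Lemma mazur_dist_le (a b : R) : (mazur a - mazur b) ^+ 2 <= 2 * `|a - b|.
Proof. by rewrite -[in leRHS](mazurK a) -[in leRHS](mazurK b); exact: signed_square_dist. Qed.

Let dist_signed_square (x y : R) : `|x * `|x| - y * `|y| | <= `|x - y| * (`|x| + `|y|).
Proof.
rewrite signed_squareB normrM ger0_norm//.
have h1 : `|(x - y) * (`|x| + `|y|)| = `|x - y| * (`|x| + `|y|).
  by rewrite normrM [X in _ * X]ger0_norm// addr_ge0.
have h2 : `|(x + y) * (`|x| - `|y|)| <= `|x - y| * (`|x| + `|y|).
  by rewrite normrM mulrC ler_pM// ?ler_dist_dist// ler_normD.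
have := ler_normD ((x - y) * (`|x| + `|y|)) ((x + y) * (`|x| - `|y|)).
by rewrite h1; lra.
Qed.

(** With [x] and [y] the images of [a] and [b], the distance is at most [|x - y| * (|x| + |y|)]. The
    weighted arithmetic-geometric mean then gives a form that can be summed over coordinates,
    directions and points, with [t] to be optimised afterwards. *)
Lemma dist_le_mazur (a b t : R) : 0 < t ->
  `|a - b| <= t * (`|a| + `|b|) + (2 * t)^-1 * (mazur a - mazur b) ^+ 2.
Proof.
move=> t0; rewrite -[`|a|]mazur_sqr -[`|b|]mazur_sqr -[in leLHS](mazurK a) -[in leLHS](mazurK b).
move: (mazur a) (mazur b) => x y; apply: le_trans (dist_signed_square x y) _.
rewrite -[(x - y) ^+ 2]real_normK ?num_real// -[x ^+ 2]real_normK ?num_real//.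
rewrite -[y ^+ 2]real_normK ?num_real//.
move: `|x| `|y| `|x - y| (normr_ge0 x) (normr_ge0 y) (normr_ge0 (x - y)) => u v w u0 v0 w0.
rewrite -subr_ge0; have -> : t * (u ^+ 2 + v ^+ 2) + (2 * t)^-1 * w ^+ 2 - w * (u + v) =
  (2 * t)^-1 * ((w - t * (u + v)) ^+ 2 + t ^+ 2 * (u - v) ^+ 2) by field; rewrite gt_eqF.
apply: mulr_ge0; first by rewrite invr_ge0 mulr_ge0// ltW.
by rewrite addr_ge0 ?sqr_ge0// mulr_ge0 ?sqr_ge0.
Qed.

End mazur_map.

Section cube_ell1.
Context {R : realType}.

Lemma sum_norm_ell1_le (I : finType) (u : I -> ell1 R) (B : R) :
  (forall K, \sum_i \sum_(k < K) `|u i k| <= B) -> \sum_i `|u i| <= B.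
Proof.
move=> h.
have cv : (fun K => \sum_i series (fun k => `|u i k|) K) @ \oo --> \sum_i `|u i|.
  by apply: cvg_big => [|i _]; [exact: add_continuous|exact: ell1_cvg].
rewrite -(cvg_lim (@norm_hausdorff _ _) cv); apply: limr_le; first by apply: cvgP cv.
apply: nearW => K; rewrite /=; apply: le_trans (h K); apply: ler_sum => i _.
by rewrite /series/= big_mkord.
Qed.

(** The cube inequality is applied to each coordinate of the Mazur image and summed. Unit norms
    bound the energy at a point by 1, and the Hölder bound of the Mazur map turns a diagonal
    displacement [eta] into [2 * eta]. *)
Lemma cube_ell1_inequality (V : finZmodType) (n r : nat) (v : 'I_n -> V)
    (h : V -> ell1 R) (d eta t : R) :
  (forall x, `|h x| = 1) -> 0 < t ->
  (forall x E, `|h (x + cube_vertex v E) - h x| <= eta) ->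
  (forall x j, d <= `|h (x + v j *+ (2 * r)) - h x|) ->
  n%:R * d <= 2 * n%:R * t + (2 * t)^-1 * (12 * n%:R * eta + 12 * r%:R ^+ 2).
Proof.
move=> h1 t0 heta hd; pose M : R := #|V|%:R.
have M0 : 0 < M by rewrite ltr0n; apply/card_gt0P; exists 0.
pose g k x := mazur (h x k).
have c0 : 0 < (2 ^+ n)^-1 :> R by rewrite invr_gt0 exprn_gt0.
have partial K x : \sum_(k < K) `|h x k| <= 1 by rewrite -(h1 x) ell1_norm_ge.
suff main : \sum_(p : 'I_n * V) `|h (p.2 + v p.1 *+ (2 * r)) - h p.2| <=
    M * (2 * n%:R * t + (2 * t)^-1 * (12 * n%:R * eta + 12 * r%:R ^+ 2)).
  rewrite -(ler_pM2l M0); apply: le_trans main.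
  apply: le_trans (_ : \sum_(p : 'I_n * V) d <= _); last by apply: ler_sum => p _; exact: hd.
  by rewrite sumr_const card_prod card_ord -[leRHS]mulr_natl natrM mulrA [M * _]mulrC.
apply: sum_norm_ell1_le => K.
rewrite -(pair_bigA _ (fun j x => \sum_(k < K) `|(h (x + v j *+ (2 * r)) - h x) k|))/=.
apply: le_trans (_ : \sum_j \sum_x \sum_(k < K) (t * (`|h (x + v j *+ (2 * r)) k| + `|h x k|) +
    (2 * t)^-1 * (g k (x + v j *+ (2 * r)) - g k x) ^+ 2) <= _).
  apply: ler_sum => j _; apply: ler_sum => x _; apply: ler_sum => k _.
  exact: dist_le_mazur.
apply: le_trans (_ : \sum_(j < n) \sum_(x : V) (2 * t) + (2 * t)^-1 *
    \sum_(k < K) \sum_j \sum_x (g k (x + v j *+ (2 * r)) - g k x) ^+ 2 <= _).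
  rewrite [X in _ + _ * X]exchange_big/= mulr_sumr -big_split/=; apply: ler_sum => j _.
  rewrite [X in _ + _ * X]exchange_big/= mulr_sumr -big_split/=; apply: ler_sum => x _.
  rewrite big_split/= -!mulr_sumr lerD2r big_split/=.
  rewrite mulrDr [2 * t]mulr_natl mulr2n.
  by apply: lerD; apply: ler_piMr (ltW t0) _; exact: partial.
have -> : \sum_(j < n) \sum_(x : V) (2 * t) = M * (2 * n%:R * t).
  under eq_bigr do rewrite sumr_const -[2 * t *+ _]mulr_natl -/M.
  by rewrite sumr_const card_ord -[LHS]mulr_natl mulrCA; congr (M * _); rewrite mulrCA mulrA.
have i0 : 0 <= (2 * t)^-1 by rewrite invr_ge0 mulr_ge0// ltW.
rewrite mulrDr lerD2l mulrCA; apply: (ler_wpM2l i0).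
apply: le_trans (_ : \sum_(k < K) (6 * n%:R * (\sum_(E : {ffun 'I_n -> bool}) (2 ^+ n)^-1 *
    \sum_x (g k (x + cube_vertex v E) - g k x) ^+ 2) + 12 * r%:R ^+ 2 * \sum_x g k x ^+ 2) <= _).
  by apply: ler_sum => k _; exact: cube_inequality.
rewrite big_split/= -!mulr_sumr mulrDr.
have S1 : \sum_(k < K) \sum_x g k x ^+ 2 <= M.
  rewrite exchange_big/=; apply: le_trans (_ : \sum_(x : V) 1 <= _).
    apply: ler_sum => x _; apply: le_trans (partial K x).
    by apply: ler_sum => k _; rewrite mazur_sqr.
  by rewrite sumr_const.
have S2 : \sum_(k < K) \sum_(E : {ffun 'I_n -> bool}) (2 ^+ n)^-1 *
    \sum_x (g k (x + cube_vertex v E) - g k x) ^+ 2 <= M * (2 * eta).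
  rewrite exchange_big/=.
  apply: le_trans (_ : \sum_(E : {ffun 'I_n -> bool}) (2 ^+ n)^-1 * (M * (2 * eta)) <= _).
    apply: ler_sum => E _; rewrite -mulr_sumr ler_wpM2l ?(ltW c0)// exchange_big/=.
    apply: le_trans (_ : \sum_(x : V) 2 * eta <= _); last by rewrite sumr_const -[leLHS]mulr_natl.
    apply: ler_sum => x _; apply: le_trans (_ : \sum_(k < K) 2 * `|(h (x + cube_vertex v E) - h x) k| <= _).
      by apply: ler_sum => k _; exact: mazur_dist_le.
    rewrite -mulr_sumr ler_wpM2l//; apply: le_trans (heta x E).
    exact: ell1_norm_ge.
  rewrite sumr_const card_ffun card_bool card_ord -[leLHS]mulr_natr natrX.
  by rewrite mulrAC mulVf ?mul1r// gt_eqF// exprn_gt0.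
apply: lerD.
  by have := ler_wpM2l (_ : 0 <= 6 * n%:R) S2; rewrite mulr_ge0// => /(_ isT); lra.
have := ler_wpM2l (_ : 0 <= 12 * r%:R ^+ 2 :> R) S1; rewrite mulr_ge0 ?sqr_ge0// => /(_ isT).
by rewrite [M * _]mulrC.
Qed.

End cube_ell1.

(** * The discrete torus in the sup norm *)

Section torus.
Context {R : realType}.
Variables (s n : nat).
(** A successor, so that [4 * r] exceeds 1 and ['Z_(4 * r)] really is the group of residues modulo
    [4 * r]. *)
Let r := s.+1.
Let Z := 'Z_(4 * r).
Let V := 'rV[Z]_n.

Definition torus_dir (j : 'I_n) : V := delta_mx ord0 j.

(** Each coordinate runs along a closed curve given by the wave and its quarter-period shift, so
    that no point of the curve is near 0; hence [n + n] columns. *)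
Definition torus_map (x : V) : 'rV[R]_(n + n) :=
  row_mx (\row_j triangle_wave r (x ord0 j))
         (\row_j triangle_wave r (x ord0 j + r)%N).

Let m_gt1 : (1 < 4 * r)%N. Proof. by rewrite mulnS. Qed.

Let valD (a b : Z) : nat_of_ord (a + b) = ((a + b) %% (4 * r))%N.
Proof. by rewrite /= {3}Zp_cast. Qed.

Let waveD (a b : Z) c : triangle_wave r (nat_of_ord (a + b)%R + c)%N =
  triangle_wave r (a + b + c)%N :> R.
Proof.
by rewrite -triangle_wave_mod valD modnDml triangle_wave_mod.
Qed.

Let wave_step (a b : Z) c : b = 1 \/ b = -1 ->
  `|triangle_wave r (nat_of_ord (a + b)%R + c)%N - triangle_wave r (a + c)%N : R| <= r%:R^-1.
Proof.
have val1 : nat_of_ord (1 : Z) = 1%N by rewrite /= modn_small// Zp_cast.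
case=> ->.
  rewrite waveD val1 addnAC; exact: triangle_wave_lipschitz.
set a' := a + -1; have -> : a = a' + 1 by rewrite /a' subrK.
rewrite waveD val1 [(a' + 1 + c)%N]addnAC distrC; exact: triangle_wave_lipschitz.
Qed.

Let wave_antiperiodic (a : Z) c :
  triangle_wave r (nat_of_ord (a + 1 *+ (2 * r))%R + c)%N = - triangle_wave r (a + c)%N :> R.
Proof.
rewrite waveD val_Zp_nat// modn_small ?ltn_pmul2r// addnAC.
exact: triangle_wave_antiperiodic.
Qed.

Let norm_le (w : 'rV[R]_(n + n)) (M : R) : 0 <= M ->
  (forall j, `|w ord0 (lshift n j)| <= M) -> (forall j, `|w ord0 (rshift n j)| <= M) ->
  `|w| <= M.
Proof.
move=> M0 wl wr; apply: rV_norm_le => // j; rewrite -(fintype.splitK j).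
by case: (fintype.split j) => k /=.
Qed.

Let mapl x j : torus_map x ord0 (lshift n j) = triangle_wave r (x ord0 j).
Proof. by rewrite /torus_map row_mxEl mxE. Qed.

Let mapr x j : torus_map x ord0 (rshift n j) = triangle_wave r (x ord0 j + r)%N.
Proof. by rewrite /torus_map row_mxEr mxE. Qed.

Lemma norm_torus_map_le1 x : `|torus_map x| <= 1.
Proof. by apply: norm_le => // j; rewrite ?mapl ?mapr norm_triangle_wave_le1. Qed.

(** All [n] coordinates move at once, yet the sup norm only sees a single step of the wave. *)
Lemma torus_map_lipschitz x E :
  `|torus_map (x + cube_vertex torus_dir E) - torus_map x| <= r%:R^-1.
Proof.
have step j : cube_vertex torus_dir E ord0 j = 1 \/ cube_vertex torus_dir E ord0 j = -1.
  rewrite /cube_vertex summxE (bigD1 j)//= big1 ?addr0 => [|k kj].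
    by case: (E j); [left|right]; rewrite !mxE !eqxx.
  by case: (E k); rewrite !mxE eq_sym (negbTE kj) andbF ?oppr0.
apply: norm_le => [|j|j]; first by rewrite invr_ge0.
  rewrite mxE [(- torus_map x) _ _]mxE !mapl mxE -[X in triangle_wave r X]addn0.
  by rewrite -[X in _ - triangle_wave r X]addn0 wave_step.
by rewrite mxE [(- torus_map x) _ _]mxE !mapr mxE wave_step.
Qed.

(** The factor [l] anticipates the radial projection onto the sphere, which rescales the two images
    differently. Along the curve of coordinate [j] the sign is reversed, so the difference is
    [1 + l] times an entry of size at least 1/2. *)
Lemma torus_map_antipode x j (l : R) : 0 <= l ->
  2^-1 <= `|torus_map x - l *: torus_map (x + torus_dir j *+ (2 * r))|.
Proof.
move=> l0; set w := torus_map x; set w' := torus_map _.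
have xj : (x + torus_dir j *+ (2 * r)) ord0 j = x ord0 j + 1 *+ (2 * r).
  by rewrite mxE mulmxnE !mxE !eqxx.
have key (i : 'I_(n + n)) : w' ord0 i = - w ord0 i -> 2^-1 <= `|w ord0 i| ->
    2^-1 <= `|w - l *: w'|.
  move=> wi h; apply: le_trans (le_rV_norm _ i).
  have -> : (w - l *: w') ord0 i = w ord0 i - l * w' ord0 i.
    by rewrite mxE; congr (_ + _); rewrite mxE; congr (- _); rewrite mxE.
  rewrite wi mulrN opprK.
  have -> : w ord0 i + l * w ord0 i = (1 + l) * w ord0 i by ring.
  rewrite normrM [`|1 + l|]ger0_norm ?addr_ge0//.
  by apply: le_trans h _; rewrite ler_peMl// lerDl.
have [h|h] := @triangle_wave_large R r (ltn0Sn _) (x ord0 j).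
  apply: (key (lshift n j)); rewrite /w /w' !mapl// xj.
  by rewrite -[X in triangle_wave r X]addn0 wave_antiperiodic addn0.
by apply: (key (rshift n j)); rewrite /w /w' !mapr// xj wave_antiperiodic.
Qed.

Lemma norm_torus_map_ge x : (0 < n)%N -> 2^-1 <= `|torus_map x|.
Proof.
move=> n0; have := torus_map_antipode x (Ordinal n0) (lexx 0).
by rewrite scale0r subr0.
Qed.

End torus.

Lemma not_linfty_of_sphere_homeomorphic (R : realType) (X : normedModType R) :
  uniformly_homeomorphic (unit_sphere X) (unit_sphere (ell1 R)) ->
  ~ contains_linfty_uniformly X.
Proof.
move=> [f [g [fK _ /unif_continuous_sphereP fU /unif_continuous_sphereP gU]]].
move=> /linfty_embedding[C C0 HS].
have c0 : 0 < (2 * C)^-1 by rewrite invr_gt0 mulr_gt0.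
have [d d0 hd] := gU _ c0.
(* With [t = d / 8], the two terms proportional to [n] are then [n * d / 4] each, and half of
   [n * d] is left to beat the term in [r ^ 2]. *)
pose eta := d ^+ 2 / 192.
have eta0 : 0 < eta by rewrite divr_gt0// exprn_gt0.
have [rho rho0 hrho] := fU _ eta0.
(* Normalised images of neighbours are within [4 * C / r]: a step of size [C / r], doubled by
   normalisation and divided by a norm at least 1/2. *)
pose s := Num.truncn (4 * C / rho).
pose r := s.+1.
have rR : 4 * C / r%:R < rho.
  rewrite ltr_pdivrMr ?ltr0n// -ltr_pdivrMl// mulrC; exact: truncnS_gt.
(* This [n] makes [n * d / 2] exceed the remaining term [48 * r ^ 2 / d]. *)
pose n := (Num.truncn (96 * r%:R ^+ 2 / d ^+ 2)).+1.
have nR : 96 * r%:R ^+ 2 / d ^+ 2 < n%:R by exact: truncnS_gt.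
have n0 : (0 < n)%N by [].
have [S [Slin SN]] := HS (n + n)%N (ltn_addr n n0).
have S0 : S 0 = 0.
  by have := Slin 1 0 0; rewrite scale1r addr0 scale1r => /esym/eqP; rewrite addrC -subr_eq0 addrK => /eqP.
have SZ k w : S (k *: w) = k *: S w by have := Slin k w 0; rewrite addr0 S0 addr0.
have SB w u : S (w - u) = S w - S u.
  by have := Slin (-1) u w; rewrite !scaleN1r addrC => ->; rewrite addrC.
pose T (x : 'rV['Z_(4 * r)]_n) : X := S (torus_map (R := R) x).
have Tge x : 2^-1 <= `|T x|.
  by apply: le_trans (norm_torus_map_ge x n0) _; case/andP: (SN (torus_map (R := R) x)).
have T0 x : T x != 0 by rewrite -normr_gt0; apply: lt_le_trans (Tge x).
have Tle x : `|T x| <= C.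
  case/andP: (SN (torus_map (R := R) x)) => _ /le_trans; apply.
  by rewrite ler_piMr ?norm_torus_map_le1// ltW.
have T1 x : `|normalize (T x)| = 1 by exact: norm_normalize.
pose F x : unit_sphere X := SigSub (mem_set (T1 x) : normalize (T x) \in unit_sphere X).
pose h x := set_val (f (F x)).
have := @cube_ell1_inequality R _ n r (@torus_dir s n) h d eta (d / 8).
have H1 x : `|h x| = 1 by exact: (set_valP (f (F x))).
have H2 x E : `|h (x + cube_vertex (@torus_dir s n) E) - h x| <= eta.
  apply/ltW/hrho; change (`|normalize (T (x + cube_vertex (@torus_dir s n) E)) - normalize (T x)| < rho).
  apply: le_lt_trans rR; apply: le_trans (normalize_dist (T0 _) (T0 _)) _.
  set y := x + _; have ny : 0 < `|T y| by rewrite normr_gt0.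
  rewrite ler_pdivrMr// /T -SB.
  apply: le_trans (_ : 2 * (C * r%:R^-1) <= _).
    rewrite ler_wpM2l//; case/andP: (SN (torus_map (R := R) y - torus_map (R := R) x)) => _ /le_trans; apply.
    by rewrite ler_wpM2l ?(ltW C0)// torus_map_lipschitz.
  have -> : 2 * (C * r%:R^-1) = 4 * C / r%:R * 2^-1 :> R by field; rewrite pnatr_eq0.
  by rewrite ler_wpM2l ?Tge// divr_ge0// mulr_ge0// ltW.
have H3 x j : d <= `|h (x + @torus_dir s n j *+ (2 * r)) - h x|.
  set y := x + _; rewrite leNgt; apply/negP => /hd; rewrite !fK.
  apply/negP; rewrite -leNgt.
  change ((2 * C)^-1 <= `|normalize (T y) - normalize (T x)|).
  rewrite distrC; have nx : 0 < `|T x| by rewrite normr_gt0.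
  have ny : 0 < `|T y| by rewrite normr_gt0.
  have e : `|T x| * `|normalize (T x) - normalize (T y)| =
      `|S (torus_map (R := R) x - (`|T x| / `|T y|) *: torus_map (R := R) y)|.
    rewrite SB SZ -[X in X * _](normr_id (T x)) -normrZ scalerBr /normalize !scalerA.
    by rewrite divff ?gt_eqF// scale1r.
  have l0 : 0 <= `|T x| / `|T y| by exact: divr_ge0.
  have := torus_map_antipode x j l0; rewrite -/y => hl.
  case/andP: (SN (torus_map (R := R) x - (`|T x| / `|T y|) *: torus_map (R := R) y)) => /(le_trans hl).
  rewrite -e => h2 _; rewrite invfM ler_pdivrMr//.
  by apply: le_trans h2 _; rewrite mulrC ler_wpM2l.
have d8 : 0 < d / 8 by rewrite divr_gt0.
move=> /(_ H1 d8 H2 H3).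
have -> : 2 * n%:R * (d / 8) + (2 * (d / 8))^-1 * (12 * n%:R * eta + 12 * r%:R ^+ 2) =
   n%:R * d / 2 + 48 * r%:R ^+ 2 / d.
  by rewrite /eta; field; rewrite gt_eqF.
apply/negP; rewrite -ltNge.
have : 96 * r%:R ^+ 2 / d < n%:R * d.
  rewrite -ltr_pdivrMr//; apply: le_lt_trans nR; rewrite le_eqVlt; apply/orP; left.
  by apply/eqP; field; rewrite gt_eqF.
have -> : 96 * r%:R ^+ 2 / d = 2 * (48 * r%:R ^+ 2 / d) by field; rewrite gt_eqF.
by lra.
Qed.

Unset Implicit Arguments.
Theorem theorem2p1 (R : realType) (X : completeNormedModType R)
    (X_infinite : infinite_dimensional X)
    (X_basis : exists e : nat -> X, unconditional_basis e) :
  uniformly_homeomorphic (unit_sphere X) (unit_sphere (ell1 R)) <->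
  ~ contains_linfty_uniformly X.

Proof.
split; first exact: not_linfty_of_sphere_homeomorphic.
by case: X_basis => e be; exact: sphere_homeomorphic_of_not_linfty be.
Qed.
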